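(* Let $\mathscr{B}\subset\mathscr{A}$ be a unital inclusion of simple unital $C^*$-algebras which is irreducible, i.e. $\mathscr{B}'\cap\mathscr{A}=\mathbb{C}$, and has finite index, $[\mathscr{A}:\mathscr{B}]_0<\infty$. Then the number of intermediate $C^*$-subalgebras $\mathscr{C}$ with $\mathscr{B}\subset\mathscr{C}\subset\mathscr{A}$ is at most $9^{[\mathscr{A}:\mathscr{B}]_0}$.
   Context: A conditional expectation $E:\mathscr{A}\to\mathscr{B}$ is of index-finite type if there are finitely many $\lambda_1,\dots,\lambda_n\in\mathscr{A}$ with $x=\sum_i E(x\lambda_i)\lambda_i^*=\sum_i\lambda_iE(\lambda_i^*x)$ for all $x\in\mathscr{A}$; its Watatani index is $\mathrm{Ind}_w(E)=\sum_i\lambda_i\lambda_i^*$ (a positive scalar when $\mathscr{A}$ is simple). For an inclusion of simple $C^*$-algebras admitting such a conditional expectation, there is a unique one, $E_0$, of minimal Watatani index, and the minimal index is $[\mathscr{A}:\mathscr{B}]_0=\mathrm{Ind}_w(E_0)$; $[\mathscr{A}:\mathscr{B}]_0<\infty$ means such conditional expectations exist. *)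

(* Defs.v *)
From HB Require Import structures.
From mathcomp Require Import all_boot all_order all_algebra.
From mathcomp Require Import complex.
From mathcomp Require Import reals exp.
Set Implicit Arguments. Unset Strict Implicit. Unset Printing Implicit Defensive.
Import Order.TTheory GRing.Theory Num.Theory.
Local Open Scope ring_scope.
Local Open Scope complex_scope.

Section CStar.
Variables (R : realType) (A : algType R[i]).
Variables (nrm : A -> R) (star : A -> A).

Definition norm_converges (u : nat -> A) (l : A) :=
  forall e : R, 0 < e -> exists N, forall n, (N <= n)%N -> nrm (u n - l) < e.

Definition norm_cauchy (u : nat -> A) :=
  forall e : R, 0 < e -> exists N, forall m n, (N <= m)%N -> (N <= n)%N ->
    nrm (u m - u n) < e.

Definition is_cstar_norm : Prop :=
  [/\ (forall x, 0 <= nrm x),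
      (forall x, nrm x = 0 -> x = 0),
      (forall x y, nrm (x + y) <= nrm x + nrm y),
      (forall (c : R[i]) x, (nrm (c *: x))%:C = `|c| * (nrm x)%:C) &
      (forall x y, nrm (x * y) <= nrm x * nrm y)].

Definition is_cstar_involution : Prop :=
  [/\ (forall x y, star (x + y) = star x + star y),
      (forall (c : R[i]) x, star (c *: x) = c^* *: star x),
      (forall x y, star (x * y) = star y * star x),
      (forall x, star (star x) = x) &
      (forall x, nrm (star x * x) = nrm x ^+ 2)].

Definition is_unital_cstar_algebra : Prop :=
  [/\ is_cstar_norm, is_cstar_involution,
      (forall u, norm_cauchy u -> exists l, norm_converges u l) &
      (1 : A) != 0].

Definition norm_closed (S : A -> Prop) :=
  forall u l, (forall n, S (u n)) -> norm_converges u l -> S l.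

Definition cstar_subalgebra (S : A -> Prop) :=
  [/\ S 0, (forall x y, S x -> S y -> S (x + y)),
      (forall (c : R[i]) x, S x -> S (c *: x)),
      (forall x y, S x -> S y -> S (x * y)) &
      (forall x, S x -> S (star x))] /\ norm_closed S.

Definition unital_cstar_subalgebra (S : A -> Prop) :=
  cstar_subalgebra S /\ S 1.

Definition closed_ideal_of (S I : A -> Prop) :=
  [/\ (forall x, I x -> S x), I 0,
      (forall x y, I x -> I y -> I (x + y)),
      (forall (c : R[i]) x, I x -> I (c *: x)) &
      (forall s x, S s -> I x -> I (s * x) /\ I (x * s))] /\ norm_closed I.

Definition simple_cstar (S : A -> Prop) :=
  forall I, closed_ideal_of S I ->
    (forall x, I x -> x = 0) \/ (forall x, S x -> I x).

Definition irreducible_inclusion (B : A -> Prop) :=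
  forall x, (forall b, B b -> x * b = b * x) -> exists c : R[i], x = c%:A.

Definition op_norm_le (E : A -> A) (r : R) := forall x, nrm (E x) <= r * nrm x.

Definition cond_exp (B : A -> Prop) (E : A -> A) :=
  [/\ (forall (c : R[i]) x y, E (c *: x + y) = c *: E x + E y),
      (forall x, B (E x)),
      (forall b, B b -> E b = b) & op_norm_le E 1].

Definition quasi_basis (E : A -> A) (n : nat) (lam : 'I_n -> A) :=
  forall x, x = \sum_(i < n) E (x * lam i) * star (lam i) /\
            x = \sum_(i < n) lam i * E (star (lam i) * x).

(* E is of index-finite type with Watatani index r (a positive scalar, A simple) *)
Definition watatani_index (E : A -> A) (r : R) :=
  exists n (lam : 'I_n -> A), quasi_basis E lam /\
    \sum_(i < n) lam i * star (lam i) = (r%:C)%:A.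

(* r = [A : B]_0, the minimal Watatani index over all conditional
   expectations of index-finite type (in particular [A:B]_0 < oo) *)
Definition minimal_index (B : A -> Prop) (r : R) :=
  (exists E, cond_exp B E /\ watatani_index E r) /\
  (forall E r', cond_exp B E -> watatani_index E r' -> r <= r').

Definition intermediate (B C : A -> Prop) :=
  cstar_subalgebra C /\ (forall x, B x -> C x).

End CStar.

(* Main.v *)
(* Since [B' /\ A] is trivial, the finite-dimensional algebra [P] of [B]-bimodule
   maps of [A] carries a trace: computing [\sum_(i,j) l_i T(l_i^* l_j) l_j^*] in two
   ways identifies the left and the right partial traces of [T], and the resulting
   KMS relations force the modular automorphism to be trivial. Its dimension is at
   most the index (Bessel's inequality). Every intermediate algebra [C] is
   orthogonally complemented, because [B] is simple and the size of the finite rank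
   operators on [C] is bounded, and the projection onto [C] is a conditional
   expectation, an element of [P].

   If [D], [D'] are distinct minimal intermediate algebras of relative indices [p]
   and [q], then [D /\ D' = B], so the join of their projections has trace
   [p + q - 1]; it lies below the projection onto [D D'], which has trace [p q / c]
   with [c] the trace of the product of the two projections. Hence the vectors
   [e_D - e_B] make pairwise angles of at least 60 degrees, and together with [0]
   there are at most [3 ^ Ind] of them. A proper intermediate algebra has relative
   index at least 2, so the total count [N] satisfies
   [N(r) <= 1 + (3^r - 1) N(r / 2)], whence [N(r) <= 9^r]. *)

(* [cond_exp] is only a linear norm-one projection onto [B], and order is available only through the
   norm: [pos] means closeness to a scalar, so all order theory rests on one iteration for square
   roots. Bilinearity of [E] over [B] first appears in a weak form, a Jordan identity, obtained from
   unitaries of [B] near ['i]; simplicity and irreducibility then exclude the defect.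

   Intermediate algebras are not known to be simple. The induction therefore carries an
   [index_datum], which passes from [B] to every intermediate algebra, and all expectations are
   built over the simple bottom algebra. The trace is needed already there: the orthogonal
   projection onto [C] is clearly left [C]-linear, but it commutes with [star] only because the
   modular automorphism is trivial.

   The packing bound may carry no constant factor, hence the words of arbitrary length; base 3 fits
   diameter 2 and separation 1. The base 9 is the one with [9^(r/2) = 3^r], so that with [X = 3^r]
   the recursion closes as [1 + (X - 1) X <= X^2]. *)
Require Import Defs.
From HB Require Import structures.
From mathcomp Require Import all_boot all_order all_algebra.
From mathcomp Require Import complex.
From mathcomp Require Import ring lra zify.
From mathcomp Require Import boolp classical_sets.
From mathcomp Require Import reals exp.
Set Implicit Arguments. Unset Strict Implicit. Unset Printing Implicit Defensive.
Import Order.TTheory GRing.Theory Num.Theory.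
Local Open Scope ring_scope.
Local Open Scope complex_scope.
(** * Identities in associative algebras *)

(* [nc] proves an identity in an algebra by comparing, word by word, the
   coefficients of the two normal forms in the free algebra on the atoms. *)
Section FreeAlgebra.
Variables (K : comNzRingType) (V : algType K).

Inductive ncexpr : Type :=
| NVar of nat | NZero | NOne | NAdd of ncexpr & ncexpr | NOpp of ncexpr
| NScale of K & ncexpr | NMul of ncexpr & ncexpr | NMuln of ncexpr & nat.

Fixpoint nc_eval (env : seq V) (e : ncexpr) : V :=
  match e with
  | NVar i => env`_i
  | NZero => 0
  | NOne => 1
  | NAdd a b => nc_eval env a + nc_eval env b
  | NOpp a => - nc_eval env a
  | NScale c a => c *: nc_eval env a
  | NMul a b => nc_eval env a * nc_eval env b
  | NMuln a n => nc_eval env a *+ n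
  end.

(** List operations are redefined because [nc_core] unfolds exactly the constants it lists; the
    arithmetic of the coefficients must stay folded for [ring]. *)
Fixpoint nc_app T (s t : seq T) : seq T :=
  match s with [::] => t | x :: s' => x :: nc_app s' t end.

Fixpoint nc_scale (c : K) (s : seq (K * seq nat)) : seq (K * seq nat) :=
  match s with [::] => [::] | (d, w) :: s' => (c * d, w) :: nc_scale c s' end.

Fixpoint nc_mulw (c : K) (v : seq nat) (s : seq (K * seq nat)) :=
  match s with
  | [::] => [::]
  | (d, w) :: s' => (c * d, nc_app v w) :: nc_mulw c v s'
  end.

Fixpoint nc_mul (s t : seq (K * seq nat)) : seq (K * seq nat) :=
  match s with
  | [::] => [::]
  | (c, v) :: s' => nc_app (nc_mulw c v t) (nc_mul s' t)
  end.

Fixpoint nc_nf (e : ncexpr) : seq (K * seq nat) :=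
  match e with
  | NVar i => [:: (1, [:: i])]
  | NZero => [::]
  | NOne => [:: (1, [::])]
  | NAdd a b => nc_app (nc_nf a) (nc_nf b)
  | NOpp a => nc_scale (- 1) (nc_nf a)
  | NScale c a => nc_scale c (nc_nf a)
  | NMul a b => nc_mul (nc_nf a) (nc_nf b)
  | NMuln a n => nc_scale n%:R (nc_nf a)
  end.

Fixpoint nc_words (e : ncexpr) : seq (seq nat) :=
  match e with
  | NVar i => [:: [:: i]]
  | NZero => [::]
  | NOne => [:: [::]]
  | NAdd a b => nc_words a ++ nc_words b
  | NOpp a => nc_words a
  | NScale c a => nc_words a
  | NMul a b => [seq v ++ w | v <- nc_words a, w <- nc_words b]
  | NMuln a n => nc_words a
  end.

Fixpoint nc_eqn (m n : nat) : bool :=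
  match m, n with
  | O, O => true | S m', S n' => nc_eqn m' n' | _, _ => false
  end.

Fixpoint nc_eqw (v w : seq nat) : bool :=
  match v, w with
  | [::], [::] => true
  | i :: v', j :: w' => if nc_eqn i j then nc_eqw v' w' else false
  | _, _ => false
  end.

Fixpoint nc_coef (w : seq nat) (s : seq (K * seq nat)) : K :=
  match s with
  | [::] => 0
  | (c, v) :: s' => if nc_eqw v w then c + nc_coef w s' else nc_coef w s'
  end.

Fixpoint nc_zero (ws : seq (seq nat)) (s : seq (K * seq nat)) : Prop :=
  match ws with
  | [::] => True
  | w :: ws' => nc_coef w s = 0 /\ nc_zero ws' s
  end.

Definition nc_list (env : seq V) (s : seq (K * seq nat)) : V :=
  \sum_(p <- s) p.1 *: \prod_(i <- p.2) env`_i.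

Lemma nc_appE T (s t : seq T) : nc_app s t = s ++ t.
Proof. by elim: s => //= x s ->. Qed.

Lemma nc_eqwE v w : nc_eqw v w = (v == w).
Proof.
have eqn i j : nc_eqn i j = (i == j) by elim: i j => [|i IH] [|j] //=.
elim: v w => [|i v IH] [|j w] //=.
by rewrite eqn IH eqseq_cons; case: (i == j).
Qed.

Lemma nc_scaleE env c s : nc_list env (nc_scale c s) = c *: nc_list env s.
Proof.
rewrite /nc_list; elim: s => [|[d w] s IH] /=; first by rewrite !big_nil scaler0.
by rewrite !big_cons /= IH scalerDr scalerA.
Qed.

Lemma nc_nfE env e : nc_eval env e = nc_list env (nc_nf e).
Proof.
elim: e => [i|||a IHa b IHb|a IHa|c a IHa|a IHa b IHb|a IHa n] /=.
- by rewrite /nc_list big_seq1 /= big_seq1 scale1r.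
- by rewrite /nc_list big_nil.
- by rewrite /nc_list big_seq1 /= big_nil scale1r.
- by rewrite nc_appE /nc_list big_cat /= IHa IHb.
- by rewrite nc_scaleE IHa scaleN1r.
- by rewrite nc_scaleE IHa.
- rewrite {}IHa {}IHb; elim: (nc_nf a) => [|[c v] s IH] /=.
    by rewrite /nc_list !big_nil mul0r.
  rewrite nc_appE /nc_list big_cat big_cons /= mulrDl; congr (_ + _); last exact: IH.
  elim: (nc_nf b) => [|[d w] t IHt] /=; first by rewrite !big_nil mulr0.
  rewrite !big_cons /= mulrDr IHt nc_appE big_cat /=; congr (_ + _).
  by rewrite -scalerAl -scalerAr scalerA.
- by rewrite nc_scaleE IHa scaler_nat.
Qed.

Lemma nc_wordsE e : [seq p.2 | p <- nc_nf e] = nc_words e.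
Proof.
have scE c s : [seq p.2 | p <- nc_scale c s] = [seq p.2 | p <- s].
  by elim: s => [|[d w] s IH] //=; rewrite IH.
elim: e => [i|||a IHa b IHb|a IHa|c a IHa|a IHa b IHb|a IHa n] //=;
  rewrite ?scE // ?nc_appE ?map_cat ?IHa ?IHb //.
rewrite -{}IHa -{}IHb; elim: (nc_nf a) => [|[c v] s IH] //=.
rewrite nc_appE map_cat IH; congr (_ ++ _).
by elim: (nc_nf b) => [|[d w] t IHt] //=; rewrite IHt nc_appE.
Qed.

Lemma nc_coefE w s : nc_coef w s = \sum_(p <- s | p.2 == w) p.1.
Proof.
elim: s => [|[c v] s IH] /=; first by rewrite big_nil.
by rewrite big_cons nc_eqwE /= IH.
Qed.

Lemma nc_eval0 env e ws : uniq ws -> all (fun w => w \in ws) (nc_words e) ->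
  nc_zero ws (nc_nf e) -> nc_eval env e = 0.
Proof.
rewrite -nc_wordsE nc_nfE; move: (nc_nf e) => s uws /allP sws z.
have zP w : w \in ws -> nc_coef w s = 0.
  elim: ws z {uws sws} => [|v ws IH] //= [z1 /IH{}IH].
  by rewrite inE => /predU1P[->|wws]; last exact: IH.
rewrite /nc_list (eq_big_seq (fun p => \sum_(w <- ws | w == p.2)
  p.1 *: \prod_(i <- w) env`_i)) => [|p ps]; last first.
  rewrite -[RHS]big_filter (eq_filter (a2 := pred1 p.2)) // filter_pred1_uniq ?big_seq1 //.
  exact/sws/map_f.
rewrite (exchange_big_dep xpredT) //= big_seq big1 // => w ww.
rewrite (eq_bigl (fun p => p.2 == w)) => [|p]; last exact: eq_sym.
by rewrite -scaler_suml -nc_coefE zP // scale0r.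
Qed.

Lemma nc_correct env e1 e2 ws :
  uniq ws && all (fun w => w \in ws) (nc_words (NAdd e1 (NOpp e2))) = true ->
  nc_zero ws (nc_nf (NAdd e1 (NOpp e2))) ->
  nc_eval env e1 = nc_eval env e2.
Proof.
move=> /andP[uws sws] z; apply/eqP; rewrite -subr_eq0; apply/eqP.
exact: (nc_eval0 env uws sws z).
Qed.

End FreeAlgebra.

Ltac nc_mem x l :=
  lazymatch l with
  | nil => false
  | cons ?y ?l' => let b := match x with y => true | _ => nc_mem x l' end in b
  end.

Ltac nc_index x l :=
  lazymatch l with
  | cons ?y ?l' =>
    match x with y => O | _ => let n := nc_index x l' in constr:(S n) end
  end.

Ltac nc_atoms t l :=
  lazymatch t with
  | @GRing.add _ ?a ?b => let l := nc_atoms a l in nc_atoms b l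
  | @GRing.opp _ ?a => nc_atoms a l
  | @GRing.mul _ ?a ?b => let l := nc_atoms a l in nc_atoms b l
  | @GRing.scale _ _ _ ?a => nc_atoms a l
  | @GRing.natmul _ ?a _ => nc_atoms a l
  | @GRing.zero _ => l
  | @GRing.one _ => l
  | _ => let b := nc_mem t l in
         lazymatch b with true => l | false => constr:(cons t l) end
  end.

Ltac nc_reify K t l :=
  lazymatch t with
  | @GRing.add _ ?a ?b => let x := nc_reify K a l in let y := nc_reify K b l in
      constr:(@NAdd K x y)
  | @GRing.opp _ ?a => let x := nc_reify K a l in constr:(@NOpp K x)
  | @GRing.mul _ ?a ?b => let x := nc_reify K a l in let y := nc_reify K b l in
      constr:(@NMul K x y)
  | @GRing.scale _ _ ?c ?a => let x := nc_reify K a l in constr:(@NScale K c x)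
  | @GRing.natmul _ ?a ?n => let x := nc_reify K a l in constr:(@NMuln K x n)
  | @GRing.zero _ => constr:(@NZero K)
  | @GRing.one _ => constr:(@NOne K)
  | _ => let n := nc_index t l in constr:(@NVar K n)
  end.

Ltac nc_core K V :=
  lazymatch goal with
  | |- @eq _ ?a ?b =>
    let l := nc_atoms a (@nil V) in
    let l := nc_atoms b l in
    let x := nc_reify K a l in
    let y := nc_reify K b l in
    let ws := eval vm_compute in (undup (nc_words (NAdd x (NOpp y)))) in
    refine (@nc_correct K V l x y ws _ _);
    [vm_compute; reflexivity
    | cbv beta iota delta [nc_zero nc_coef nc_nf nc_mul nc_mulw nc_scale nc_app
        nc_eqw nc_eqn]; repeat (split; [|]); [..|exact I]]
  end.


(** * Packing in Euclidean space *)

Section Packing.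
Variables (R : realType) (m K : nat) (x : 'I_K -> 'I_m -> R).
Hypothesis sep : forall i j, i != j -> 1 <= \sum_a (x i a - x j a) ^+ 2 <= 4.

Let nle (v : 'I_m -> R) (c : R) := 0 <= c /\ \sum_a v a ^+ 2 <= c ^+ 2.

(** Cauchy-Schwarz is read off from the square of [d v - c w]. The cases [c = 0] and [d = 0], where
    one vector vanishes, are separate because the factor [c d] is cancelled. *)
Let nleD v w c d : nle v c -> nle w d -> nle (fun a => v a + w a) (c + d).
Proof.
move=> [c0 hv] [d0 hw]; split; first by rewrite addr_ge0.
have v0 : 0 <= \sum_a v a ^+ 2 by apply: sumr_ge0 => a _; exact: sqr_ge0.
have w0 : 0 <= \sum_a w a ^+ 2 by apply: sumr_ge0 => a _; exact: sqr_ge0.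
have -> : \sum_a (v a + w a) ^+ 2 =
    \sum_a v a ^+ 2 + 2 * (\sum_a v a * w a) + \sum_a w a ^+ 2.
  by rewrite mulr_sumr -!big_split; apply: eq_bigr => a _ /=; ring.
have q0 : 0 <= \sum_a (d * v a - c * w a) ^+ 2.
  by apply: sumr_ge0 => a _; exact: sqr_ge0.
have qE : \sum_a (d * v a - c * w a) ^+ 2 = d ^+ 2 * (\sum_a v a ^+ 2)
    - 2 * c * d * (\sum_a v a * w a) + c ^+ 2 * (\sum_a w a ^+ 2).
  by rewrite !mulr_sumr -sumrN -!big_split; apply: eq_bigr => a _ /=; ring.
have zero (s t : 'I_m -> R) : \sum_a s a ^+ 2 <= 0 -> \sum_a s a * t a = 0.
  move=> h; have e : \sum_a s a ^+ 2 = 0.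
    by apply/le_anti; rewrite h sumr_ge0 // => a _; exact: sqr_ge0.
  rewrite big1 // => a _.
  have /eqP := e; rewrite psumr_eq0 => [|b _]; last exact: sqr_ge0.
  by move=> /allP/(_ a (mem_index_enum a)); rewrite /= sqrf_eq0 => /eqP ->; rewrite mul0r.
suff : \sum_a v a * w a <= c * d by move: (\sum_a _) (\sum_a _) (\sum_a _) hv hw => *; nra.
have [cz|cz] := eqVneq c 0.
  have -> : \sum_a v a * w a = 0 by apply: zero; move: hv; rewrite cz expr0n.
  by rewrite cz mul0r.
have [dz|dz] := eqVneq d 0.
  have -> : \sum_a v a * w a = \sum_a w a * v a by apply: eq_bigr => a _; exact: mulrC.
  have -> : \sum_a w a * v a = 0 by apply: zero; move: hw; rewrite dz expr0n.
  by rewrite dz mulr0.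
have cd : 0 < c * d by rewrite mulr_gt0 // lt0r ?cz ?dz.
rewrite qE in q0; rewrite -(ler_pM2l cd).
have a1 : d ^+ 2 * (\sum_a v a ^+ 2) <= d ^+ 2 * c ^+ 2 by rewrite ler_wpM2l ?sqr_ge0.
have a2 : c ^+ 2 * (\sum_a w a ^+ 2) <= c ^+ 2 * d ^+ 2 by rewrite ler_wpM2l ?sqr_ge0.
move: (\sum_a v a * w a) (d ^+ 2 * \sum_a _) (c ^+ 2 * \sum_a _) q0 a1 a2 => *; lra.
Qed.

Let nleZ (k : R) v c : 0 <= k -> nle v c -> nle (fun a => k * v a) (k * c).
Proof.
move=> k0 [c0 hv]; split; first by rewrite mulr_ge0.
under eq_bigr do rewrite exprMn.
by rewrite -mulr_sumr exprMn ler_wpM2l ?sqr_ge0.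
Qed.

Let nle_ext v w c : v =1 w -> nle v c -> nle w c.
Proof. by move=> e [c0 h]; split=> //; under eq_bigr do rewrite -e. Qed.

(* The [K ^ n] points [\sum_j 3^j x_(w_j)] are 1-separated with mutual distances
   below [3 ^ n]; a grid count bounds their number by [c * 3 ^ (m * n)], with [c]
   independent of [n], and [n] is arbitrary. *)
Fixpoint word_point (w : seq 'I_K) (a : 'I_m) : R :=
  if w is i :: w' then 3 ^+ size w' * x i a + word_point w' a else 0.

Let sep_le i j : nle (fun a => x i a - x j a) 2.
Proof.
split=> //; have [->|/sep/andP[_]] := eqVneq i j.
  by rewrite big1 => [|a _]; [exact: sqr_ge0|rewrite subrr expr0n].
by move/le_trans; apply; lra.
Qed.

(** Each digit contributes at most 2, so the total is [2 (1 + 3 + ... + 3^(n-1)) = 3^n - 1]. *)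
Let word_le w w' : size w = size w' ->
  nle (fun a => word_point w a - word_point w' a) (3 ^+ size w - 1).
Proof.
elim: w w' => [|i w IH] [|j w'] //= => [_|[sz]].
  split; first by rewrite expr0 subrr.
  by rewrite big1 => [|a _]; [exact: sqr_ge0|rewrite subrr expr0n].
have h3 : 0 <= 3 ^+ size w :> R by exact: exprn_ge0.
have := nleD (nleZ h3 (sep_le i j)) (IH w' sz).
have -> : 3 ^+ size w * 2 + (3 ^+ size w - 1) = 3 ^+ (size w).+1 - 1 :> R by rewrite exprS; ring.
by apply: nle_ext => a; rewrite -sz; ring.
Qed.

(** At the first differing digit, with [k] digits to follow, the leading term has norm at least
    [3^k] and the tail at most [3^k - 1]; a distance of at least 1 remains. *)
Let word_sep w w' : size w = size w' -> w != w' ->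
  1 <= \sum_a (word_point w a - word_point w' a) ^+ 2.
Proof.
elim: w w' => [|i w IH] [|j w'] //= [sz].
rewrite eqseq_cons; have [->|ij _] := eqVneq i j => /= [ww|].
  apply: le_trans (IH w' sz ww) _; rewrite le_eqVlt; apply/orP; left; apply/eqP.
  by apply: eq_bigr => a _; rewrite sz; congr (_ ^+ 2); ring.
rewrite leNgt; apply/negP; set S := \sum_a _ => S1.
have S0 : 0 <= S by apply: sumr_ge0 => a _; exact: sqr_ge0.
have sS : nle (fun a => 3 ^+ size w * x i a + word_point w a -
     (3 ^+ size w' * x j a + word_point w' a)) (Num.sqrt S).
  by split; [exact: sqrtr_ge0|rewrite sqr_sqrtr].
have [_] := nleD sS (word_le (esym sz)).
rewrite (eq_bigr (fun a => (3 ^+ size w) ^+ 2 * (x i a - x j a) ^+ 2)); last first.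
  by move=> a _; rewrite -sz; ring.
rewrite -mulr_sumr -sz; have /andP[ge1 _] := sep ij.
have r1 : Num.sqrt S < 1 by rewrite -sqrtr1 ltr_sqrt.
have r0 := sqrtr_ge0 S.
have t1 : 1 <= 3 ^+ size w :> R by rewrite exprn_ege1 // ler1n.
move: (3 ^+ size w) (Num.sqrt S) (\sum_a _) r1 r0 t1 ge1 => t q u *.
have : t ^+ 2 <= t ^+ 2 * u by rewrite ler_peMr ?sqr_ge0.
nra.
Qed.

(** Points are sorted into cells of side [1/m]: two points of one cell would have squared distance
    below [m / m^2 <= 1], against [word_sep]. The shift by [3^n] makes all coordinates
    nonnegative. *)
Let word_count n : (K ^ n <= (2 * m * 3 ^ n).+1 ^ m)%N.
Proof.
have [->|K0] := posnP K; first by case: n => [|n]; [rewrite expn0 expn_gt0|rewrite exp0n].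
pose w0 := nseq n (Ordinal K0).
pose y (w : n.-tuple 'I_K) a := m%:R * (word_point w a - word_point w0 a + 3 ^+ n) : R.
have bnd (w : n.-tuple 'I_K) a : 0 <= y w a <= (2 * m * 3 ^ n)%:R.
  have [c0] := @word_le w w0 (ltac:(by rewrite size_tuple size_nseq)); rewrite size_tuple.
  rewrite (bigD1 a) //= => h.
  have {h} : (word_point w a - word_point w0 a) ^+ 2 <= (3 ^+ n - 1) ^+ 2.
    by apply: le_trans h; rewrite lerDl; apply: sumr_ge0 => b _; exact: sqr_ge0.
  rewrite -(real_normK (num_real (word_point w a - word_point w0 a))).
  rewrite size_tuple in c0; rewrite ler_sqr ?nnegrE // ler_norml => /andP[h1 h2].
  have m0 : 0 <= m%:R :> R by [].
  rewrite !natrM natrX /y; move: (m%:R) (3 ^+ n) m0 h1 h2 => M t *.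
  by apply/andP; split; nra.
pose f w : {ffun 'I_m -> 'I_(2 * m * 3 ^ n).+1} := [ffun a => inord (Num.truncn (y w a))].
have fE w a : f w a = Num.truncn (y w a) :> nat.
  have /andP[y0 y1] := bnd w a; rewrite ffunE inordK // ltnS.
  by rewrite -(ler_nat R) (le_trans _ y1) // truncn_le.
have inj : injective f.
  move=> w w' e; apply/eqP; rewrite -val_eqE; apply/negPn/negP => /= ww.
  have := word_sep (etrans (size_tuple w) (esym (size_tuple w'))) ww.
  apply/negP; rewrite -ltNge.
  have d a : (m%:R * (word_point w a - word_point w' a)) ^+ 2 < 1.
    have /andP[y0 _] := bnd w a; have /andP[y0' _] := bnd w' a.
    have /andP[] := truncn_itv y0; have /andP[] := truncn_itv y0'.
    rewrite -!fE e; move: (nat_of_ord (f w' a)) => k; rewrite -addn1 natrD.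
    have -> : m%:R * (word_point w a - word_point w' a) = y w a - y w' a by rewrite /y; ring.
    move: (y w a) (y w' a) => u u' *.
    by rewrite -real_normK ?num_real // expr_lt1 // ltr_norml; apply/andP; split; lra.
  have [m0|m0] := posnP m.
    by rewrite big1 // => a; move: (ltn_ord a); rewrite {2}m0.
  have mp : 0 < m%:R :> R by rewrite ltr0n.
  rewrite -(ltr_pM2l (exprn_gt0 2 mp)) mulr1 mulr_sumr.
  apply: (@lt_le_trans _ _ (\sum_(a < m) 1)).
    under eq_bigr do rewrite -exprMn.
    apply: ltr_sum => [|a _]; last exact: d.
    by apply/hasP; exists (Ordinal m0) => //; rewrite mem_index_enum.
  by rewrite sumr_const card_ord expr2 ler_pMl // ler1n.
have := leq_card f inj; rewrite card_tuple card_ffun !card_ord //.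
Qed.

Lemma packing : (K <= 3 ^ m)%N.
Proof.
set q := (3 ^ m)%N; rewrite leqNgt; apply/negP => qK.
pose c := ((2 * m).+1 ^ m)%N.
have q0 : (0 < q)%N by rewrite expn_gt0.
have mono a b : (a <= b)%N -> (a ^ m <= b ^ m)%N.
  by move=> ab; have [->//|m0] := posnP m; rewrite leq_exp2r.
have up n : (K ^ n <= c * q ^ n)%N.
  apply: leq_trans (word_count n) _; rewrite /c /q -expnM (mulnC m) expnM -expnMn.
  by apply: mono; rewrite mulSn -add1n leq_add2r expn_gt0.
(* Bernoulli's inequality for [(1 + 1/q)^n], cleared of denominators: [(q + 1)^n] outgrows [c q^n],
   visibly at [n = c q + 1]. *)
have low n : (q ^ n * (q + n) <= q.+1 ^ n * q)%N.
  elim: n => [|n IH]; first by rewrite !expn0 !mul1n addn0.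
  have := leq_mul (leqnn q.+1) IH; rewrite !expnS; nia.
have := low (c * q).+1; have := up (c * q).+1.
have hK : (q.+1 ^ (c * q).+1 <= K ^ (c * q).+1)%N by rewrite leq_exp2r.
have : (0 < q ^ (c * q).+1)%N by rewrite expn_gt0 q0.
move: (q ^ _)%N (q.+1 ^ _)%N (K ^ _)%N hK => a b d hK a0 hu hl.
have : (a * (q + (c * q).+1) <= a * (c * q))%N.
  apply: leq_trans hl _; apply: leq_trans (leq_mul (leq_trans hK hu) (leqnn q)) _.
  by rewrite mulnAC mulnC.
by rewrite leq_pmul2l // leqNgt; lia.
Qed.

End Packing.

(** * Positive elements of a C*-algebra *)

Section CStarAlgebra.
Variables (R : realType) (A : algType R[i]).
Variables (nrm : A -> R) (star : A -> A).
Hypothesis hA : is_unital_cstar_algebra nrm star.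

(** * Norm, involution and closed subalgebras *)

Lemma nrm_ge0 x : 0 <= nrm x.
Proof. by have [[h _ _ _ _] _ _ _] := hA; apply: h. Qed.

Lemma nrm_eq0 x : nrm x = 0 -> x = 0.
Proof. by have [[_ h _ _ _] _ _ _] := hA; apply: h. Qed.

Lemma nrmD x y : nrm (x + y) <= nrm x + nrm y.
Proof. by have [[_ _ h _ _] _ _ _] := hA; apply: h. Qed.

Lemma nrmM x y : nrm (x * y) <= nrm x * nrm y.
Proof. by have [[_ _ _ _ h] _ _ _] := hA; apply: h. Qed.

Lemma starD x y : star (x + y) = star x + star y.
Proof. by have [_ [h _ _ _ _] _ _] := hA; apply: h. Qed.

Lemma starM x y : star (x * y) = star y * star x.
Proof. by have [_ [_ _ h _ _] _ _] := hA; apply: h. Qed.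

Lemma starK x : star (star x) = x.
Proof. by have [_ [_ _ _ h _] _ _] := hA; apply: h. Qed.

Lemma nrm_starM x : nrm (star x * x) = nrm x ^+ 2.
Proof. by have [_ [_ _ _ _ h] _ _] := hA; apply: h. Qed.

Lemma complete u : norm_cauchy nrm u -> exists l, norm_converges nrm u l.
Proof. by have [_ _ h _] := hA; apply: h. Qed.
Lemma one_neq0 : (1 : A) != 0. Proof. by have [_ _ _ h] := hA. Qed.

Lemma nrmZ (a : R) x : nrm (a%:C *: x) = `|a| * nrm x.
Proof.
case: hA => [[_ _ _ h _] _ _ _]; apply: (@complexI R).
by rewrite h rmorphM /= normc_def /= expr0n addr0 sqrtr_sqr.
Qed.

Definition iu : R[i] := 'i.

Lemma iu2 : iu * iu = -1. Proof. by rewrite -expr2 sqr_i. Qed.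

Lemma nrmZi x : nrm (iu *: x) = nrm x.
Proof.
case: hA => [[_ _ _ h _] _ _ _]; apply: (@complexI R).
by rewrite h normc_def /= expr0n expr1n add0r sqrtr1 mul1r.
Qed.

Lemma starZ (a : R) x : star (a%:C *: x) = a%:C *: star x.
Proof. by case: hA => [_ [_ h _ _ _] _ _]; rewrite h conj_Creal //; apply/complex_realP; exists a. Qed.

Lemma starZi x : star (iu *: x) = - (iu *: star x).
Proof.
case: hA => [_ [_ h _ _ _] _ _]; rewrite h -scaleNr; congr (_ *: _).
by rewrite /iu /=; apply/eqP; rewrite eq_complex /= oppr0 !eqxx.
Qed.


Local Notation "t %:S" := ((t%:C)%:A) (at level 2, left associativity, format "t %:S").
Local Ltac nc := nc_core (R[i] : comNzRingType) A; try ring.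

Lemma nrmN x : nrm (- x) = nrm x.
Proof.
have -> : - x = (-1)%:C *: x by nc.
by rewrite nrmZ normrN1 mul1r.
Qed.

Lemma nrm0 : nrm 0 = 0.
Proof. by have := nrmZ 0 0; rewrite rmorph0 scale0r normr0 mul0r. Qed.

Lemma nrmB x y : nrm (x - y) <= nrm x + nrm y.
Proof. by rewrite -(nrmN y) nrmD. Qed.

Lemma nrmBC x y : nrm (x - y) = nrm (y - x).
Proof. by rewrite -nrmN opprB. Qed.

Lemma nrm_tri x y z : nrm (x - z) <= nrm (x - y) + nrm (y - z).
Proof. by rewrite -[x - z](subrKA y) nrmD. Qed.

Lemma star0 : star 0 = 0.
Proof. by have := starZ 0 0; rewrite rmorph0 !scale0r. Qed.

Lemma starN x : star (- x) = - star x.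
Proof. by apply/eqP; rewrite -addr_eq0 -starD addNr star0. Qed.

Lemma starB x y : star (x - y) = star x - star y.
Proof. by rewrite starD starN. Qed.

Lemma star_sum I (r : seq I) (P : pred I) (F : I -> A) :
  star (\sum_(i <- r | P i) F i) = \sum_(i <- r | P i) star (F i).
Proof. by apply: (big_morph star starD star0). Qed.

Lemma star1 : star 1 = 1.
Proof. by have := starM (star 1) 1; rewrite mulr1 starK mulr1 => <-. Qed.

Lemma starS (t : R) : star t%:S = t%:S.
Proof. by rewrite starZ star1. Qed.

Lemma nrm_star x : nrm (star x) = nrm x.
Proof.
suff h y : nrm y <= nrm (star y) by apply/le_anti; rewrite h -{2}(starK x) h.
have [y0|y0] := eqVneq (nrm y) 0; first by rewrite y0 nrm_ge0.
rewrite -(@ler_pM2r _ (nrm y)) ?lt0r ?y0 ?nrm_ge0 //.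
by rewrite -expr2 -nrm_starM nrmM.
Qed.

Lemma nrm1 : nrm 1 = 1.
Proof.
have n1 : nrm 1 != 0 by apply: contraNneq one_neq0 => /nrm_eq0 ->.
apply: (mulfI n1); rewrite -expr2 -nrm_starM star1 !mulr1; by [].
Qed.

Lemma nrmS (t : R) : nrm t%:S = `|t|.
Proof. by rewrite nrmZ nrm1 mulr1. Qed.

Lemma nrm_sum I (r : seq I) (P : pred I) (F : I -> A) :
  nrm (\sum_(i <- r | P i) F i) <= \sum_(i <- r | P i) nrm (F i).
Proof.
elim/big_rec2: _ => [|i y x _ h]; first by rewrite nrm0.
by rewrite (le_trans (nrmD _ _)) // lerD2l.
Qed.

Lemma nrm_eps0 x : (forall e : R, 0 < e -> nrm x <= e) -> x = 0.
Proof.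
move=> h; apply: nrm_eq0; apply/le_anti; rewrite nrm_ge0 andbT.
by apply/ler_addgt0Pr => e /h; rewrite add0r.
Qed.

(** The means of passing linear identities to norm limits. *)
Lemma closed_ker (f : A -> A) (K : R) :
  (forall x y, f (x - y) = f x - f y) -> (forall x, nrm (f x) <= K * nrm x) ->
  norm_closed nrm (fun x => f x = 0).
Proof.
move=> fB fK u l u0 cu; apply: nrm_eps0 => e e0.
have K1 : 0 < `|K| + 1 by rewrite ltr_pwDr.
have [n /(_ n (leqnn n)) hn] := cu (e / (`|K| + 1)) (divr_gt0 e0 K1).
have -> : f l = - f (u n - l) by rewrite fB u0 sub0r opprK.
rewrite nrmN (le_trans (fK _)) //.
have := nrm_ge0 (u n - l); move: hn; rewrite ltr_pdivlMr //.
move: (nrm _) => t; have := ler_norm K => *; nra.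
Qed.

Lemma closed_ball (r : R) : norm_closed nrm (fun x => nrm x <= r).
Proof.
move=> u l ur cu; apply/ler_addgt0Pr => e /cu[n /(_ n (leqnn n)) hn].
have := nrm_tri l (u n) 0; rewrite !subr0 nrmBC; have := ur n; lra.
Qed.

Lemma closed_sa : norm_closed nrm (fun x => star x = x).
Proof.
have := @closed_ker (fun x => star x - x) 2 _ _; set P := norm_closed _ _.
move=> h u l us cu; apply/eqP; rewrite -subr_eq0; apply/eqP; apply: h cu => [x y|x|n].
- by rewrite starB; nc.
- by rewrite (le_trans (nrmB _ _)) // nrm_star; lra.
- by rewrite us subrr.
Qed.

(** Closure under [star] is left out so that the commutant of any element qualifies: one statement
    about all closed subalgebras containing [h] then yields both membership and commutation. *)
Definition closed_subalg (S : A -> Prop) :=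
  [/\ S 1, (forall x y, S x -> S y -> S (x + y)),
      (forall (c : R[i]) x, S x -> S (c *: x)),
      (forall x y, S x -> S y -> S (x * y)) & norm_closed nrm S].

Lemma closed_commutant x : closed_subalg (fun y => x * y = y * x).
Proof.
split=> [|y z hy hz|c y hy|y z hy hz|].
- by rewrite mulr1 mul1r.
- by rewrite mulrDr mulrDl hy hz.
- by rewrite -scalerAr hy scalerAl.
- by rewrite mulrA hy -mulrA hz mulrA.
have := @closed_ker (fun y => x * y - y * x) (2 * nrm x) _ _ => h u l us cu.
apply/eqP; rewrite -subr_eq0; apply/eqP; apply: h cu => [y z|y|n].
- nc.
- rewrite (le_trans (nrmB _ _)) //; have := nrmM x y; have := nrmM y x; lra.
- by rewrite us subrr.
Qed.

Lemma subalgB S x y : closed_subalg S -> S x -> S y -> S (x - y).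
Proof.
case=> _ hD hZ _ _ hx hy; apply: hD => //.
by rewrite -scaleN1r; apply: hZ.
Qed.

Lemma subalgS S (t : R) : closed_subalg S -> S t%:S.
Proof. by case=> h1 _ hZ _ _; apply: hZ. Qed.


(** * Square roots by iteration *)

Lemma sqrt_iter_rate (n : nat) :
  let s := iter n (fun s : R => 2^-1 * (1 + s ^+ 2)) 0 in
  [/\ 0 <= s, s <= 1 & 1 - s <= 2 / n.+2%:R].
Proof.
elim: n => [|n [s0 s1 IH]] /=; first by split; lra.
move: (iter n _ 0) s0 s1 IH => s s0 s1 IH.
split; first by nra.
  by nra.
have n2 : 0 < n.+2%:R :> R by rewrite ltr0n.
have n3 : 0 < n.+3%:R :> R by rewrite ltr0n.
have e3 : n.+3%:R = n.+2%:R + 1 :> R by rewrite -[in LHS]addn1 natrD.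
move: IH; rewrite !ler_pdivlMr // e3; move: (n.+2%:R) n2 => m m0 IH.
have [sm|] := leP (1 - s) (2 / (m + 1)); last first.
  rewrite ltr_pdivrMr; [nra | lra].
rewrite ler_pdivlMr in sm; last lra.
nra.
Qed.

(** The iteration [y -> (h + y^2) / 2] converges to [1 - sqrt (1 - h)]. Its increments are dominated
    by those of the scalar iteration for [h = 1], which tends to 1; so it is Cauchy even when
    [nrm h = 1], where no uniform contraction factor is available. The last clause is an induction
    principle for the limit. *)
Lemma sqrt_iter_limit (h : A) : nrm h <= 1 ->
  exists2 y, 2%:C *: y = h + y * y &
    forall S : A -> Prop, norm_closed nrm S -> S 0 ->
      (forall y, S y -> S (2^-1%:C *: (h + y * y))) -> S y.
Proof.
move=> h1; set f := fun y => 2^-1%:C *: (h + y * y).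
set g := fun s : R => 2^-1 * (1 + s ^+ 2).
pose y n := iter n f 0; pose s n := iter n g 0.
have sP n : [/\ 0 <= s n, s n <= 1 & 1 - s n <= 2 / n.+2%:R] := sqrt_iter_rate n.
have yh n x : x * h = h * x -> x * y n = y n * x.
  move=> xh; elim: n => [|n IH]; first by rewrite mulr0 mul0r.
  rewrite /y /= -/(y n) /f -scalerAr -scalerAl mulrDr mulrDl xh.
  by rewrite mulrA IH -!mulrA IH.
have yy m n : y m * y n = y n * y m by apply/yh/esym/yh.
have yS n : y n.+1 = f (y n) by [].
have ys n : nrm (y n) <= s n.
  elim: n => [|n IH]; first by rewrite nrm0.
  rewrite yS /f nrmZ ger0_norm ?invr_ge0 //= /g -/(s n) ler_pM2l ?invr_gt0 //.
  rewrite (le_trans (nrmD _ _)) // lerD // (le_trans (nrmM _ _)) //.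
  by rewrite expr2 ler_pM ?nrm_ge0.
have dS n : nrm (y n.+1 - y n) <= s n.+1 - s n.
  elim: n => [|n IH].
    rewrite yS /f /y /s /= mulr0 addr0 !subr0 nrmZ ger0_norm ?invr_ge0 //.
    rewrite /g expr0n addr0; lra.
  rewrite yS [in X in _ - X]yS /f.
  have -> : 2^-1%:C *: (h + y n.+1 * y n.+1) - 2^-1%:C *: (h + y n * y n) =
    2^-1%:C *: ((y n.+1 - y n) * (y n.+1 + y n)).
    have e := yy n.+1 n; rewrite mulrDr !mulrBl e; nc.
  rewrite nrmZ ger0_norm ?invr_ge0 //.
  have := le_trans (nrmM (y n.+1 - y n) (y n.+1 + y n))
    (ler_pM (nrm_ge0 _) (nrm_ge0 _) IH (le_trans (nrmD _ _) (lerD (ys _) (ys _)))).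
  have : s n.+2 = 2^-1 * (1 + s n.+1 ^+ 2) by [].
  have : s n.+1 = 2^-1 * (1 + s n ^+ 2) by [].
  move: (s n.+2) (s n.+1) (s n) (nrm _) => s2 s1 s0 P e1 e2 hP; lra.
have dk n k : nrm (y (n + k)%N - y n) <= s (n + k)%N - s n.
  elim: k => [|k IH]; first by rewrite addn0 !subrr nrm0.
  rewrite addnS; have := nrm_tri (y (n + k).+1) (y (n + k)%N) (y n).
  have := dS (n + k)%N; lra.
have eps e : 0 < e -> exists n, 2 / n.+2%:R < e :> R.
  move=> e0; have [n hn] : exists n, 2 / e < n%:R :> R.
    by exists (Num.bound (2 / e)); apply: le_lt_trans (archi_boundP _) => //; rewrite divr_ge0 ?ltW.
  exists n; rewrite ltr_pdivrMr ?ltr0n // mulrC -ltr_pdivrMr //.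
  by rewrite (lt_trans hn) // ltr_nat.
have cy : norm_cauchy nrm y.
  move=> e e0; have [N hN] := eps _ (divr_gt0 e0 (ltr0n R 2)).
  have b n : (N <= n)%N -> nrm (y n - y N) < e / 2%:R.
    move=> /subnKC <-; apply: le_lt_trans hN; apply: le_trans (dk _ _) _.
    have [_ _] := sP N; have [_ + _] := sP (N + (n - N))%N.
    by move: (s _) (s _) (2 / _) => *; lra.
  exists N => m n Nm Nn; have := nrm_tri (y m) (y N) (y n).
  have := b _ Nm; have := b _ Nn; rewrite (nrmBC (y n)); lra.
have [l cl] := complete cy.
have Sl (S : A -> Prop) : norm_closed nrm S -> S 0 ->
    (forall y, S y -> S (f y)) -> S l.
  by move=> cS S0 Sf; apply: cS cl => n; elim: n => //= n /Sf.
have l1 : nrm l <= 1.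
  apply: (Sl (fun x => nrm x <= 1)); [exact: closed_ball|by rewrite nrm0 |move=> z z1].
  rewrite /f nrmZ ger0_norm ?invr_ge0 //.
  have := nrmD h (z * z); have := nrmM z z; have := nrm_ge0 z; nra.
exists l; last exact: Sl.
suff fl : l - f l = 0.
  by have {1}-> : l = f l by [apply/eqP; rewrite -subr_eq0 fl]; rewrite /f; nc; field.
apply: nrm_eps0 => e e0.
have [N hN] := cl _ (divr_gt0 e0 (ltr0n R 2)).
have a1 := hN N (leqnn N); have a2 := hN N.+1 (leqnSn N).
have := nrm_tri l (y N.+1) (f l); rewrite (nrmBC l (y N.+1)).
suff : nrm (y N.+1 - f l) <= nrm (y N - l) by lra.
have -> : y N.+1 - f l = 2^-1%:C *: (y N * (y N - l) + (y N - l) * l).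
  rewrite yS /f; nc.
rewrite nrmZ ger0_norm ?invr_ge0 //.
have := nrmD (y N * (y N - l)) ((y N - l) * l).
have := nrmM (y N) (y N - l); have := nrmM (y N - l) l.
have := nrm_ge0 (y N - l); have [_ ? _] := sP N; have := ys N; nra.
Qed.

(** Apply the iteration to [1 - h]: [2 y = (1 - h) + y^2] says that [(1 - y)^2 = h]. The bound on
    [1 - k] serves later to make [k] positive and to let it tend to 1. *)
Lemma sqrt_near1 (h : A) : star h = h -> nrm (1 - h) <= 1 ->
  exists k, [/\ star k = k, k * k = h,
    (forall t, nrm (1 - h) <= t -> t <= 1 -> nrm (1 - k) <= t) &
    forall S, closed_subalg S -> S h -> S k].
Proof.
move=> hs h1; have [y ey yS] := sqrt_iter_limit h1; exists (1 - y).
split.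
- rewrite starB star1; congr (_ - _).
  apply: (yS (fun y => star y = y)); [exact: closed_sa|exact: star0|move=> z sz].
  by rewrite starZ starD starB star1 hs starM sz.
- have -> : (1 - y) * (1 - y) = 1 - 2%:C *: y + y * y by nc.
  rewrite ey; nc.
- move=> t ht t1; have -> : 1 - (1 - y) = y by nc.
  have t0 : 0 <= t by apply: le_trans ht; apply: nrm_ge0.
  apply: (yS (fun y => nrm y <= t)); [exact: closed_ball|by rewrite nrm0|move=> z zt].
  rewrite nrmZ ger0_norm ?invr_ge0 //.
  have := nrmD (1 - h) (z * z); have := nrmM z z; have := nrm_ge0 z; nra.
- move=> S cS Sh; have [S1 SD SZ SM Sc] := cS; apply: subalgB => //.
  apply: yS => //; first by rewrite -(scale0r 1); apply: SZ.
  by move=> z Sz; apply/SZ/SD; [apply: subalgB|apply: SM].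
Qed.

(* In terms of the spectrum: [h] is self-adjoint with spectrum in [[0, 2 t]]. *)
Definition pos (h : A) := star h = h /\ exists2 t : R, 0 <= t & nrm (t%:S - h) <= t.

Lemma pos_sa h : pos h -> star h = h. Proof. by case. Qed.

Lemma pos0 : pos 0.
Proof. by split; [exact: star0|exists 0 => //; rewrite scale0r subr0 nrm0]. Qed.

Lemma posD x y : pos x -> pos y -> pos (x + y).
Proof.
case=> sx [t t0 ht] [sy [u u0 hu]]; split; first by rewrite starD sx sy.
exists (t + u); first by rewrite addr_ge0.
have -> : (t + u)%:S - (x + y) = (t%:S - x) + (u%:S - y) by nc.
by rewrite (le_trans (nrmD _ _)) // lerD.
Qed.

Lemma pos_sum I (r : seq I) (P : pred I) (F : I -> A) :
  (forall i, P i -> pos (F i)) -> pos (\sum_(i <- r | P i) F i).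
Proof. by move=> h; apply: big_ind => //; [exact: pos0|exact: posD]. Qed.

Lemma posZ (a : R) x : 0 <= a -> pos x -> pos (a%:C *: x).
Proof.
move=> a0 [sx [t t0 ht]]; split; first by rewrite starZ sx.
exists (a * t); first by rewrite mulr_ge0.
have -> : (a * t)%:S - a%:C *: x = a%:C *: (t%:S - x) by nc.
by rewrite nrmZ ger0_norm // ler_wpM2l.
Qed.

Lemma posZE (a : R) x : 0 < a -> pos (a%:C *: x) -> pos x.
Proof.
move=> a0 /(@posZ a^-1 _); rewrite scalerA -rmorphM mulVf ?gt_eqF // scale1r.
by apply; rewrite invr_ge0 ltW.
Qed.

Lemma posS (t : R) : 0 <= t -> pos t%:S.
Proof. by move=> t0; split; [exact: starS|exists t; rewrite ?subrr ?nrm0]. Qed.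

Lemma pos_nrmB h : star h = h -> pos ((nrm h)%:S - h).
Proof.
move=> sh; split; first by rewrite starB starS sh.
by exists (nrm h); [exact: nrm_ge0|rewrite subKr].
Qed.

Lemma pos_leB h (M : R) : star h = h -> nrm h <= M -> pos (M%:S - h).
Proof.
move=> sh hM; have -> : M%:S - h = (M - nrm h)%:S + ((nrm h)%:S - h) by nc.
by apply: posD; [apply: posS; rewrite subr_ge0|exact: pos_nrmB].
Qed.

Lemma pos_leD h (M : R) : star h = h -> nrm h <= M -> pos (M%:S + h).
Proof.
by move=> sh hM; rewrite -[h]opprK; apply: pos_leB; rewrite ?starN ?sh ?nrmN.
Qed.

(** With [T = t + 1], positive even for [t = 0], the element [h / T] lies in the unit ball around
    1. *)
Lemma pos_sqrt h : pos h ->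
  exists k, [/\ pos k, k * k = h & forall S, closed_subalg S -> S h -> S k].
Proof.
move=> [sh [t t0 ht]]; pose T := t + 1.
have T0 : 0 < T by rewrite ltr_wpDl.
have hT : nrm (1 - T^-1%:C *: h) <= 1.
  have -> : 1 - T^-1%:C *: h = T^-1%:C *: (T%:S - h).
    by nc; field; rewrite fmorph_eq0 gt_eqF.
  rewrite nrmZ ger0_norm; last by rewrite invr_ge0 ltW.
  rewrite ler_pdivrMl // mulr1.
  have -> : T%:S - h = 1%:S + (t%:S - h) by rewrite /T; nc.
  by have := nrmD 1%:S (t%:S - h); rewrite nrmS normr1 /T; lra.
have [|k [sk kk k1 kS]] := @sqrt_near1 (T^-1%:C *: h) _ hT; first by rewrite starZ sh.
have sT : Num.sqrt T ^+ 2 = T by rewrite sqr_sqrtr // ltW.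
exists ((Num.sqrt T)%:C *: k); split.
- apply: posZ; first exact: sqrtr_ge0.
  by split=> //; exists 1 => //; rewrite scale1r; apply: k1.
- have -> : (Num.sqrt T)%:C *: k * ((Num.sqrt T)%:C *: k) =
     (Num.sqrt T ^+ 2)%:C *: (k * k) by nc.
  by rewrite sT kk; nc; field; rewrite fmorph_eq0 gt_eqF.
- by move=> S cS Sh; have [_ _ SZ _ _] := cS; apply: (SZ); apply: (kS S cS); apply: (SZ).
Qed.

Lemma nrm_cartesian a b (M : R) : star a = a -> star b = b -> a * b = b * a ->
  a * a + b * b = M%:S -> 0 <= M -> nrm a ^+ 2 <= M.
Proof.
move=> sa sb ab e M0; pose u := a + iu *: b.
have su : star u = a - iu *: b by rewrite /u starD starZi sa sb.
have uu : star u * u = M%:S.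
  rewrite su -e /u; have -> : (a - iu *: b) * (a + iu *: b) =
    a * a + iu *: (a * b - b * a) - (iu * iu) *: (b * b) by nc.
  by rewrite ab iu2 subrr scaler0 scaleN1r opprK addr0.
have nu : nrm u ^+ 2 = M by rewrite -nrm_starM uu nrmS ger0_norm.
have -> : a = 2^-1%:C *: (u + star u) by rewrite su /u; nc; field.
have := nrmD u (star u); rewrite nrm_star nrmZ ger0_norm ?invr_ge0 //.
have := nrm_ge0 (u + star u); have := nrm_ge0 u; rewrite -nu; nra.
Qed.

(** For a self-adjoint contraction [l], the root [s] of [1 - l^2] commutes with [l]. Then
    [s^2 + l^2 = 1] bounds [s] by 1, so [1 - l^2 = s^2] has norm at most 1, and that is positivity
    of [l^2]. *)
Lemma pos_sqr k : star k = k -> pos (k * k).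
Proof.
move=> sk; pose T := nrm k + 1.
have T0 : 0 < T by rewrite ltr_wpDl // nrm_ge0.
pose l := T^-1%:C *: k.
have sl : star l = l by rewrite starZ sk.
have l1 : nrm l <= 1.
  rewrite nrmZ ger0_norm; last by rewrite invr_ge0 ltW.
  rewrite ler_pdivrMl // mulr1 /T; lra.
have -> : k * k = (T ^+ 2)%:C *: (l * l).
  by rewrite /l; nc; field; rewrite fmorph_eq0 gt_eqF.
apply: posZ; first exact: sqr_ge0.
have [||s [ss es _ sS]] := @sqrt_near1 (1 - l * l).
- by rewrite starB star1 starM sl.
- rewrite subKr (le_trans (nrmM _ _)) //; have := nrm_ge0 l; nra.
split; first by rewrite starM sl.
exists 1 => //; rewrite scale1r -es (le_trans (nrmM _ _)) // -expr2.
apply: (@nrm_cartesian s l) => //; last by rewrite es subrK scale1r.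
apply/esym; apply: (sS (fun y => l * y = y * l)); first exact: closed_commutant.
by nc.
Qed.

(* [h + i k l] with [k^2 = M - h], [l^2 = M + h] has modulus [M]. *)
Lemma nrm_le_pos h (M : R) : 0 <= M -> pos (M%:S - h) -> pos (M%:S + h) -> nrm h <= M.
Proof.
move=> M0 p1 p2.
have sh : star h = h.
  by have [/eqP + _] := p2; rewrite starD starS => /eqP/addrI.
have [k [[sk _] kk kS]] := pos_sqrt p1; have [l [[sl _] ll lS]] := pos_sqrt p2.
have hk : h * k = k * h.
  by apply: (kS (fun y => h * y = y * h)); [exact: closed_commutant|nc].
have hl : h * l = l * h.
  by apply: (lS (fun y => h * y = y * h)); [exact: closed_commutant|nc].
have kl : k * l = l * k.
  apply: (lS (fun y => k * y = y * k)); first exact: closed_commutant.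
  by rewrite mulrDr mulrDl hk; congr (_ + _); nc.
rewrite -(@ler_pXn2r _ 2) ?nnegrE ?nrm_ge0 //.
apply: (@nrm_cartesian h (k * l)) => //; last exact: sqr_ge0.
- by rewrite starM sk sl.
- by rewrite mulrA hk -mulrA hl mulrA.
have -> : k * l * (k * l) = (k * k) * (l * l) by rewrite !mulrA -(mulrA k l k) -kl !mulrA.
by rewrite kk ll; nc.
Qed.

Lemma pos_antisym h : pos h -> pos (- h) -> h = 0.
Proof.
move=> p n; apply: nrm_eq0; apply/le_anti; rewrite nrm_ge0 andbT.
by apply: nrm_le_pos; rewrite // scale0r ?sub0r ?add0r.
Qed.

Lemma pos_nrm_le a b : pos a -> pos (b - a) -> nrm a <= nrm b.
Proof.
move=> pa pba; have pb : pos b by rewrite -(subrK a b); apply: posD.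
apply: nrm_le_pos; first exact: nrm_ge0.
  have -> : (nrm b)%:S - a = ((nrm b)%:S - b) + (b - a) by nc.
  by apply: posD => //; apply/pos_nrmB/pos_sa.
by apply: posD => //; apply/posS/nrm_ge0.
Qed.

Lemma pos_S (t : R) : pos t%:S -> 0 <= t.
Proof.
move=> p; rewrite leNgt; apply/negP => t0.
have /eqP : t%:S = 0 :> A.
  apply: pos_antisym => //; have -> : - t%:S = (- t)%:S :> A by nc.
  by apply: posS; rewrite oppr_ge0 ltW.
by rewrite scaler_eq0 fmorph_eq0 (negbTE one_neq0) orbF lt_eqF.
Qed.

Lemma pos_eps h : (forall e : R, 0 < e -> pos (h + e%:S)) -> pos h.
Proof.
move=> hp; have sh : star h = h.
  by have [+ _] := hp 1 ltr01; rewrite starD starS => /addIr.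
split=> //; exists (nrm h); first exact: nrm_ge0.
apply/ler_addgt0Pr => e e0; apply: nrm_le_pos.
- by rewrite addr_ge0 ?nrm_ge0 ?ltW.
- have -> : (nrm h + e)%:S - ((nrm h)%:S - h) = h + e%:S by nc.
  exact: hp.
- apply: posD; last exact: pos_nrmB.
  by apply: posS; rewrite addr_ge0 ?nrm_ge0 ?ltW.
Qed.

Lemma posM_comm a b : pos a -> pos b -> a * b = b * a -> pos (a * b).
Proof.
move=> pa pb ab; have [k [[sk _] kk kS]] := pos_sqrt pa.
have [l [[sl _] ll lS]] := pos_sqrt pb.
have bk : b * k = k * b by apply: (kS (fun y => b * y = y * b)) => //; exact: closed_commutant.
have kl : k * l = l * k by apply: (lS (fun y => k * y = y * k)) => //; exact: closed_commutant.
have -> : a * b = (k * l) * (k * l).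
  by rewrite -kk -ll !mulrA -(mulrA k l k) -kl !mulrA.
by apply: pos_sqr; rewrite starM sk sl.
Qed.

(** * Contractions and inverses *)

Lemma expr_small (q e : R) : 0 <= q -> q < 1 -> 0 < e -> exists n, q ^+ n < e.
Proof.
move=> q0 q1 e0.
have bern n : q ^+ n * (1 + n%:R * (1 - q)) <= 1.
  elim: n => [|n IH]; first by rewrite expr0 mul0r addr0 mulr1.
  rewrite exprS -[n.+1]addn1 natrD.
  have n0 : 0 <= n%:R :> R by []; have qn : 0 <= q ^+ n by exact: exprn_ge0.
  have h : q * (1 + (n%:R + 1) * (1 - q)) <= 1 + n%:R * (1 - q).
    rewrite -subr_ge0.
    have -> : 1 + n%:R * (1 - q) - q * (1 + (n%:R + 1) * (1 - q)) =
      (n%:R + 1) * (1 - q) ^+ 2 by ring.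
    by rewrite mulr_ge0 ?sqr_ge0 ?addr_ge0.
  by apply: le_trans IH; rewrite [q * _]mulrC -mulrA ler_wpM2l.
have c0 : 0 < 1 - q by rewrite subr_gt0.
pose n := Num.bound ((e * (1 - q))^-1); exists n.
have hn : (e * (1 - q))^-1 < n%:R.
  by apply: le_lt_trans (archi_boundP _) => //; rewrite invr_ge0 mulr_ge0 // ltW.
have := bern n; have : 0 <= q ^+ n by exact: exprn_ge0.
have : 1 < n%:R * (e * (1 - q)) by rewrite -ltr_pdivrMr ?mulr_gt0 // div1r.
move: (q ^+ n) (n%:R) => x N h x0 hx; rewrite ltNge; apply/negP => ex.
nra.
Qed.

Lemma fixpoint (S : A -> Prop) (f : A -> A) (q : R) x0 :
  norm_closed nrm S -> S x0 -> (forall x, S x -> S (f x)) -> 0 <= q -> q < 1 ->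
  (forall x y, S x -> S y -> nrm (f x - f y) <= q * nrm (x - y)) ->
  exists2 x, S x & f x = x.
Proof.
move=> cS S0 Sf q0 q1 hf; pose x n := iter n f x0.
have Sx n : S (x n) by elim: n => //= n /Sf.
pose D := nrm (x 1%N - x 0%N).
have D0 : 0 <= D := nrm_ge0 _.
have d1 n : nrm (x n.+1 - x n) <= q ^+ n * D.
  elim: n => [|n IH]; first by rewrite expr0 mul1r.
  by apply: le_trans (hf _ _ (Sx n.+1) (Sx n)) _; rewrite exprS -mulrA ler_wpM2l.
have dk n k : nrm (x (n + k)%N - x n) * (1 - q) <= q ^+ n * D.
  suff : nrm (x (n + k)%N - x n) * (1 - q) <= (q ^+ n - q ^+ (n + k)) * D.
    move/le_trans; apply; rewrite ler_wpM2r // lerBlDr lerDl exprn_ge0 //.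
  elim: k => [|k IH]; first by rewrite addn0 !subrr nrm0 !mul0r.
  rewrite addnS; have := nrm_tri (x (n + k).+1) (x (n + k)%N) (x n).
  have := d1 (n + k)%N; rewrite [q ^+ (n + k).+1]exprS.
  move: (q ^+ (n + k)) (q ^+ n) (nrm _) (nrm _) (nrm _) IH => *; nra.
have c0 : 0 < 1 - q by rewrite subr_gt0.
have cx : norm_cauchy nrm x.
  move=> e e0; have D1 : 0 < D + 1 by rewrite ltr_wpDl.
  have e1 : 0 < e * (1 - q) / (2 * (D + 1)) by rewrite divr_gt0 ?mulr_gt0.
  have [N hN] := expr_small q0 q1 e1.
  have b n : (N <= n)%N -> nrm (x n - x N) < e / 2.
    move=> /subnKC <-; rewrite -(ltr_pM2r c0) (le_lt_trans (dk _ _)) //.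
    move: hN; rewrite ltr_pdivlMr ?mulr_gt0 //.
    have : 0 <= q ^+ N by exact: exprn_ge0.
    move: (q ^+ N) => *; nra.
  exists N => m n Nm Nn; have := nrm_tri (x m) (x N) (x n).
  have := b _ Nm; have := b _ Nn; rewrite (nrmBC (x n)); lra.
have [l cl] := complete cx; have Sl : S l by apply: cS cl.
exists l => //; apply/eqP; rewrite -subr_eq0; apply/eqP; apply: nrm_eps0 => e e0.
have [N hN] := cl _ (divr_gt0 e0 (ltr0n R 2)).
have a1 := hN N (leqnn N); have a2 := hN N.+1 (leqnSn N).
have := nrm_tri (f l) (x N.+1) l; have := hf _ _ Sl (Sx N); rewrite (nrmBC l (x N)).
have := nrm_ge0 (x N - l); rewrite [x N.+1]/= -/(x N) in a2 *; nra.
Qed.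

(** The Neumann series, as the fixed point of [y -> (1 + (T - g) y) / T]. For [T = nrm g + d] the
    norm of [T - g] is at most [T - d], which gives the contraction factor [1 - d / T]. Running
    inside the intersection of all closed subalgebras containing [g] locates the inverse there. *)
Lemma pos_inv g (d : R) : 0 < d -> pos (g - d%:S) ->
  exists g', [/\ g * g' = 1, g' * g = 1, star g' = g' &
    forall S, closed_subalg S -> S g -> S g'].
Proof.
move=> d0 pg; pose T := nrm g + d.
have sg : star g = g by have [+ _] := pg; rewrite starB starS => /addIr.
have T0 : 0 < T by rewrite ltr_wpDl ?nrm_ge0.
have nT : nrm (T%:S - g) <= T - d.
  apply: nrm_le_pos; first by rewrite /T addrK nrm_ge0.
    by have -> : (T - d)%:S - (T%:S - g) = g - d%:S by nc.
  apply: posD; first by apply: posS; rewrite /T addrK nrm_ge0.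
  by apply: pos_leB => //; rewrite /T lerDl ltW.
pose f y := T^-1%:C *: (1 + (T%:S - g) * y).
pose S0 y := forall S, closed_subalg S -> S g -> S y.
have S0D x y : S0 x -> S0 y -> S0 (x + y).
  by move=> hx hy S cS Sg; have [_ SD _ _ _] := cS; apply: SD; [apply: hx|apply: hy].
have [||||||y Sy fy] := @fixpoint S0 f (1 - d / T) 1.
- move=> u l Su cu S cS Sg; have [_ _ _ _ Sc] := cS.
  by apply: Sc cu => n; apply: Su.
- by move=> S [].
- move=> y Sy S cS Sg; have [S1 SD SZ SM _] := cS.
  apply: (SZ); apply: (SD) => //; apply: (SM); last exact: Sy.
  by apply: subalgB => //; apply: subalgS.
- by rewrite subr_ge0 ler_pdivrMr // mul1r /T lerDr nrm_ge0.
- by rewrite ltrBlDr ltrDl divr_gt0.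
- move=> x y _ _.
  have -> : f x - f y = T^-1%:C *: ((T%:S - g) * (x - y)) by rewrite /f; nc.
  rewrite nrmZ ger0_norm; last by rewrite invr_ge0 ltW.
  rewrite ler_pdivrMl // (le_trans (nrmM _ _)) // mulrA ler_wpM2r ?nrm_ge0 //.
  by rewrite mulrBr mulr1 mulrCA divff ?gt_eqF // mulr1.
have gy : g * y = 1.
  have e : T%:C *: y = 1 + (T%:S - g) * y.
    by rewrite -{1}fy /f; nc; field; rewrite fmorph_eq0 gt_eqF.
  have -> : g * y = 1 + T%:C *: y - (1 + (T%:S - g) * y) by nc.
  by rewrite -e addrK.
have yg : y * g = 1.
  by rewrite -gy; apply/esym; apply: (Sy (fun y => g * y = y * g)) => //; exact: closed_commutant.
exists y; split=> //.
have : star y * g = 1 by rewrite -{1}sg -starM gy star1.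
by move=> h; rewrite -[star y]mulr1 -gy mulrA h mul1r.
Qed.

(** For [c] above the norm of the inverse, [c g - 1 = g (c - g1)] is a product of commuting positive
    elements. *)
Lemma pos_inv_lower g g1 g2 : pos g -> g * g1 = 1 -> g2 * g = 1 ->
  exists2 d : R, 0 < d & pos (g - d%:S).
Proof.
move=> pg e1 e2; have e : g2 = g1 by rewrite -[g2]mulr1 -e1 mulrA e2 mul1r.
rewrite {}e in e2; have sg := pos_sa pg.
have s1 : star g1 = g1.
  have h : star g1 * g = 1 by rewrite -{1}sg -starM e1 star1.
  by rewrite -[star g1]mulr1 -e1 mulrA h mul1r.
pose c := nrm g1 + 1; have c0 : 0 < c by rewrite ltr_wpDl ?nrm_ge0.
exists c^-1; first by rewrite invr_gt0.
apply: (@posZE c) => //.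
have -> : c%:C *: (g - c^-1%:S) = g * (c%:S - g1).
  by rewrite mulrBr e1; nc; field; rewrite fmorph_eq0 gt_eqF.
apply: posM_comm => //; first by apply: pos_leB => //; rewrite lerDl.
by rewrite mulrBr mulrBl e1 e2; nc.
Qed.

(** * Positivity of [star x * x] *)

Lemma addr_starM_pos y : pos (star y * y + y * star y).
Proof.
pose c := iu *: (y - star y).
have sc : star c = c by rewrite /c starZi starB starK; nc.
have sy : star (y + star y) = y + star y by rewrite starD starK addrC.
apply: (@posZE 2) => //.
have -> : 2%:C *: (star y * y + y * star y) = (y + star y) * (y + star y) + c * c.
  have -> : c * c = (iu * iu) *: ((y - star y) * (y - star y)) by rewrite /c; nc.
  by rewrite iu2; nc.
by apply: posD; exact: pos_sqr.
Qed.

(** The two products of [y] and [star y] have the same nonzero spectrum; the inverse is the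
    classical [(1 - star y * z * y) / m]. *)
Lemma inv_swap y z (m : R) : 0 < m -> (y * star y + m%:S) * z = 1 ->
  z * (y * star y + m%:S) = 1 ->
  exists v, (star y * y + m%:S) * v = 1 /\ v * (star y * y + m%:S) = 1.
Proof.
move=> m0 e1 e2; exists (m^-1%:C *: (1 - star y * z * y)); split.
  have -> : (star y * y + m%:S) * (m^-1%:C *: (1 - star y * z * y)) =
    m^-1%:C *: (star y * y + m%:S - star y * ((y * star y + m%:S) * z) * y) by nc.
  by rewrite e1; nc; field; rewrite fmorph_eq0 gt_eqF.
have -> : m^-1%:C *: (1 - star y * z * y) * (star y * y + m%:S) =
  m^-1%:C *: (star y * y + m%:S - star y * (z * (y * star y + m%:S)) * y) by nc.
by rewrite e2; nc; field; rewrite fmorph_eq0 gt_eqF.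
Qed.

Lemma pos_expX g k : pos g -> pos (g ^+ k).
Proof.
move=> pg; elim: k => [|k IH]; first by rewrite expr0 -(scale1r 1); apply: posS.
by rewrite exprS; apply: posM_comm => //; rewrite -exprS -exprSr.
Qed.

(** The power [t^k] increases on the positive half-line, so both factors have the same sign; the
    recursion on [k] replaces the functional calculus. *)
Lemma pos_chebyshev g (a : R) k : pos g -> 0 <= a ->
  pos ((g ^+ k - (a ^+ k)%:S) * (g - a%:S)).
Proof.
move=> pg a0; elim: k => [|k IH].
  by rewrite !expr0 scale1r subrr mul0r; exact: pos0.
have cg : g ^+ k * g = g * g ^+ k by rewrite -exprS -exprSr.
have -> : (g ^+ k.+1 - (a ^+ k.+1)%:S) * (g - a%:S) =
   g * ((g ^+ k - (a ^+ k)%:S) * (g - a%:S)) +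
   (a ^+ k)%:C *: ((g - a%:S) * (g - a%:S)).
  by rewrite !exprS; nc.
apply: posD; last first.
  by apply: posZ; [exact: exprn_ge0|apply: pos_sqr; rewrite starB starS (pos_sa pg)].
apply: posM_comm => //.
have -> : (g ^+ k - (a ^+ k)%:S) * (g - a%:S) * g =
   (g ^+ k * g) * g - (a ^+ k)%:C *: (g * g) - a%:C *: (g ^+ k * g) + (a ^+ k * a)%:C *: g.
  by nc.
by rewrite cg; nc.
Qed.

(* Were [-m < 0] the bottom of the spectrum of [h = x* x], multiplying [x] by a
   high power of [g], a decreasing affine function of [h], would leave the
   negative part of [x* x] only; [y y* = 2 (a^2 + b^2) - y* y] would then be
   positive up to a small error, although [y y* + m] and [y* y + m] are
   invertible together. *)
Lemma starM_inv_shift x (m : R) : 0 < m -> pos (star x * x + m%:S) ->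
  exists2 d : R, 0 < d & pos (star x * x + m%:S - d%:S).
Proof.
move=> m0 pm; set h := star x * x in pm *.
have sh : star h = h by rewrite starM starK.
(* The decreasing affine map of [[- m, M]] onto [[0, 1]] sends [h] to [g], and [a] is the image of
   0; thus [h = W (a - g)] is negative where [g] exceeds [a]. *)
pose M := nrm h; pose W := M + m; pose a := M / W.
have M0 : 0 <= M := nrm_ge0 _.
have W0 : 0 < W by rewrite ltr_wpDl.
have a0 : 0 <= a by rewrite divr_ge0 // ltW.
have a1 : a < 1 by rewrite ltr_pdivrMr // mul1r ltrDl.
have Wa : W * a = M by rewrite mulrC divfK // gt_eqF.
pose g := W^-1%:C *: (M%:S - h).
have Wn : W%:C != 0 :> R[i] by rewrite fmorph_eq0 gt_eqF.
have pg : pos g by apply: posZ; [rewrite invr_ge0 ltW|exact: pos_nrmB].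
have sg := pos_sa pg.
have hE : h = W%:C *: (a%:S - g).
  have -> : W%:C *: (a%:S - g) = (W * a)%:S - W%:C *: g by nc.
  by rewrite Wa /g; nc; field; exact: Wn.
have [n hn] : exists n, a ^+ n < m / W by apply: expr_small => //; rewrite divr_gt0.
pose y := x * g ^+ n; pose k := (n + n)%N.
have gg : g ^+ n * g ^+ n = g ^+ k by rewrite exprD.
have cg : g ^+ n * g = g * g ^+ n by rewrite -exprS -exprSr.
have yy : star y * y = W%:C *: (a%:C *: g ^+ k - g ^+ k.+1).
  rewrite /y starM (pos_sa (pos_expX n pg)) mulrA -(mulrA (g ^+ n)) -/h hE.
  have -> : g ^+ n * (W%:C *: (a%:S - g)) * g ^+ n =
    W%:C *: (a%:C *: (g ^+ n * g ^+ n) - (g ^+ n * g) * g ^+ n) by nc.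
  by rewrite cg -mulrA gg exprS.
pose e := W * a ^+ k.+1.
have em : e < m.
  have ank : a ^+ k.+1 <= a ^+ n.
    by apply: ler_wiXn2l => //; [exact: ltW|exact: leq_trans (leq_addr n n) (leqnSn k)].
  rewrite /e -ltr_pdivlMl // mulrC; exact: le_lt_trans hn.
have pe : pos (e%:S - star y * y).
  have -> : e%:S - star y * y = W%:C *: ((a ^+ k)%:C *: g +
     (g ^+ k - (a ^+ k)%:S) * (g - a%:S)).
    by rewrite yy /e !exprSr; nc.
  apply: posZ; first exact: ltW.
  apply: posD; last exact: pos_chebyshev.
  by apply: posZ => //; exact: exprn_ge0.
have [||z [z1 z2 _ _]] := @pos_inv (y * star y + m%:S) (m - e).
- by rewrite subr_gt0.
- have -> : y * star y + m%:S - (m - e)%:S = (star y * y + y * star y) +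
    (e%:S - star y * y) by nc.
  by apply: posD => //; exact: addr_starM_pos.
have [v [v1 v2]] := inv_swap m0 z1 z2.
(* As a polynomial in [g], [star y * y + m] vanishes at 1, the point where [h] takes the value
   [- m]; [Q] is its quotient by [1 - g]. Invertibility thus passes to [h + m]. *)
pose Q := W%:C *: ((1 - a)%:C *: (\sum_(i < k) g ^+ i) + g ^+ k).
have sumE : g ^+ k - 1 = (g - 1) * \sum_(i < k) g ^+ i by exact: subrX1.
have sumE' : g ^+ k - 1 = (\sum_(i < k) g ^+ i) * (g - 1).
  rewrite sumE; apply: commr_sum => i _; apply/commr_sym/commrB; last exact: commr1.
  exact/commr_sym/commrX.
have mW : m = W * (1 - a) by rewrite mulrBr mulr1 Wa /W; ring.
have P1 : star y * y + m%:S = (1 - g) * Q.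
  have -> : (1 - g) * Q = W%:C *: ((a - 1)%:C *: ((g - 1) * \sum_(i < k) g ^+ i)
     + g ^+ k - g * g ^+ k) by rewrite /Q; nc.
  by rewrite -sumE yy mW exprS; nc.
have P2 : star y * y + m%:S = Q * (1 - g).
  have -> : Q * (1 - g) = W%:C *: ((a - 1)%:C *: ((\sum_(i < k) g ^+ i) * (g - 1))
     + g ^+ k - g ^+ k * g) by rewrite /Q; nc.
  by rewrite -sumE' yy mW exprSr; nc.
have hm : h + m%:S = W%:C *: (1 - g).
  have -> : W%:C *: (1 - g) = W%:S - W%:C *: g by nc.
  have -> : W%:C *: g = M%:S - h by rewrite /g; nc; field; exact: Wn.
  by rewrite /W; nc.
apply: (@pos_inv_lower _ (W^-1%:C *: (Q * v)) (W^-1%:C *: (v * Q))) => //.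
  rewrite hm -[RHS]v1 P1; nc; field; exact: Wn.
by rewrite hm -[RHS]v2 P2; nc; field.
Qed.

(** The infimum of the shifts that make [h] positive is attained, since positivity survives limits;
    were it positive, [starM_inv_shift] would lower it. *)
Lemma starM_pos x : pos (star x * x).
Proof.
set h := star x * x.
have sh : star h = h by rewrite starM starK.
pose E := [set l : R | 0 <= l /\ pos (h + l%:S)]%classic.
have E0 : has_inf E.
  split; last by exists 0 => l [].
  by exists (nrm h); split; [exact: nrm_ge0|rewrite addrC; exact: pos_leD].
pose m := inf E.
have m0 : 0 <= m by apply: lb_le_inf; [case: E0|move=> l []].
have pm : pos (h + m%:S).
  apply: pos_eps => e e0; have [l [l0 pl] lm] := inf_adherent e0 E0.
  have -> : h + m%:S + e%:S = (h + l%:S) + (m + e - l)%:S by nc.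
  by apply: posD => //; apply: posS; rewrite subr_ge0 ltW.
have [mz|mz] := eqVneq m 0; first by move: pm; rewrite mz scale0r addr0.
have {mz}m1 : 0 < m by rewrite lt0r mz.
have [d d0 pd] := starM_inv_shift m1 pm.
have [md|md] := leP d m; last first.
  have -> : h = (h + m%:S - d%:S) + (d - m)%:S by nc.
  by apply: posD => //; apply: posS; rewrite subr_ge0 ltW.
have /(ge_inf (proj2 E0)) : E (m - d).
  split; first by rewrite subr_ge0.
  by have -> : h + (m - d)%:S = h + m%:S - d%:S by nc.
by rewrite -/m lerBrDr gerDl leNgt d0.
Qed.

Lemma mul_star_pos x : pos (x * star x).
Proof. by have := starM_pos (star x); rewrite starK. Qed.

Lemma pos_conj x h : pos h -> pos (star x * h * x).
Proof.
move=> ph; have [k [[sk _] <- _]] := pos_sqrt ph.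
by have := starM_pos (k * x); rewrite starM sk !mulrA.
Qed.

Lemma starM_eq0 x : star x * x = 0 -> x = 0.
Proof.
move=> e; apply: nrm_eq0; apply/eqP; rewrite -sqrf_eq0 -nrm_starM e.
by rewrite nrm0.
Qed.

Lemma pos_sum_eq0 (I : finType) (F : I -> A) : (forall i, pos (F i)) ->
  \sum_i F i = 0 -> forall i, F i = 0.
Proof.
move=> pF e i; apply: pos_antisym => //.
have -> : - F i = \sum_(j | j != i) F j.
  by move/eqP: e; rewrite (bigD1 i) //= addrC addr_eq0 => /eqP ->.
by apply: pos_sum.
Qed.

(** The defect is the sum of [star (x - x') * (x - x')] over the pairs of entries; an induction step
    adds the pairs that contain [a]. *)
Lemma sqr_sum_le (s : seq A) :
  pos ((size s)%:R%:C *: (\sum_(x <- s) star x * x) -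
       star (\sum_(x <- s) x) * (\sum_(x <- s) x)).
Proof.
elim: s => [|a s IH]; first by rewrite !big_nil star0 scaler0 mul0r subr0; exact: pos0.
rewrite !big_cons /=.
have e : (size s).+1%:R = (size s)%:R + 1 :> R by rewrite -[in LHS]addn1 natrD.
have h : pos ((size s)%:R%:C *: (star a * a) + \sum_(x <- s) star x * x -
    star a * \sum_(x <- s) x - star (\sum_(x <- s) x) * a).
  have -> : (size s)%:R%:C *: (star a * a) + \sum_(x <- s) star x * x -
      star a * \sum_(x <- s) x - star (\sum_(x <- s) x) * a =
    \sum_(x <- s) star (a - x) * (a - x).
    elim: s {IH e} => [|x s IH]; rewrite ?big_nil ?big_cons /=.
      by rewrite star0; nc.
    rewrite -IH !starD !starN -[(size s).+1]addn1 natrD.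
    set u := \sum_(j <- s) j; set v := \sum_(j <- s) star j * j.
    by move: ((size s)%:R : R) => N; nc.
  by apply: (@pos_sum A s xpredT (fun x => star (a - x) * (a - x))) => x _; exact: starM_pos.
have := posD IH h; rewrite starD e; move: ((size s)%:R : R) => N.
set u := \sum_(j <- s) j; set v := \sum_(j <- s) star j * j.
by congr pos; nc.
Qed.

(** * Norm-one projections onto a simple subalgebra *)

Definition lin (E : A -> A) := forall (c : R[i]) x y, E (c *: x + y) = c *: E x + E y.

Lemma linD E (l : lin E) x y : E (x + y) = E x + E y.
Proof. by have := l 1 x y; rewrite !scale1r. Qed.

Lemma lin0 E (l : lin E) : E 0 = 0.
Proof. by have /eqP := linD l 0 0; rewrite addr0 -subr_eq subrr => /eqP. Qed.

Lemma linZ E (l : lin E) (c : R[i]) x : E (c *: x) = c *: E x.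
Proof. by have := l c x 0; rewrite (lin0 l) !addr0. Qed.

Lemma linN E (l : lin E) x : E (- x) = - E x.
Proof. by rewrite -scaleN1r (linZ l) scaleN1r. Qed.

Lemma linB E (l : lin E) x y : E (x - y) = E x - E y.
Proof. by rewrite (linD l) (linN l). Qed.

Lemma lin_sum E (l : lin E) I (r : seq I) (P : pred I) (F : I -> A) :
  E (\sum_(i <- r | P i) F i) = \sum_(i <- r | P i) E (F i).
Proof. by apply: (big_morph E) => [x y|]; [exact: linD|exact: lin0]. Qed.

Lemma cartesianE x : exists a b, [/\ star a = a, star b = b, x = a + iu *: b &
  forall S, closed_subalg S -> S x -> S (star x) -> S a /\ S b].
Proof.
exists (2^-1%:C *: (x + star x)), ((2^-1%:C * iu) *: (star x - x)); split.
- by rewrite starZ starD starK addrC.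
- by rewrite -scalerA starZ starZi starB starK; nc.
- have -> : iu *: ((2^-1%:C * iu) *: (star x - x)) = (iu * iu * 2^-1%:C) *: (star x - x) by nc.
  by rewrite iu2; nc; field.
- move=> S cS Sx Sy; have [_ SD SZ _ _] := cS; split; apply: (SZ); first exact: SD.
  exact: subalgB.
Qed.

(** For the imaginary part [b] of [E h], the square of [nrm (b + t)] is at most that of
    [nrm (h + i t)], hence at most [nrm h ^ 2 + t^2]; a nonzero [b] violates this for some large [t]
    of one sign. *)
Lemma contraction_sa E h : lin E -> E 1 = 1 -> (forall x, nrm (E x) <= nrm x) ->
  star h = h -> star (E h) = E h.
Proof.
move=> lE E1 cE sh; have [a [b [sa sb ez _]]] := cartesianE (E h).
pose H := nrm h; have H0 : 0 <= H := nrm_ge0 h.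
have key (t : R) : nrm (b + t%:S) ^+ 2 <= H ^+ 2 + t ^+ 2.
  pose w := E (h + (iu * t%:C) *: 1).
  have wE : w = a + iu *: (b + t%:S) by rewrite /w (linD lE) (linZ lE) E1 ez; nc.
  have n1 : nrm (b + t%:S) <= nrm w.
    have sw : star w = a - iu *: (b + t%:S).
      by rewrite wE starD starZi starD starS sa sb.
    have -> : b + t%:S = (2^-1%:C) *: (iu *: (star w - w)).
      have -> : star w - w = - (2%:C * iu) *: (b + t%:S) by rewrite sw wE; nc.
      have -> : iu *: (- (2%:C * iu) *: (b + t%:S)) = (- (2%:C) * (iu * iu)) *: (b + t%:S) by nc.
      by rewrite iu2; nc; field.
    rewrite nrmZ nrmZi ger0_norm ?invr_ge0 //.
    by have := nrmB (star w) w; rewrite nrm_star; lra.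
  have n2 : nrm (h + (iu * t%:C) *: 1) ^+ 2 <= H ^+ 2 + t ^+ 2.
    rewrite -nrm_starM starD -scalerA starZi starZ star1 sh.
    have -> : (h - iu *: (t%:C *: 1)) * (h + iu *: (t%:C *: 1)) =
      h * h - ((iu * iu) * (t ^+ 2)%:C) *: 1 by nc.
    have -> : h * h - ((iu * iu) * (t ^+ 2)%:C) *: 1 = h * h + (t ^+ 2)%:S.
      by rewrite iu2; nc.
    rewrite (le_trans (nrmD _ _)) // nrmS ger0_norm ?sqr_ge0 // lerD2r expr2.
    exact: nrmM.
  have := cE (h + (iu * t%:C) *: 1); rewrite -/w.
  have := nrm_ge0 (b + t%:S); have := nrm_ge0 w; have := nrm_ge0 (h + (iu * t%:C) *: 1).
  move: (nrm _) (nrm _) (nrm _) n1 n2 => *; nra.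
have small (e : R) : 0 < e -> exists t, [/\ 0 < t & nrm (b + t%:S) <= t + e /\
    nrm (b + (- t)%:S) <= t + e].
  move=> e0; exists (H ^+ 2 / e + 1); set t := _ + 1.
  have t0 : 0 < t by rewrite ltr_wpDl // divr_ge0 ?sqr_ge0 // ltW.
  have et : H ^+ 2 <= e * t.
    by rewrite /t mulrDr mulr1 mulrC divfK ?gt_eqF // lerDl ltW.
  by split=> //; split; [have := key t|have := key (- t)];
    have := nrm_ge0 (b + t%:S); have := nrm_ge0 (b + (- t)%:S);
    move: (nrm _) (nrm _) => *; nra.
suff b0 : b = 0 by rewrite ez b0 scaler0 addr0 sa.
apply: pos_antisym; apply: pos_eps => e e0; have [t [t0 [h1 h2]]] := small e e0.
  have -> : b + e%:S = (t + e)%:S + (b + (- t)%:S) by nc.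
  by apply: pos_leD => //; rewrite starD starS sb.
have -> : - b + e%:S = (t + e)%:S - (b + t%:S) by nc.
by apply: pos_leB => //; rewrite starD starS sb.
Qed.

Lemma contraction_star E x : lin E -> E 1 = 1 -> (forall x, nrm (E x) <= nrm x) ->
  E (star x) = star (E x).
Proof.
move=> lE E1 cE; have [a [b [sa sb -> _]]] := cartesianE x.
rewrite !starD !starZi sa sb (linB lE) !(linD lE) !(linZ lE) starD starZi.
by rewrite !contraction_sa.
Qed.

Lemma contraction_posE E x : lin E -> E 1 = 1 -> (forall x, nrm (E x) <= nrm x) ->
  pos x -> pos (E x).
Proof.
move=> lE E1 cE [sx [t t0 ht]]; split; first by rewrite -contraction_star // sx.
exists t => //; have -> : t%:S - E x = E (t%:S - x) by rewrite (linB lE) (linZ lE) E1.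
exact: le_trans (cE _) ht.
Qed.

(** * Bilinearity of the expectation over [B] *)

Section Tomiyama.
Variables (B : A -> Prop) (E : A -> A).
Hypothesis hB : unital_cstar_subalgebra nrm star B.
Hypothesis hBs : simple_cstar nrm B.
Hypothesis hirr : irreducible_inclusion B.
Hypothesis hE : cond_exp nrm B E.

Lemma ucs_subalg : closed_subalg B.
Proof. by have [[[_ ? ? ? _] ?] ?] := hB. Qed.

Lemma ucs_star x : B x -> B (star x).
Proof. by have [[[_ _ _ _ h] _] _] := hB; apply: h. Qed.

Lemma ucsD x y : B x -> B y -> B (x + y). Proof. by have [_ h _ _ _] := ucs_subalg; apply: h. Qed.
Lemma ucsZ c x : B x -> B (c *: x). Proof. by have [_ _ h _ _] := ucs_subalg; apply: h. Qed.
Lemma ucsM x y : B x -> B y -> B (x * y). Proof. by have [_ _ _ h _] := ucs_subalg; apply: h. Qed.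
Lemma ucsB x y : B x -> B y -> B (x - y). Proof. exact: subalgB ucs_subalg. Qed.
Lemma ucs1 : B 1. Proof. by have [h _ _ _ _] := ucs_subalg. Qed.
Lemma ucs0 : B 0. Proof. by have [[[h _ _ _ _] _] _] := hB. Qed.

Lemma E_lin : lin E. Proof. by have [h _ _ _] := hE. Qed.
Lemma E_B x : B (E x). Proof. by have [_ h _ _] := hE. Qed.
Lemma E_id b : B b -> E b = b. Proof. by have [_ _ h _] := hE; apply: h. Qed.
Lemma E_nrm x : nrm (E x) <= nrm x.
Proof. by have [_ _ _ h] := hE; have := h x; rewrite mul1r. Qed.
Lemma E_1 : E 1 = 1. Proof. exact: E_id ucs1. Qed.

Lemma E_star x : E (star x) = star (E x).
Proof. exact: contraction_star E_lin E_1 E_nrm. Qed.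

Lemma E_pos x : pos x -> pos (E x).
Proof. exact: contraction_posE E_lin E_1 E_nrm. Qed.

(* [x |-> u* E(u x)] is again a unital contraction, hence star-preserving. *)
Lemma E_unitary u x : B u -> star u * u = 1 -> u * star u = 1 ->
  E (u * x * u) = u * E x * u.
Proof.
move=> Bu u1 u2; pose G x := star u * E (u * x).
have nu : nrm u = 1.
  have := nrm_starM u; rewrite u1 nrm1 => /esym/eqP; rewrite sqrf_eq1.
  by case/orP => /eqP // h; have := nrm_ge0 u; rewrite h oppr_ge0 ler10.
have lG : lin G.
  move=> c y z; rewrite /G mulrDr -scalerAr (linD E_lin) (linZ E_lin).
  by rewrite mulrDr -scalerAr.
have G1 : G 1 = 1 by rewrite /G mulr1 E_id.
have cG y : nrm (G y) <= nrm y.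
  rewrite (le_trans (nrmM _ _)) // nrm_star nu mul1r (le_trans (E_nrm _)) //.
  by rewrite (le_trans (nrmM _ _)) // nu mul1r.
have e : star u * E (u * x * u) = E x * u.
  have := contraction_star (star (x * u)) lG G1 cG; rewrite starK /G mulrA => ->.
  have -> : u * star (x * u) = star x by rewrite starM mulrA u2 mul1r.
  by rewrite starM starK E_star starK.
by rewrite -[LHS]mul1r -u2 -mulrA e mulrA.
Qed.

(** For small [t] the elements [i s + t b] and [i s - t b], with [s] the root of [1 - t^2 b^2], are
    unitaries of [B]. The difference of the two instances of [E_unitary] isolates the part odd in
    [t], a multiple of [s x b + b x s]; as [1 - s] has norm at most [t], the identity with 1 in
    place of [s] follows in the limit. *)
Lemma E_jordan_sa b x : B b -> star b = b -> nrm b <= 1 ->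
  E (b * x + x * b) = b * E x + E x * b.
Proof.
move=> Bb sb b1; apply/eqP; rewrite -subr_eq0; apply/eqP; apply: nrm_eps0 => e e0.
have nx := nrm_ge0 x.
(* Small enough that the two error terms, each at most [2 t nrm x], add up to at most [e]. *)
pose t := e / (4 * nrm x + e).
have d0 : 0 < 4 * nrm x + e by rewrite ltr_wpDl // mulr_ge0.
have t0 : 0 < t by rewrite divr_gt0.
have t1 : t <= 1 by rewrite ler_pdivrMr // mul1r lerDr mulr_ge0.
have te : 4 * t * nrm x <= e.
  have : t * (4 * nrm x + e) = e by rewrite divfK // gt_eqF.
  nra.
pose h := 1 - (t ^+ 2)%:C *: (b * b).
have sh : star h = h by rewrite starB star1 starZ starM sb.
have h1 : nrm (1 - h) <= t ^+ 2.
  have -> : 1 - h = (t ^+ 2)%:C *: (b * b) by rewrite /h; nc.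
  have nb : nrm (b * b) <= 1 by have := nrmM b b; have := nrm_ge0 b; nra.
  by rewrite nrmZ ger0_norm ?sqr_ge0 // ler_piMr ?sqr_ge0.
have t2 : t ^+ 2 <= t by nra.
have [|s [ss es sd sS]] := sqrt_near1 sh; first by lra.
have {sd}sd : nrm (1 - s) <= t by apply: sd; lra.
have Bs : B s.
  apply: sS; [exact: ucs_subalg|apply: ucsB; first exact: ucs1].
  by apply: ucsZ; apply: ucsM.
have bs : b * s = s * b.
  by apply: (sS (fun y => b * y = y * b)); [exact: closed_commutant|rewrite /h; nc].
pose u := iu *: s + t%:C *: b; pose v := iu *: s - t%:C *: b.
have su : star u = - v by rewrite /u starD starZi starZ ss sb /v; nc.
have sv : star v = - u by rewrite /v starB starZi starZ ss sb /u; nc.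
have uv : u * v = -1.
  have -> : u * v = (iu * iu) *: (s * s) - (iu * t%:C) *: (s * b - b * s) -
    (t ^+ 2)%:C *: (b * b) by rewrite /u /v; nc.
  by rewrite es bs iu2 /h; nc.
have vu : v * u = -1.
  have -> : v * u = (iu * iu) *: (s * s) + (iu * t%:C) *: (s * b - b * s) -
    (t ^+ 2)%:C *: (b * b) by rewrite /u /v; nc.
  by rewrite es bs iu2 /h; nc.
have Bu : B u by apply: ucsD; apply: ucsZ.
have Bv : B v by apply: ucsB; apply: ucsZ.
have eu := @E_unitary u x Bu; rewrite su mulNr mulrN uv vu opprK in eu.
have ev := @E_unitary v x Bv; rewrite sv mulNr mulrN uv vu opprK in ev.
have key : E (s * x * b + b * x * s) = s * E x * b + b * E x * s.
  have c0 : 2%:C * iu * t%:C != 0 :> R[i].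
    rewrite !mulf_neq0 //; first by rewrite fmorph_eq0 pnatr_eq0.
      by apply/eqP => i0; have := iu2; rewrite i0 mul0r => /eqP; rewrite eq_sym oppr_eq0 oner_eq0.
    by rewrite fmorph_eq0 gt_eqF.
  apply: (scalerI c0); rewrite -(linZ E_lin).
  have -> : (2%:C * iu * t%:C) *: (s * x * b + b * x * s) = u * x * u - v * x * v.
    by rewrite /u /v; nc.
  rewrite (linB E_lin).
  by rewrite eu // ev // /u /v; nc.
have -> : E (b * x + x * b) - (b * E x + E x * b) =
  E ((1 - s) * x * b + b * x * (1 - s)) - ((1 - s) * E x * b + b * E x * (1 - s)).
  have -> : (1 - s) * x * b + b * x * (1 - s) = (b * x + x * b) -
    (s * x * b + b * x * s) by nc.
  rewrite (linB E_lin).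
  by rewrite key; nc.
have bd z : nrm ((1 - s) * z * b + b * z * (1 - s)) <= 2 * t * nrm z.
  have := nrmD ((1 - s) * z * b) (b * z * (1 - s)).
  have z0 := nrm_ge0 z.
  have a1 := le_trans (nrmM (1 - s) z) (ler_wpM2r z0 sd).
  have a2 := le_trans (nrmM b z) (ler_wpM2r z0 b1); rewrite mul1r in a2.
  have a3 := le_trans (nrmM ((1 - s) * z) b) (ler_wpM2l (nrm_ge0 _) b1).
  have a4 := le_trans (nrmM (b * z) (1 - s)) (ler_pM (nrm_ge0 _) (nrm_ge0 _) a2 sd).
  rewrite mulr1 in a3; lra.
have := nrmB (E ((1 - s) * x * b + b * x * (1 - s))) ((1 - s) * E x * b + b * E x * (1 - s)).
have := E_nrm ((1 - s) * x * b + b * x * (1 - s)); have := bd x; have := bd (E x).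
have := E_nrm x; nra.
Qed.

Lemma E_jordan b x : B b -> E (b * x + x * b) = b * E x + E x * b.
Proof.
have sa_case a : B a -> star a = a -> E (a * x + x * a) = a * E x + E x * a.
  move=> Ba sa; pose T := nrm a + 1.
  have T0 : 0 < T by rewrite ltr_wpDl ?nrm_ge0.
  have Tn : T%:C != 0 :> R[i] by rewrite fmorph_eq0 gt_eqF.
  have -> : a = T%:C *: (T^-1%:C *: a) by nc; field.
  set c := T^-1%:C *: a.
  have := @E_jordan_sa c x (ucsZ _ Ba).
  rewrite {1}/c starZ sa => /(_ (erefl _)) h.
  have {}h : E (c * x + x * c) = c * E x + E x * c.
    apply: h; rewrite nrmZ ger0_norm; last by rewrite invr_ge0 ltW.
    by rewrite ler_pdivrMl // mulr1 /T lerDl.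
  have -> : T%:C *: c * x + x * (T%:C *: c) = T%:C *: (c * x + x * c) by nc.
  by rewrite (linZ E_lin) h; nc.
move=> Bb; have [a1 [a2 [s1 s2 eb hS]]] := cartesianE b.
have [B1' B2'] := hS B ucs_subalg Bb (ucs_star Bb).
rewrite eb.
have -> : (a1 + iu *: a2) * x + x * (a1 + iu *: a2) =
  (a1 * x + x * a1) + iu *: (a2 * x + x * a2) by nc.
by rewrite (linD E_lin) (linZ E_lin) !sa_case //; nc.
Qed.

Lemma E_jordan_ker b m : B b -> E m = 0 -> E (m * b) = - E (b * m).
Proof.
move=> Bb m0; apply/eqP; rewrite -addr_eq0 addrC -(linD E_lin) E_jordan // m0.
by rewrite mulr0 mul0r addr0.
Qed.

(** The Jordan identities for [x] with [y m] and for [y] with [m x] express [2 E (x y m)] by terms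
    symmetric in [x] and [y], so the commutator drops out. *)
Lemma E_comm_ker b c m : B b -> B c -> E m = 0 -> E ((b * c - c * b) * m) = 0.
Proof.
move=> Bb Bc m0.
have key x y : B x -> B y -> 2%:C *: E (x * y * m) =
    x * E (y * m) + E (y * m) * x + (y * E (x * m) + E (x * m) * y).
  move=> Bx By; have e1 := E_jordan (y * m) Bx; have e2 := E_jordan (m * x) By.
  rewrite (E_jordan_ker Bx m0) (linD E_lin) in e2; rewrite (linD E_lin) in e1.
  have e3 : E (m * x * y) = - E (x * y * m) by rewrite -mulrA E_jordan_ker //; apply: ucsM.
  rewrite mulrA in e1; rewrite e3 mulrA in e2.
  have -> : 2%:C *: E (x * y * m) = (E (x * y * m) + E (y * m * x)) -
    (E (y * m * x) + - E (x * y * m)) by nc.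
  by rewrite e1 e2; nc.
have n2 : 2%:C != 0 :> R[i] by rewrite fmorph_eq0 pnatr_eq0.
apply: (scalerI n2); rewrite scaler0 mulrBl (linB E_lin) scalerBr !key //; nc.
Qed.

Lemma E_comm_mul b c d m : B b -> B c -> B d -> E m = 0 ->
  E ((b * c - c * b) * d * m) = (b * c - c * b) * E (d * m).
Proof.
move=> Bb Bc Bd m0.
have m'0 : E (d * m - E (d * m)) = 0 by rewrite (linB E_lin) (E_id (E_B _)) subrr.
have := E_comm_ker Bb Bc m'0; rewrite mulrBr (linB E_lin) mulrA => /eqP.
rewrite subr_eq0 => /eqP ->; rewrite E_id //; apply: ucsM; last exact: E_B.
by apply: ucsB; apply: ucsM.
Qed.

Lemma E_comm_commute b c d m : B b -> B c -> B d -> E m = 0 ->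
  (b * c - c * b) * E (d * m) = E (d * m) * (b * c - c * b).
Proof.
move=> Bb Bc Bd m0; set k := b * c - c * b.
have Bk : B k by apply: ucsB; apply: ucsM.
have m'0 : E (m * d - E (m * d)) = 0 by rewrite (linB E_lin) (E_id (E_B _)) subrr.
have e1 : E (m * d * k) = E (m * d) * k.
  have := E_comm_ker Bb Bc m'0; rewrite -/k => e0.
  have := E_jordan_ker Bk m'0; rewrite e0 oppr0 mulrBl (linB E_lin) => /eqP.
  by rewrite subr_eq0 => /eqP ->; rewrite E_id //; apply: ucsM => //; exact: E_B.
have e2 : E (d * k * m) = E (d * m) * k.
  have := E_jordan_ker (ucsM Bd Bk) m0; rewrite mulrA e1 E_jordan_ker // mulNr => /eqP.
  by rewrite eqr_opp => /eqP <-.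
have := E_comm_ker Bd Bk m0; rewrite mulrBl (linB E_lin) e2 E_comm_mul // => /eqP.
by rewrite subr_eq0 => /eqP ->.
Qed.

(** The commutator [k] commutes with [E (d m)] and with [y E (d m)], so [k y - y k] annihilates
    [E (d m)]. Taking [x a] for [y] and splitting the commutator inserts the factor [a], which an
    ideal of annihilators requires. *)
Lemma E_comm_annihil b c x a d m : B b -> B c -> B x -> B a -> B d -> E m = 0 ->
  ((b * c - c * b) * x - x * (b * c - c * b)) * a * E (d * m) = 0.
Proof.
move=> Bb Bc Bx Ba Bd m0; set k := b * c - c * b.
have cc z : B z -> k * E (z * m) = E (z * m) * k by move=> Bz; exact: E_comm_commute.
have base y : B y -> (k * y - y * k) * E (d * m) = 0.
  move=> By; have m'0 : E (d * m - E (d * m)) = 0 by rewrite (linB E_lin) (E_id (E_B _)) subrr.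
  have : k * E (y * (d * m - E (d * m))) = E (y * (d * m - E (d * m))) * k.
    exact: E_comm_commute.
  move: k cc => k cc; rewrite mulrBr (linB E_lin).
  rewrite (E_id (ucsM By (E_B _))) mulrA mulrBr mulrBl.
  rewrite (cc _ (ucsM By Bd)) => /addrI/oppr_inj e.
  by rewrite mulrBl -mulrA e -!mulrA (cc _ Bd) subrr.
have -> : (k * x - x * k) * a * E (d * m) = (k * (x * a) - (x * a) * k) * E (d * m) -
  x * ((k * a - a * k) * E (d * m)) by nc.
by rewrite !base ?mulr0 ?subr0 //; apply: ucsM.
Qed.

(** Irreducibility makes central commutators scalar. If [b c - c b] is a nonzero scalar [k], then
    [b (c b) - (c b) b = k b] is scalar too, so [b] is scalar and commutes with [c] after all. *)
Lemma comm_scalar_comm : (forall b c x, B b -> B c -> B x ->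
  (b * c - c * b) * x = x * (b * c - c * b)) -> forall b c, B b -> B c -> b * c = c * b.
Proof.
move=> h b c Bb Bc; apply/eqP; rewrite -subr_eq0; apply/eqP.
have [k ek] : exists k, b * c - c * b = k%:A by apply: hirr => x Bx; exact: h.
have [l el] : exists l, b * (c * b) - c * b * b = l%:A.
  by apply: hirr => x Bx; apply: h => //; apply: ucsM.
have [k0|k0] := eqVneq k 0; first by rewrite ek k0 scale0r.
have e : k *: b = l%:A.
  by rewrite -el mulrA -mulrBl ek -scalerAl mul1r.
have -> : b = (k^-1 * l) *: 1 by rewrite -scalerA -e scalerA mulVf // scale1r.
nc.
Qed.

(** The [z] in [B] with [z a E (d m) = 0] for all [a] form a closed ideal of the simple algebra [B].
    If it is everything, take [z = 1]. If it is zero, double commutators vanish, [B] is commutative,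
    and by irreducibility [d] is a scalar. *)
Lemma E_ker d m : B d -> E m = 0 -> E (d * m) = 0.
Proof.
move=> Bd m0; pose y := E (d * m).
pose I z := B z /\ forall a, B a -> z * a * y = 0.
have [|Iz|IB] := hBs (I := I).
- split; last first.
    move=> u l Iu cu; split.
      by have [_ _ _ _ Bc] := ucs_subalg; apply: Bc cu => n; case: (Iu n).
    move=> a Ba; have := @closed_ker (fun z => z * a * y) (nrm a * nrm y) _ _ u l.
    apply=> // [z w|z|n]; first by nc.
      have := nrmM (z * a) y; have := nrmM z a; have := nrm_ge0 y; nra.
    by case: (Iu n) => _; apply.
  split=> [z []//||z w [Bz hz] [Bw hw]|c z [Bz hz]|s z Bs [Bz hz]].
  - by split=> [|a _]; [exact: ucs0|rewrite !mul0r].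
  - split; first exact: ucsD.
    by move=> a Ba; rewrite !mulrDl hz // hw // addr0.
  - by split; [exact: ucsZ|move=> a Ba; rewrite -!scalerAl hz // scaler0].
  - split; split; try exact: ucsM.
      by move=> a Ba; rewrite -!mulrA (mulrA z) hz // mulr0.
    by move=> a Ba; rewrite -(mulrA z) hz //; exact: ucsM.
- have comm := comm_scalar_comm.
  suff Bcomm b c : B b -> B c -> b * c = c * b.
    have [k ->] : exists k, d = k%:A by apply: hirr => b Bb; exact: Bcomm.
    by rewrite -scalerAl mul1r (linZ E_lin) m0 scaler0.
  apply: comm => {b c} b c x Bb Bc Bx; apply/eqP; rewrite -subr_eq0; apply/eqP.
  apply: Iz; split; first by apply: ucsB; apply: ucsM => //; apply: ucsB; apply: ucsM.
  by move=> a Ba; exact: E_comm_annihil.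
- by have [_ /(_ 1 ucs1)] := IB 1 ucs1; rewrite !mul1r.
Qed.

Lemma E_left b x : B b -> E (b * x) = b * E x.
Proof.
move=> Bb; have m0 : E (x - E x) = 0 by rewrite (linB E_lin) (E_id (E_B _)) subrr.
have := E_ker Bb m0; rewrite mulrBr (linB E_lin) => /eqP; rewrite subr_eq0 => /eqP ->.
by rewrite E_id //; apply: ucsM => //; exact: E_B.
Qed.

Lemma E_right b x : B b -> E (x * b) = E x * b.
Proof.
move=> Bb; have := E_left (star x) (ucs_star Bb); rewrite -starM !E_star -starM.
by move/(congr1 star); rewrite !starK.
Qed.

End Tomiyama.

(** * The trace on bimodule maps *)

(** For the bottom algebra these properties come from simplicity and irreducibility; for
    intermediate algebras, not known to be simple, they are proved by orthogonal projection. *)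
Record bimodule_exp (B : A -> Prop) (E : A -> A) : Prop := BimoduleExp {
  be_lin : lin E;
  be_mem : forall x, B (E x);
  be_id : forall b, B b -> E b = b;
  be_star : forall x, E (star x) = star (E x);
  be_left : forall b x, B b -> E (b * x) = b * E x;
  be_right : forall b x, B b -> E (x * b) = E x * b;
  be_pos : forall x, pos x -> pos (E x) }.

Definition scalar (x : A) := exists c : R[i], x = c%:A.

(* Junk value [0] when [x] is not a scalar. *)
Definition sc (x : A) : R[i] := xget 0 [set c | x = c%:A]%classic.

Lemma scalar_inj (c d : R[i]) : c%:A = d%:A :> A -> c = d.
Proof.
move/eqP; rewrite -subr_eq0 -scalerBl scaler_eq0 (negbTE one_neq0) orbF subr_eq0.
by move/eqP.
Qed.

Lemma scE x : scalar x -> x = (sc x)%:A.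
Proof. by move=> [c xc]; rewrite /sc; case: xgetP => [d _ ->//|/(_ c)]. Qed.

Lemma scA (c : R[i]) : sc c%:A = c.
Proof. by apply: scalar_inj; rewrite -scE //; exists c. Qed.

(** The induction hypothesis on an inclusion: it holds again with [B] replaced by an intermediate
    algebra that has an expectation compatible with [E], see [sub_datum]. *)
Record index_datum (B : A -> Prop) (E : A -> A) (n : nat) (lam : 'I_n -> A) (r : R) :
    Prop := IndexDatum {
  id_sub : unital_cstar_subalgebra nrm star B;
  id_irr : irreducible_inclusion B;
  id_exp : bimodule_exp B E;
  id_qb : quasi_basis star E lam;
  id_ind : \sum_(i < n) lam i * star (lam i) = r%:S }.

Section Datum.
Variables (B : A -> Prop) (E : A -> A) (n : nat) (lam : 'I_n -> A) (r : R).
Hypothesis hD : index_datum B E lam r.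

Let sB := id_sub hD.
Let lE := be_lin (id_exp hD).
Let EB := be_mem (id_exp hD).
Let Eid := be_id (id_exp hD).
Let Estar := be_star (id_exp hD).
Let El := be_left (id_exp hD).
Let Er := be_right (id_exp hD).
Let Epos := be_pos (id_exp hD).

Lemma qbl x : x = \sum_i E (x * lam i) * star (lam i).
Proof. by case: (id_qb hD x). Qed.

Lemma qbr x : x = \sum_i lam i * E (star (lam i) * x).
Proof. by case: (id_qb hD x). Qed.

Lemma E_scalar x : scalar x -> E x = x.
Proof. by move=> [c ->]; rewrite (linZ lE) (Eid (ucs1 sB)). Qed.

Lemma nondegl x y : (forall z, E (x * z) = E (y * z)) -> x = y.
Proof. by move=> h; rewrite (qbl x) (qbl y); apply: eq_bigr => i _; rewrite h. Qed.

Lemma nondegr x y : (forall z, E (z * x) = E (z * y)) -> x = y.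
Proof. by move=> h; rewrite (qbr x) (qbr y); apply: eq_bigr => i _; rewrite h. Qed.

Lemma E_schwarz x : pos (E (star x * x) - star (E x) * E x).
Proof.
have := Epos (starM_pos (x - E x)); congr pos.
have -> : star (x - E x) * (x - E x) =
  star x * x - star x * E x - star (E x) * x + star (E x) * E x.
  by rewrite starB; nc.
rewrite (linD lE) !(linB lE) (Er (star x) (EB x)) (El x (ucs_star sB (EB x))).
rewrite (Eid (ucsM sB (ucs_star sB (EB _)) (EB _))) Estar; nc.
Qed.

(** Expand [z] in the quasi-basis and apply the Cauchy-Schwarz inequality [sqr_sum_le]. Only the
    existence of a constant matters: it makes [E] faithful and bounds [nrm z ^ 2] by a multiple of
    [nrm (E (star z * z))]. *)
Lemma pimsner_popa : exists2 c : R, 0 < c &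
  forall z, pos (c%:C *: E (star z * z) - star z * z).
Proof.
pose L := \sum_i nrm (star (lam i) * lam i).
have L0 : 0 <= L by apply: sumr_ge0 => i _; exact: nrm_ge0.
pose N := (size (index_enum 'I_n))%:R : R.
have c0 : 0 < N * L + 1 by rewrite ltr_wpDl // mulr_ge0.
exists (N * L + 1) => // z.
pose e i := E (star (lam i) * z); pose a i := lam i * e i.
have ez : E (star z * z) = \sum_i star (e i) * e i.
  rewrite {2}(qbr z) mulr_sumr (lin_sum lE); apply: eq_bigr => i _.
  by rewrite mulrA Er // /e -Estar starM starK.
have pz : pos (E (star z * z)) by apply/Epos/starM_pos.
have h1 : pos (N%:C *: (\sum_i star (a i) * a i) - star z * z).
  have := sqr_sum_le [seq a i | i <- index_enum 'I_n].
  by rewrite size_map !big_map -(qbr z).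
have h2 : pos (L%:C *: E (star z * z) - \sum_i star (a i) * a i).
  rewrite ez scaler_sumr -sumrB; apply: pos_sum => i _.
  have -> : L%:C *: (star (e i) * e i) - star (a i) * a i =
    star (e i) * (L%:S - star (lam i) * lam i) * e i by rewrite /a starM; nc.
  apply: pos_conj; apply: pos_leB; first by rewrite starM starK.
  rewrite /L (bigD1 i) //= lerDl; apply: sumr_ge0 => j _; exact: nrm_ge0.
have N0 : 0 <= N by [].
have := posD (posD h1 (posZ N0 h2)) pz; congr pos; nc.
Qed.

Lemma E_faithful x : E (star x * x) = 0 -> x = 0.
Proof.
move=> e; apply: starM_eq0; have [c _ /(_ x)] := pimsner_popa.
by rewrite e scaler0 sub0r => p; apply: pos_antisym => //; exact: starM_pos.
Qed.

Lemma index_neq0 : r != 0.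
Proof.
apply/eqP => r0; have := id_ind hD; rewrite r0 scale0r => e.
have z i : lam i = 0.
  have /(_ i) := pos_sum_eq0 (fun i => mul_star_pos (lam i)) e.
  by rewrite -{1}(starK (lam i)) => /starM_eq0 h; rewrite -(starK (lam i)) h star0.
move/eqP: one_neq0; apply; rewrite (qbr 1) big1 // => i _; rewrite z mul0r //.
Qed.

(** * Bimodule maps, their partial traces and transposes *)

Definition bim (T : A -> A) :=
  [/\ lin T, (forall b x, B b -> T (b * x) = b * T x) &
      (forall b x, B b -> T (x * b) = T x * b)].

(* Identifying [T] with [\sum_i T (lam i) e_B lam i^*] in the basic construction
   [<A, e_B>], [trc T] is [Ind E] times the dual expectation of [T]. *)
Definition trc (T : A -> A) := \sum_i T (lam i) * star (lam i).
Definition trc' (T : A -> A) := \sum_i lam i * T (star (lam i)).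

Lemma bim_lin T : bim T -> lin T. Proof. by case. Qed.

Lemma bim_comp S T : bim S -> bim T -> bim (S \o T).
Proof.
move=> [lS Sl Sr] [lT Tl Tr]; split=> [c x y|b x Bb|b x Bb] /=.
- by rewrite lT lS.
- by rewrite Tl // Sl.
- by rewrite Tr // Sr.
Qed.

Lemma bim_id : bim id. Proof. by []. Qed.

Lemma bim_E : bim E. Proof. by []. Qed.

Lemma bim_comb (c : R[i]) S T : bim S -> bim T -> bim (fun x => c *: S x + T x).
Proof.
move=> [lS Sl Sr] [lT Tl Tr]; split=> [d x y|b x Bb|b x Bb].
- by rewrite lS lT; nc.
- by rewrite Sl // Tl //; nc.
- by rewrite Sr // Tr //; nc.
Qed.

Lemma bimB S T : bim S -> bim T -> bim (fun x => S x - T x).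
Proof.
move=> hS hT; have := bim_comb (-1) hT hS.
by congr bim; apply/funext => x; rewrite scaleN1r addrC.
Qed.

Lemma bim_expandr T x : bim T -> T x = \sum_i T (lam i) * E (star (lam i) * x).
Proof.
move=> [lT _ Tr]; rewrite {1}(qbr x) (lin_sum lT).
by apply: eq_bigr => i _; rewrite Tr.
Qed.

Lemma bim_expandl T x : bim T -> T x = \sum_i E (x * lam i) * T (star (lam i)).
Proof.
move=> [lT Tl _]; rewrite {1}(qbl x) (lin_sum lT).
by apply: eq_bigr => i _; rewrite Tl.
Qed.

(* [\sum_i lam i (x) lam i^*] is a central element of the bimodule [A (x)_B A]. *)
Lemma trc_central T x : bim T -> \sum_i T (x * lam i) * star (lam i) = trc T * x.
Proof.
move=> hT; rewrite /trc mulr_suml.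
under eq_bigr do rewrite (bim_expandr _ hT) mulr_suml.
rewrite exchange_big /=; apply: eq_bigr => j _.
rewrite -mulrA [in RHS](qbl (star (lam j) * x)) mulr_sumr.
by apply: eq_bigr => i _; rewrite !mulrA.
Qed.

Lemma trc'_central T x : bim T -> \sum_i lam i * T (star (lam i) * x) = x * trc' T.
Proof.
move=> hT; rewrite /trc' mulr_sumr.
under eq_bigr do rewrite (bim_expandl _ hT) mulr_sumr.
rewrite exchange_big /=; apply: eq_bigr => j _.
rewrite mulrA [in RHS](qbr (x * lam j)) mulr_suml.
by apply: eq_bigr => i _; rewrite !mulrA.
Qed.

Lemma trc_scalar T : bim T -> scalar (trc T).
Proof.
move=> hT; apply: (id_irr hD) => b Bb; rewrite -trc_central //.
have [_ Tl _] := hT; rewrite /trc mulr_sumr.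
by apply: eq_bigr => i _; rewrite Tl // mulrA.
Qed.

Lemma trc'_scalar T : bim T -> scalar (trc' T).
Proof.
move=> hT; apply: (id_irr hD) => b Bb; rewrite -trc'_central //.
have [_ _ Tr] := hT; rewrite /trc' mulr_suml.
by apply: eq_bigr => i _; rewrite Tr // mulrA.
Qed.

(* Both sides, multiplied by the index, are
   [\sum_i \sum_j lam i * T (lam i^* * lam j) * lam j^*]. *)
Lemma trc_trc' T : bim T -> trc T = trc' T.
Proof.
move=> hT; rewrite (scE (trc_scalar hT)) (scE (trc'_scalar hT)).
set c := sc _; set d := sc _; congr (_ *: _).
have e : \sum_i lam i * trc T * star (lam i) = \sum_i lam i * trc' T * star (lam i).
  under eq_bigr do rewrite -mulrA -trc_central // mulr_sumr.
  rewrite exchange_big /=; apply: eq_bigr => j _.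
  by rewrite -trc'_central // mulr_suml; apply: eq_bigr => i _; rewrite mulrA.
have s (z : R[i]) : \sum_i lam i * z%:A * star (lam i) = (z * r%:C)%:A.
  rewrite -scalerA -(id_ind hD) scaler_sumr.
  by apply: eq_bigr => i _; rewrite -scalerAr mulr1 scalerAl.
move: e; rewrite (scE (trc_scalar hT)) (scE (trc'_scalar hT)) !s => /scalar_inj.
by apply: mulIf; rewrite fmorph_eq0 index_neq0.
Qed.

(* [tw T] is the transpose of [T] for the pairing [E (x * y)]; [twi] is the
   inverse operation. *)
Definition tw (T : A -> A) z := \sum_i E (z * T (lam i)) * star (lam i).
Definition twi (T : A -> A) z := \sum_i lam i * E (T (star (lam i)) * z).

Lemma twE T z y : bim T -> E (z * T y) = E (tw T z * y).
Proof.
move=> hT; rewrite (bim_expandr _ hT) mulr_sumr /tw mulr_suml !(lin_sum lE).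
by apply: eq_bigr => i _; rewrite mulrA (Er _ (EB _)) -[in RHS]mulrA (El _ (EB _)).
Qed.

Lemma twiE T y z : bim T -> E (T y * z) = E (y * twi T z).
Proof.
move=> hT; rewrite (bim_expandl _ hT) mulr_suml /twi mulr_sumr !(lin_sum lE).
by apply: eq_bigr => i _; rewrite -mulrA (El _ (EB _)) mulrA (Er _ (EB _)).
Qed.

Lemma bim_tw T : bim T -> bim (tw T).
Proof.
move=> hT; have [lT Tl Tr] := hT; split=> [c x y|b x Bb|b x Bb]; apply: nondegl => z.
- by rewrite mulrDl -scalerAl lE -!twE // mulrDl -scalerAl lE.
- by rewrite -(mulrA b (tw T x)) (El _ Bb) -!twE // -mulrA (El _ Bb).
- by rewrite -mulrA -!twE // Tl // mulrA.
Qed.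

Lemma bim_twi T : bim T -> bim (twi T).
Proof.
move=> hT; have [lT Tl Tr] := hT; split=> [c x y|b x Bb|b x Bb]; apply: nondegr => z.
- by rewrite mulrDr -scalerAr lE -!twiE // mulrDr -scalerAr lE.
- by rewrite mulrA -!twiE // Tr // mulrA.
- by rewrite (mulrA z) (Er _ Bb) -!twiE // mulrA (Er _ Bb).
Qed.

Lemma twK T x : bim T -> twi (tw T) x = T x.
Proof. by move=> hT; apply: nondegr => z; rewrite -twiE -?twE //; exact: bim_tw. Qed.

Lemma twiK T x : bim T -> tw (twi T) x = T x.
Proof. by move=> hT; apply: nondegl => z; rewrite -twE -?twiE //; exact: bim_twi. Qed.

Lemma tw_ext S T : S =1 T -> tw S =1 tw T.
Proof. by move=> e z; apply: eq_bigr => i _; rewrite e. Qed.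

(** The common expression behind the traces of compositions: [trc] and [trc'] reduce to it, directly
    or under [E], with [tw] or [twi] applied to one argument. *)
Definition pairing (S V : A -> A) := \sum_i S (lam i) * V (star (lam i)).

Lemma trc_comp S T : bim S -> bim T -> trc (S \o T) = pairing S (tw T).
Proof.
move=> hS hT; rewrite /trc /pairing.
under eq_bigr do rewrite /= (bim_expandr (T _) hS) mulr_suml.
rewrite exchange_big /=; apply: eq_bigr => k _.
rewrite [in RHS](qbl (tw T _)) mulr_sumr; apply: eq_bigr => i _.
by rewrite twE // mulrA.
Qed.

Lemma trc'_comp S T : bim S -> bim T -> trc' (S \o T) = pairing (twi T) S.
Proof.
move=> hS hT; rewrite /trc' /pairing.
under eq_bigr do rewrite /= (bim_expandl (T _) hS) mulr_sumr.
rewrite exchange_big /=; apply: eq_bigr => k _.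
rewrite [in RHS](qbr (twi T _)) mulr_suml; apply: eq_bigr => i _.
by rewrite twiE // mulrA.
Qed.

Lemma E_trc_comp S T : bim S -> bim T -> trc (T \o S) = E (pairing S (twi T)).
Proof.
move=> hS hT; rewrite -(E_scalar (trc_scalar (bim_comp hT hS))) !(lin_sum lE).
by apply: eq_bigr => i _; rewrite /= twiE.
Qed.

Lemma E_trc'_comp S T : bim S -> bim T -> trc' (T \o S) = E (pairing (tw T) S).
Proof.
move=> hS hT; rewrite -(E_scalar (trc'_scalar (bim_comp hT hS))) !(lin_sum lE).
by apply: eq_bigr => i _; rewrite /= twE.
Qed.

(** The scalar [pairing S (tw T)] is [trc (S \o T)]; evaluated through [E], which fixes scalars, it
    is also the trace in the other order, with [tw (tw T)]. The companion [trc_kms'] does the same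
    with the left trace and [twi]. *)
Lemma trc_kms S T : bim S -> bim T -> trc (S \o T) = trc (tw (tw T) \o S).
Proof.
move=> hS hT; have h1 := bim_tw hT; have h2 := bim_tw h1.
rewrite (E_trc_comp hS h2) -(E_scalar (trc_scalar (bim_comp hS hT))) trc_comp //.
by congr E; apply: eq_bigr => i _; rewrite twK.
Qed.

Lemma trc_kms' S T : bim S -> bim T -> trc (S \o T) = trc (twi (twi T) \o S).
Proof.
move=> hS hT; have h1 := bim_twi hT; have h2 := bim_twi h1.
rewrite !trc_trc' ?(E_trc'_comp hS h2); try exact: bim_comp.
rewrite -(E_scalar (trc'_scalar (bim_comp hS hT))) trc'_comp //.
by congr E; apply: eq_bigr => i _; rewrite twiK.
Qed.

Definition adj (T : A -> A) y := star (tw T (star y)).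

Lemma adjE T x y : bim T -> E (star x * T y) = E (star (adj T x) * y).
Proof. by move=> hT; rewrite twE // /adj starK. Qed.

Lemma starZc (c : R[i]) x : star (c *: x) = c^*%R *: star x.
Proof. by have [_ [_ h _ _ _] _ _] := hA. Qed.

Lemma bim_adj T : bim T -> bim (adj T).
Proof.
move=> /bim_tw [l hl hr]; rewrite /adj; split=> [c x y|b x Bb|b x Bb].
- by rewrite starD starZc l starD starZc conjCK.
- by rewrite starM hr ?starM ?starK //; apply: (ucs_star sB).
- by rewrite starM hl ?starM ?starK //; apply: (ucs_star sB).
Qed.

Lemma adjK T x : bim T -> adj (adj T) x = T x.
Proof.
move=> hT; rewrite -[T x]starK; congr star; apply: nondegl => y.
rewrite -twE; last exact: bim_adj.
by have := congr1 star (adjE y x hT); rewrite -!Estar !starM !starK => <-.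
Qed.

Lemma trc_adj T : bim T -> trc (T \o adj T) = \sum_i T (lam i) * star (T (lam i)).
Proof.
move=> hT; rewrite trc_comp //; last exact: bim_adj.
by apply: eq_bigr => i _; congr (_ * _); rewrite -(adjK _ hT) /adj starK.
Qed.

Lemma trc_adj_pos T : bim T -> pos (trc (T \o adj T)).
Proof. by move=> hT; rewrite trc_adj //; apply: pos_sum => i _; exact: mul_star_pos. Qed.

Lemma trc_adj_eq0 T : bim T -> trc (T \o adj T) = 0 -> forall x, T x = 0.
Proof.
move=> hT; rewrite trc_adj // => e x.
rewrite (bim_expandr _ hT) big1 // => i _.
have /(_ i) := pos_sum_eq0 (fun i => mul_star_pos (T (lam i))) e.
rewrite -{1}(starK (T (lam i))) => /starM_eq0 h.
by rewrite -(starK (T (lam i))) h star0 mul0r.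
Qed.

Lemma trcB S T : trc (fun x => S x - T x) = trc S - trc T.
Proof. by rewrite /trc -sumrB; apply: eq_bigr => i _; rewrite mulrBl. Qed.

Lemma twB S T x : tw (fun x => S x - T x) x = tw S x - tw T x.
Proof. by rewrite /tw -sumrB; apply: eq_bigr => i _; rewrite mulrBr (linB lE) mulrBl. Qed.

(* [tw o tw] plays the role of the modular automorphism: comparing the two KMS
   relations shows that it has order two, and by positivity it is trivial. *)
Lemma tw_invol T x : bim T -> tw (tw T) x = T x.
Proof.
move=> hT; have t2 S : bim S -> bim (tw (tw S)) by move=> /bim_tw /bim_tw.
have i2 S : bim S -> bim (twi (twi S)) by move=> /bim_twi /bim_twi.
(* The two KMS relations give [trc (Z \o V) = 0] for the difference [Z] and every bimodule map [V];
   take for [V] the adjoint of [Z]. *)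
have e1 S y : bim S -> tw (tw S) y = twi (twi S) y.
  move=> hS; apply/eqP; rewrite -subr_eq0; apply/eqP.
  have hZ := bimB (t2 _ hS) (i2 _ hS).
  apply: (trc_adj_eq0 hZ).
  have hZa := bim_adj hZ.
  rewrite -[_ \o _]/(fun x => (tw (tw S) \o adj _) x - (twi (twi S) \o adj _) x).
  by rewrite trcB -trc_kms // -trc_kms' // subrr.
have e2 y : tw (tw (tw (tw T))) y = T y.
  rewrite (tw_ext (tw_ext (fun z => e1 T z hT))).
  by rewrite (tw_ext (fun z => twiK z (bim_twi hT))) twiK.
(* The double transpose maps [D] to [- D], so [trc (adj D \o D) = - trc (D \o adj D)], although both
   traces are positive. *)
pose D := fun y => T y - tw (tw T) y.
have hDD : bim D by apply: bimB => //; apply: t2.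
have e3 y : tw (tw D) y = - D y.
  rewrite (tw_ext (fun z => twB T (tw (tw T)) z)) twB e2 /D opprB //.
have hDa := bim_adj hDD.
have e4 : trc (adj D \o D) = - trc (D \o adj D).
  rewrite trc_kms // /trc -sumrN; apply: eq_bigr => i _ /=.
  by rewrite e3 mulNr.
have p : pos (- trc (D \o adj D)).
  rewrite -e4; have := trc_adj_pos hDa; congr pos; apply: eq_bigr => i _ /=.
  by congr (adj D _ * _); exact: adjK.
have z := pos_antisym (trc_adj_pos hDD) p.
by have /eqP := trc_adj_eq0 hDD z x; rewrite /D subr_eq0 => /eqP <-.
Qed.

Lemma trc_tracial S T : bim S -> bim T -> trc (S \o T) = trc (T \o S).
Proof.
by move=> hS hT; rewrite trc_kms //; apply: eq_bigr => i _; rewrite /= tw_invol.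
Qed.

Lemma twE' T y z : bim T -> E (T y * z) = E (y * tw T z).
Proof.
by move=> hT; rewrite -(tw_invol y hT) -twE //; exact: bim_tw.
Qed.

(** * The Euclidean space of self-adjoint bimodule maps *)

Definition sa (T : A -> A) := forall x y, E (star x * T y) = E (star (T x) * y).
Definition bsa T := bim T /\ sa T.

Lemma bsa_bim T : bsa T -> bim T. Proof. by case. Qed.

Lemma bsa_tw T z : bsa T -> tw T z = star (T (star z)).
Proof.
by move=> [hT sT]; apply: nondegl => y; rewrite -twE // -{1}(starK z) sT.
Qed.

Lemma bsa_id : bsa id. Proof. by split; [exact: bim_id|]. Qed.

Lemma bsa_E : bsa E.
Proof.
split; first exact: bim_E.
by move=> x y; rewrite (Er _ (EB _)) (El _ (ucs_star sB (EB _))) Estar.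
Qed.

Lemma bsa_comb (a : R) S T : bsa S -> bsa T -> bsa (fun x => a%:C *: S x + T x).
Proof.
move=> [bS sS] [bT sT]; split; first exact: bim_comb.
move=> x y; rewrite starD starZ mulrDr mulrDl -scalerAr -scalerAl !lE.
by rewrite sS sT.
Qed.

Lemma bsa_ext S T : S =1 T -> bsa S -> bsa T.
Proof. by move=> /funext ->. Qed.

Lemma bsaB S T : bsa S -> bsa T -> bsa (fun x => S x - T x).
Proof.
move=> hS hT; apply: bsa_ext (bsa_comb (-1) hT hS) => x; nc.
Qed.

Lemma bsa0 : bsa (fun=> 0).
Proof. by apply: bsa_ext (bsaB bsa_E bsa_E) => x; rewrite subrr. Qed.

Lemma bsaZ (a : R) T : bsa T -> bsa (fun x => a%:C *: T x).
Proof. by move=> hT; apply: bsa_ext (bsa_comb a hT bsa0) => x; rewrite addr0. Qed.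

Lemma bsaD S T : bsa S -> bsa T -> bsa (fun x => S x + T x).
Proof. by move=> hS hT; apply: bsa_ext (bsa_comb 1 hS hT) => x; rewrite scale1r. Qed.

Lemma bsa_sum (m : nat) (x : nat -> R) (T : nat -> A -> A) :
  (forall a, (a < m)%N -> bsa (T a)) -> bsa (fun y => \sum_(a < m) (x a)%:C *: T a y).
Proof.
elim: m => [|m IH] hT; first by apply: bsa_ext bsa0 => y; rewrite big_ord0.
apply: bsa_ext (bsa_comb (x m) (hT m (ltnSn m)) (IH _)) => [y|a am].
  by rewrite big_ord_recr /= addrC.
by apply: hT; exact: ltnW.
Qed.

Lemma bsa_transpose (c : R) S T : bsa S -> bsa T -> (forall x, S (T x) = c%:C *: T x) ->
  forall x, T (S x) = c%:C *: T x.
Proof.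
move=> [_ sS] [_ sT] h y; apply: nondegr => x; rewrite -(starK x) sT sS h.
by rewrite starZ -scalerAl -scalerAr !(linZ lE) sT.
Qed.

Lemma bsa_conj S T : bsa S -> bsa T -> bsa (fun x => S (T (S x))).
Proof.
move=> [bS sS] [bT sT]; split; first exact: (bim_comp bS (bim_comp bT bS)).
by move=> x y; rewrite sS sT sS.
Qed.

Lemma scalar_real x : scalar x -> star x = x -> x = (complex.Re (sc x))%:S.
Proof.
move=> hx; rewrite {1 2}(scE hx) starZc star1 => /scalar_inj /CrealP c.
by rewrite {1}(scE hx) RRe_real.
Qed.

(** On [bsa] maps this trace is a real scalar ([ipE]), so taking real parts loses nothing. *)
Definition ip (S T : A -> A) : R := complex.Re (sc (trc (S \o T))).
Definition rtr (T : A -> A) : R := complex.Re (sc (trc T)).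

Lemma trc_compE S T : bsa S -> bsa T ->
  trc (S \o T) = \sum_i S (lam i) * star (T (lam i)).
Proof.
move=> hS hT; rewrite trc_comp; [|exact: bsa_bim|exact: bsa_bim].
by apply: eq_bigr => i _; rewrite bsa_tw // starK.
Qed.

Lemma ipE S T : bsa S -> bsa T -> trc (S \o T) = (ip S T)%:S.
Proof.
move=> hS hT; have bS := bsa_bim hS; have bT := bsa_bim hT.
apply: scalar_real; first exact: trc_scalar (bim_comp bS bT).
rewrite {2}trc_tracial // !trc_compE // star_sum.
by apply: eq_bigr => i _; rewrite starM starK.
Qed.

Lemma rtrE T : bsa T -> trc T = (rtr T)%:S.
Proof. by move=> hT; have := ipE bsa_id hT. Qed.

Lemma realS_inj (a b : R) : a%:S = b%:S :> A -> a = b.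
Proof. by move/scalar_inj/complexI. Qed.

Lemma ip_sym S T : bsa S -> bsa T -> ip S T = ip T S.
Proof.
move=> hS hT; apply: realS_inj; rewrite -!ipE // trc_tracial //; exact: bsa_bim.
Qed.

Lemma ip_comb (a : R) S S' T : bsa S -> bsa S' -> bsa T ->
  ip (fun x => a%:C *: S x + S' x) T = a * ip S T + ip S' T.
Proof.
move=> hS hS' hT; apply: realS_inj; rewrite -ipE //; last exact: bsa_comb.
have -> : (a * ip S T + ip S' T)%:S = a%:C *: (ip S T)%:S + (ip S' T)%:S :> A by nc.
rewrite -!ipE // /trc scaler_sumr -big_split; apply: eq_bigr => i _ /=.
by rewrite mulrDl -scalerAl.
Qed.

Lemma ip0l T : bsa T -> ip (fun=> 0) T = 0.
Proof.
move=> hT; apply: realS_inj; rewrite -ipE //; last exact: bsa0.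
by rewrite /trc big1 ?scale0r // => i _; rewrite mul0r.
Qed.

Lemma ip_suml (m : nat) (x : nat -> R) (T : nat -> A -> A) S :
  (forall a, (a < m)%N -> bsa (T a)) -> bsa S ->
  ip (fun y => \sum_(a < m) (x a)%:C *: T a y) S = \sum_(a < m) x a * ip (T a) S.
Proof.
move=> hT hS; elim: m hT => [|m IH] hT.
  rewrite big_ord0 -(ip0l hS); congr (ip _ S); apply/funext => y.
  by rewrite big_ord0.
have hT' a : (a < m)%N -> bsa (T a) by move=> am; apply: hT; exact: ltnW.
rewrite big_ord_recr /= -(IH hT') addrC -ip_comb //; [|exact: hT|exact: bsa_sum].
by congr (ip _ S); apply/funext => y; rewrite big_ord_recr /= addrC.
Qed.

Lemma ipDl S S' T : bsa S -> bsa S' -> bsa T ->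
  ip (fun x => S x + S' x) T = ip S T + ip S' T.
Proof.
move=> hS hS' hT; rewrite -(mul1r (ip S T)) -ip_comb //.
by congr (ip _ T); apply/funext => x; rewrite scale1r.
Qed.

Lemma ipBl S S' T : bsa S -> bsa S' -> bsa T ->
  ip (fun x => S x - S' x) T = ip S T - ip S' T.
Proof.
move=> hS hS' hT; rewrite addrC -(mulN1r (ip S' T)) -ip_comb //.
by congr (ip _ T); apply/funext => x; rewrite addrC rmorphN1 scaleN1r.
Qed.

Lemma ipZl (a : R) S T : bsa S -> bsa T -> ip (fun x => a%:C *: S x) T = a * ip S T.
Proof.
move=> hS hT; rewrite -[RHS]addr0 -(ip0l hT) -ip_comb //; last exact: bsa0.
by congr (ip _ T); apply/funext => x; rewrite addr0.
Qed.

Lemma ip_ge0 T : bsa T -> 0 <= ip T T.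
Proof.
move=> hT; apply: pos_S; rewrite -ipE // trc_compE //.
by apply: pos_sum => i _; exact: mul_star_pos.
Qed.

Lemma ip_eq0 T : bsa T -> ip T T = 0 -> forall x, T x = 0.
Proof.
move=> hT e; have bT := bsa_bim hT; apply: trc_adj_eq0 => //.
by rewrite trc_adj // -trc_compE // ipE // e scale0r.
Qed.

Lemma rtr_comp S T U : (forall x, U x = S (T x)) -> rtr U = ip S T.
Proof. by move=> h; rewrite /rtr /ip; congr (complex.Re (sc (trc _))); apply/funext. Qed.

Lemma rtr_idem f : (forall x, f (f x) = f x) -> rtr f = ip f f.
Proof. by move=> h; apply: rtr_comp => x; rewrite h. Qed.

Lemma rtrB S T : bsa S -> bsa T -> rtr (fun x => S x - T x) = rtr S - rtr T.
Proof. by move=> hS hT; have := ipBl hS hT bsa_id. Qed.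

Lemma rtrD S T : bsa S -> bsa T -> rtr (fun x => S x + T x) = rtr S + rtr T.
Proof. by move=> hS hT; have := ipDl hS hT bsa_id. Qed.

Lemma rtrZ (a : R) S : bsa S -> rtr (fun x => a%:C *: S x) = a * rtr S.
Proof. by move=> hS; have := ipZl a hS bsa_id. Qed.

Lemma rtr_id : rtr id = r.
Proof. by apply: realS_inj; rewrite -(rtrE bsa_id) -(id_ind hD). Qed.

Lemma rtr_E : rtr E = 1.
Proof.
apply: realS_inj; rewrite -(rtrE bsa_E) scale1r [RHS]qbl.
by apply: eq_bigr => i _; rewrite mul1r.
Qed.

(** With [z = f y] and [g i = star (f (lam i)) * z], the sum of [star (E (g i)) * E (g i)] is
    [E (star z * z)], and the sum of [E (star (g i) * g i)] is [rtr f] times it; the Schwarz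
    inequality compares the two. Relative indices of at least 2 originate here. *)
Lemma rtr_proj_ge1 f y : bsa f -> (forall x, f (f x) = f x) -> f y != 0 -> 1 <= rtr f.
Proof.
move=> hf ff fy0; set z := f y in fy0; have [bf sf] := hf.
have fz : f z = z by rewrite /z ff.
pose g i := star (f (lam i)) * z.
have e1 : E (star z * z) = \sum_i star (E (g i)) * E (g i).
  rewrite -{2}fz -{2}fz (bim_expandr _ bf) mulr_sumr (lin_sum lE).
  apply: eq_bigr => i _; rewrite mulrA (Er _ (EB _)) (sf (lam i)).
  by rewrite /g -Estar starM starK.
have e2 : (rtr f)%:C *: E (star z * z) = \sum_i E (star (g i) * g i).
  rewrite -(linZ lE) -(lin_sum lE); congr E.
  have -> : (rtr f)%:C *: (star z * z) = star z * (rtr f)%:S * z by nc.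
  rewrite rtr_idem // -ipE // trc_compE // mulr_sumr mulr_suml.
  by apply: eq_bigr => i _; rewrite /g starM starK !mulrA.
have p : pos ((rtr f)%:C *: E (star z * z) - E (star z * z)).
  by rewrite e2 {1}e1 -sumrB; apply: pos_sum => i _; exact: E_schwarz.
have pz : pos (E (star z * z)) by apply/Epos/starM_pos.
rewrite leNgt; apply/negP => lt1; case/eqP: fy0; apply: E_faithful.
apply: pos_antisym => //; apply: (@posZE (1 - rtr f)); first by rewrite subr_gt0.
by have -> : (1 - rtr f)%:C *: (- E (star z * z)) =
  (rtr f)%:C *: E (star z * z) - E (star z * z) by nc.
Qed.

(** * Bessel's inequality and orthonormal coordinates *)

Lemma bessel (m : nat) (T : nat -> A -> A) x :
  (forall a, (a < m)%N -> bsa (T a)) ->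
  (forall a b, (a < m)%N -> (b < m)%N -> ip (T a) (T b) = (a == b)%:R) ->
  pos (E (star x * x) - \sum_(a < m) star (T a x) * T a x).
Proof.
move=> hT oT.
have hTo (a : 'I_m) : bsa (T a) by exact: hT.
(* The rows [T a (lam i)], indexed by [i], are orthonormal in [A^n] with scalar Gram matrix ([e4]),
   and [v] is the remainder of the row [E (star x * lam i)] after projection onto their span. *)
pose v i := E (star x * lam i) - \sum_(a < m) star (T a x) * T a (lam i).
suff -> : E (star x * x) - \sum_(a < m) star (T a x) * T a x = \sum_i v i * star (v i).
  by apply: pos_sum => i _; exact: mul_star_pos.
have e1 : \sum_i E (star x * lam i) * E (star (lam i) * x) = E (star x * x).
  rewrite [in RHS](qbr x) [in RHS]mulr_sumr (lin_sum lE) -[in RHS](qbr x).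
  by apply: eq_bigr => i _; rewrite mulrA (Er _ (EB _)).
have e2 (a : 'I_m) : \sum_i T a (lam i) * E (star (lam i) * x) = T a x.
  by rewrite -bim_expandr //; exact: bsa_bim.
have e3 (a : 'I_m) : \sum_i E (star x * lam i) * star (T a (lam i)) = star (T a x).
  rewrite -e2 star_sum; apply: eq_bigr => i _.
  by rewrite starM -Estar starM starK.
have e4 (a b : 'I_m) : \sum_i T a (lam i) * star (T b (lam i)) = (a == b)%:R.
  by rewrite -trc_compE // ipE // oT // rmorph_nat scaler_nat.
have ve i : v i * star (v i) =
   E (star x * lam i) * E (star (lam i) * x)
   - \sum_(a < m) (E (star x * lam i) * star (T a (lam i))) * T a x
   - \sum_(a < m) star (T a x) * (T a (lam i) * E (star (lam i) * x))
   + \sum_(a < m) \sum_(b < m) star (T a x) * (T a (lam i) * star (T b (lam i))) * T b x.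
  have s1 : star (v i) = E (star (lam i) * x) -
      \sum_(a < m) star (T a (lam i)) * T a x.
    rewrite starB -Estar starM starK star_sum; congr (_ - _).
    by apply: eq_bigr => a _; rewrite starM starK.
  rewrite s1 /v mulrBl !mulrBr opprB !mulr_sumr mulr_suml.
  have -> : \sum_(a < m) (\sum_(a < m) star (T a x) * T a (lam i)) *
        (star (T a (lam i)) * T a x) =
      \sum_(a < m) \sum_(b < m) star (T a x) * (T a (lam i) * star (T b (lam i))) * T b x.
    rewrite exchange_big /=; apply: eq_bigr => b _.
    by rewrite mulr_suml; apply: eq_bigr => a _; rewrite !mulrA.
  under [X in _ - X - _ + _]eq_bigr do rewrite -mulrA.
  under [X in _ - _ - X + _]eq_bigr do rewrite mulrA.
  set s2 := \sum_(a < m) _ * _; set s3 := \sum_(a < m) _ * _; set s4 := \sum_(a < m) _.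
  nc.
rewrite (eq_bigr _ (fun i _ => ve i)) big_split /= !sumrB e1.
rewrite [\sum_i \sum_(a < m) _ * T a x]exchange_big.
rewrite [\sum_i \sum_(a < m) star _ * _]exchange_big.
rewrite [\sum_i \sum_(a < m) \sum_(b < m) _]exchange_big /=.
have f1 : \sum_(a < m) \sum_i E (star x * lam i) * star (T a (lam i)) * T a x =
  \sum_(a < m) star (T a x) * T a x.
  by apply: eq_bigr => a _; rewrite -mulr_suml e3.
have f2 : \sum_(a < m) \sum_i star (T a x) * (T a (lam i) * E (star (lam i) * x)) =
  \sum_(a < m) star (T a x) * T a x.
  by apply: eq_bigr => a _; rewrite -mulr_sumr e2.
have f3 : \sum_(a < m) \sum_i \sum_(b < m)
    star (T a x) * (T a (lam i) * star (T b (lam i))) * T b x =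
  \sum_(a < m) star (T a x) * T a x.
  apply: eq_bigr => a _; rewrite exchange_big /=.
  under eq_bigr do rewrite -mulr_suml -mulr_sumr e4.
  rewrite (bigD1 a) //= eqxx mulr1 big1 ?addr0 // => b ba.
  by rewrite eq_sym (negbTE ba) mulr0 mul0r.
rewrite f1 f2 f3; set s := \sum_(a < m) _; nc.
Qed.

(** Sum Bessel's inequality over [x = star (lam k)] and apply [E]: the first term gives the index,
    and each [T a] gives the left trace of [T a \o T a], which equals the right one, namely 1. *)
Lemma bessel_dim (m : nat) (T : nat -> A -> A) :
  (forall a, (a < m)%N -> bsa (T a)) ->
  (forall a b, (a < m)%N -> (b < m)%N -> ip (T a) (T b) = (a == b)%:R) -> m%:R <= r.
Proof.
move=> hT oT; rewrite -subr_ge0; apply: pos_S.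
have p : pos (\sum_k (E (star (star (lam k)) * star (lam k)) -
    \sum_(a < m) star (T a (star (lam k))) * T a (star (lam k)))).
  by apply: pos_sum => k _; exact: bessel.
have := Epos p; congr pos; rewrite sumrB (linB lE) rmorphB scalerBl.
under eq_bigr do rewrite starK.
rewrite -!(lin_sum lE) (id_ind hD) (linZ lE) (linZ lE) !(Eid (ucs1 sB)); congr (_ - _).
rewrite exchange_big /= (lin_sum lE).
have -> : (m%:R%:C *: 1 : A) = \sum_(a < m) 1.
  by rewrite sumr_const card_ord -scaler_nat rmorph_nat.
apply: eq_bigr => a _; have ha := hT a (ltn_ord a); have ba := bsa_bim ha.
have := oT a a (ltn_ord a) (ltn_ord a); rewrite eqxx => o1.
have <- : trc (T a \o T a) = 1 by rewrite ipE // o1 scale1r.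
rewrite trc_trc'; last exact: bim_comp.
rewrite (E_trc'_comp ba ba); congr E; apply: eq_bigr => i _.
by rewrite bsa_tw.
Qed.

(** No dimension is known beforehand: the orthonormal family grows with [k], and [bessel_dim] bounds
    it at every step. A remainder [w] of norm zero means that [u k] adds no new direction. *)
Lemma gram_schmidt (k : nat) (u : nat -> A -> A) : (forall i, (i < k)%N -> bsa (u i)) ->
  exists m (T : nat -> A -> A) (x : nat -> nat -> R), [/\ m%:R <= r,
    (forall a, (a < m)%N -> bsa (T a)),
    (forall a b, (a < m)%N -> (b < m)%N -> ip (T a) (T b) = (a == b)%:R) &
    forall i, (i < k)%N -> forall y, u i y = \sum_(a < m) (x i a)%:C *: T a y].
Proof.
elim: k => [|k IH] hu.
  exists 0%N, (fun _ _ => 0), (fun _ _ => 0); split=> //.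
  by apply: (@bessel_dim 0 (fun _ _ => 0)).
have [|m [T [x [mr hT oT uE]]]] := IH.
  by move=> i ik; apply: hu; exact: ltnW.
have huk := hu k (ltnSn k).
pose w y := u k y - \sum_(a < m) (ip (u k) (T a))%:C *: T a y.
have hs := bsa_sum (fun a => ip (u k) (T a)) hT.
have hw : bsa w by exact: bsaB.
have wT b : (b < m)%N -> ip w (T b) = 0.
  move=> bm; have hb := hT b bm; rewrite ipBl //.
  rewrite (ip_suml (fun a => ip (u k) (T a)) hT hb) (bigD1 (Ordinal bm)) //=.
  rewrite oT // eqxx mulr1 big1 ?addr0 ?subrr // => a ab.
  by move: ab; rewrite -val_eqE /= => /negbTE ab; rewrite oT // ab mulr0.
have [w0|w0] := eqVneq (ip w w) 0.
  exists m, T, (fun i a => if i == k then ip (u k) (T a) else x i a); split=> //.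
  move=> i; rewrite ltnS leq_eqVlt => /predU1P[->|ik] y.
    by have /eqP := ip_eq0 hw w0 y; rewrite subr_eq0 eqxx => /eqP.
  by rewrite ltn_eqF // uE.
have wp : 0 < ip w w by rewrite lt0r w0 ip_ge0.
pose s := Num.sqrt (ip w w).
have s0 : 0 < s by rewrite sqrtr_gt0.
have ss : s * s = ip w w by rewrite -expr2 sqr_sqrtr // ltW.
pose t y := s^-1%:C *: w y.
have ht : bsa t by exact: bsaZ.
have tT b : (b < m)%N -> ip t (T b) = 0.
  by move=> bm; rewrite ipZl ?wT ?mulr0 //; exact: hT.
have tt : ip t t = 1.
  by rewrite ipZl // ip_sym // ipZl // -ss mulKf ?mulVf ?gt_eqF.
pose T' a := if a == m then t else T a.
have hT' a : (a < m.+1)%N -> bsa (T' a).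
  rewrite ltnS leq_eqVlt /T' => /predU1P[->|am]; first by rewrite eqxx.
  by rewrite ltn_eqF //; exact: hT.
have oT' a b : (a < m.+1)%N -> (b < m.+1)%N -> ip (T' a) (T' b) = (a == b)%:R.
  rewrite /T' ltnS leq_eqVlt => /predU1P[->|am]; rewrite ltnS leq_eqVlt => /predU1P[->|bm].
  - by rewrite eqxx.
  - by rewrite eqxx (ltn_eqF bm) tT // gtn_eqF.
  - by rewrite eqxx (ltn_eqF am) ip_sym ?tT //; exact: hT.
  - by rewrite (ltn_eqF am) (ltn_eqF bm) oT.
exists m.+1, T', (fun i a => if i == k then (if a == m then s else ip (u k) (T a))
   else (if a == m then 0 else x i a)); split=> //; first exact: bessel_dim oT'.
move=> i; rewrite ltnS leq_eqVlt => ik y; rewrite big_ord_recr /= eqxx /T' eqxx.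
case/predU1P: ik => [->|ik]; rewrite ?eqxx.
  have -> : s%:C *: t y = w y.
    by rewrite /t scalerA -rmorphM mulfV ?gt_eqF // scale1r.
  rewrite /w (eq_bigr (fun a : 'I_m => (ip (u k) (T a))%:C *: T a y)) ?subrKC //.
  by move=> a _; rewrite ltn_eqF.
rewrite ltn_eqF // scale0r addr0 uE //; apply: eq_bigr => a _.
by rewrite ltn_eqF.
Qed.

(** * The angle between intermediate subalgebras *)

Lemma bsa_lin_dep (k : nat) (u : nat -> A -> A) : (forall i, bsa (u i)) -> r < k%:R ->
  exists a : nat -> R, (exists2 j, (j < k)%N & a j != 0) /\
    forall y, \sum_(i < k) (a i)%:C *: u i y = 0.
Proof.
move=> hu rk; have [m [T [x [mr hT _ uE]]]] := gram_schmidt (fun i (_ : (i < k)%N) => hu i).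
pose M : 'M[R]_(k, m) := \matrix_(i, a) x i a.
have mk : (m < k)%N by rewrite -(ltr_nat R) (le_lt_trans mr).
have /rowV0Pn[v /sub_kermxP vM v0] : kermx M != 0.
  by rewrite -mxrank_eq0 mxrank_ker -lt0n subn_gt0 (leq_ltn_trans (rank_leq_col M)).
pose a (i : nat) := if insub i is Some i' then v 0 i' else 0.
have aE (i : 'I_k) : a i = v 0 i by rewrite /a valK.
exists a; split.
  have /rV0Pn[j vj] := v0; exists j; rewrite // aE //.
move=> y; under eq_bigr do rewrite uE // scaler_sumr.
rewrite exchange_big /= big1 // => b _.
under eq_bigr do rewrite scalerA -rmorphM.
rewrite -scaler_suml -rmorph_sum /=.
have /matrixP/(_ 0 b) := vM; rewrite !mxE => vb.
rewrite (eq_bigr (fun i : 'I_k => v 0 i * M i b)) ?vb ?scale0r //.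
by move=> i _; rewrite aE mxE.
Qed.

Record sub_exp (D : A -> Prop) (F : A -> A) : Prop := SubExp {
  se_exp : bimodule_exp D F;
  se_sub : forall x, B x -> D x;
  se_E : forall x, E (F x) = E x }.

Lemma se_idem D F x : sub_exp D F -> F (F x) = F x.
Proof. by case=> h _ _; rewrite (be_id h) //; exact: be_mem h _. Qed.

Lemma se_FE D F x : sub_exp D F -> F (E x) = E x.
Proof. by case=> h s _; rewrite (be_id h) //; exact: s. Qed.

Lemma se_swap D F x y : sub_exp D F -> E (F x * y) = E (x * F y).
Proof.
move=> h; have [hF _ FE] := h.
by rewrite -FE (be_left hF _ (be_mem hF x)) -(be_right hF x (be_mem hF y)) FE.
Qed.

Lemma se_bsa D F : sub_exp D F -> bsa F.
Proof.
move=> h; have [hF s FE] := h; split.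
  split; [exact: be_lin hF| |]; move=> b x /s Db.
    by rewrite (be_left hF).
  by rewrite (be_right hF).
by move=> x y; rewrite -(be_star hF) (se_swap _ _ h).
Qed.

Section Angle.
Variables (D D' : A -> Prop) (F F' : A -> A).
Hypotheses (hF : sub_exp D F) (hF' : sub_exp D' F').
Hypothesis hI : forall x, D x -> D' x -> B x.

Let bF := se_bsa hF.
Let bF' := se_bsa hF'.
Let lF := bim_lin (bsa_bim bF).
Let lF' := bim_lin (bsa_bim bF').
Let v' x := F' x - E x.
(** The compression of [1 - F] to the range of [v'], the part of [D'] orthogonal to [B]. It is
    injective there: [H x = 0] forces [x] into [D] as well as [D'], hence into [B]. *)
Let H x := v' x - v' (F (v' x)).

Let bv' : bsa v' := bsaB bF' bsa_E.
Let bH : bsa H := bsaB bv' (bsa_conj bv' bF).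
Let lv' := bim_lin (bsa_bim bv').
Let lH := bim_lin (bsa_bim bH).

Let v'v' x : v' (v' x) = v' x.
Proof.
rewrite /v' (linB lF') (se_idem _ hF') (se_FE _ hF') (linB lE) (se_E hF').
by rewrite (Eid (EB _)) subrr subr0.
Qed.

Let v'H x : v' (H x) = H x.
Proof. by rewrite /H (linB lv') !v'v'. Qed.

Let Hv' x : H (v' x) = H x.
Proof. by rewrite /H !v'v'. Qed.

Let H_inj x : v' x = x -> H x = 0 -> x = 0.
Proof.
move=> vx Hx; have [_ sv] := bv'; have [_ sF] := bF.
have Fx : x - F x = 0.
  apply: E_faithful; rewrite starB mulrBl (linB lE) -sF (linB lF) (se_idem _ hF) subrr.
  rewrite mulr0 (lin0 lE) subr0; have : E (star x * H x) = 0 by rewrite Hx mulr0 (lin0 lE).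
  by rewrite /H mulrBr (linB lE) [in X in _ - X]sv !vx mulrBr (linB lE).
have Dx : D x.
  by move/eqP: Fx; rewrite subr_eq0 => /eqP ->; exact: be_mem (se_exp hF) _.
have Dx' : D' x.
  have <- : F' (x - E x) = x by rewrite (linB lF') (se_FE _ hF').
  exact: be_mem (se_exp hF') _.
have Bx := hI Dx Dx'.
by rewrite -vx /v' (Eid Bx) (be_id (se_exp hF')) ?subrr.
Qed.

Let u j := iter j (fun T x => H (T x)) v'.

Let uP j : [/\ bsa (u j), (forall x, u j (H x) = H (u j x)) & forall x, v' (u j x) = u j x].
Proof.
elim: j => [|j [[bU sU] uH vU]].
  by split=> // x; rewrite /u /= ?v'H ?Hv'.
have [bh sh] := bH; split.
- split; first exact: (bim_comp bh bU).
  by move=> x y; rewrite /u /= -/(u j) sh sU uH.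
- by move=> x; rewrite /u /= -/(u j) uH.
- by move=> x; rewrite /u /= v'H.
Qed.

(** Finite dimension makes the maps [u j], the powers of [H] times [v'], linearly dependent. A
    vanishing lowest coefficient is divided out by injectivity of [H]; a nonzero one lets the
    relation be solved for [v'], so the inverse is a polynomial in [H]. *)
Let corner_inverse : exists Z, [/\ bsa Z, (forall x, v' (Z x) = Z x) &
  forall x, H (Z x) = v' x].
Proof.
have [k rk] : exists k, r < k%:R.
  exists (Num.bound `|r|).
  exact: le_lt_trans (ler_norm r) (archi_boundP (normr_ge0 r)).
have [a [[j jk aj] e]] := bsa_lin_dep (fun j => let: And3 h _ _ := uP j in h) rk.
elim: k a j jk aj e {rk} => // k IH a j jk aj e.
pose w b y := \sum_(i < k) (b i.+1)%:C *: u i y : A.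
have e' y : (a 0%N)%:C *: v' y + H (w a y) = 0.
  rewrite -(e y) big_ord_recl /=; congr (_ + _); rewrite (lin_sum lH).
  by apply: eq_bigr => i _; rewrite (linZ lH).
have vw b y : v' (w b y) = w b y.
  rewrite (lin_sum lv'); apply: eq_bigr => i _; rewrite (linZ lv').
  by have [_ _ ->] := uP i.
have [a0|a0] := eqVneq (a 0%N) 0.
  case: j jk aj => [|j] jk aj; first by rewrite a0 eqxx in aj.
  apply: (IH (fun i => a i.+1) j) => // y; apply: H_inj; first exact: vw.
  by have := e' y; rewrite a0 scale0r add0r.
pose b i := - a i / a 0%N.
exists (w b); split=> //.
  by apply: (bsa_sum (fun i => b i.+1)) => i _; have [] := uP i.
move=> x; have -> : w b x = (- (a 0%N)^-1)%:C *: w a x.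
  rewrite scaler_sumr; apply: eq_bigr => i _; rewrite scalerA -rmorphM /b.
  by rewrite mulNr mulrC mulNr.
rewrite (linZ lH); have /eqP := e' x; rewrite addrC addr_eq0 => /eqP ->.
rewrite scalerN -scaleNr scalerA -rmorphN -rmorphM opprK mulVf // scale1r //.
Qed.

Let p := rtr F.
Let q := rtr F'.
Let c := ip F F'.

(* [K] is a multiple of the orthogonal projection onto the span of [D D']: the
   [F (lam i)] form a quasi-basis of [D], so [K] is [D]-linear on the left. *)
Let K y := \sum_i F (lam i) * F' (F (star (lam i)) * y).

Let K_left x y : D x -> K (x * y) = x * K y.
Proof.
move=> Dx; have [hf sf _] := hF; have [hf' sf' _] := hF'; have [bF2 _] := bF.
rewrite /K mulr_sumr.
have e i : F' (F (star (lam i)) * (x * y)) =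
    \sum_j E (star (lam i) * x * lam j) * F' (F (star (lam j)) * y).
  rewrite mulrA -(be_right hf _ Dx) (bim_expandl _ bF2) mulr_suml (lin_sum lF').
  by apply: eq_bigr => j _; rewrite -mulrA (be_left hf' _ (sf' _ (EB _))).
under eq_bigr do rewrite e mulr_sumr.
rewrite exchange_big /=; apply: eq_bigr => j _.
rewrite [RHS]mulrA -(be_left hf (lam j) Dx) (bim_expandr (x * lam j) bF2) [RHS]mulr_suml.
by apply: eq_bigr => i _; rewrite !mulrA.
Qed.

Let K_right y z : D' z -> K (y * z) = K y * z.
Proof.
move=> Dz; have [hf' _ _] := hF'; rewrite /K mulr_suml; apply: eq_bigr => i _.
by rewrite mulrA (be_right hf' _ Dz) mulrA.
Qed.

Let bimK : bim K.
Proof.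
split=> [d x y|b x Bb|b x Bb].
- rewrite /K scaler_sumr -big_split; apply: eq_bigr => i _ /=.
  by rewrite mulrDr -scalerAr lF' mulrDr -scalerAr.
- by apply: K_left; exact: (se_sub hF).
- by apply: K_right; exact: (se_sub hF').
Qed.

Let bK : bsa K.
Proof.
split=> // x y; have [hf _ _] := hF; have [hf' _ _] := hF'.
rewrite /K mulr_sumr star_sum mulr_suml !(lin_sum lE); apply: eq_bigr => i _.
rewrite mulrA -(se_swap _ _ hF') !starM -(be_star hf') starM -(be_star hf).
by rewrite (be_star hf) starK !mulrA.
Qed.

(** Irreducibility makes [K 1] a scalar, and applying [E] identifies it with the left trace of
    [F \o (F' \o F)], which is [c]. *)
Let K1 : K 1 = c%:S.
Proof.
have [hf _ _] := hF; have [b1 _] := bF; have [b2 _] := bF'.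
have s1 : scalar (K 1).
  apply: (id_irr hD) => b Bb; have [_ l1 r1] := bimK.
  by rewrite -r1 // -l1 // mul1r mulr1.
rewrite -(E_scalar s1) /K (lin_sum lE).
transitivity (E (trc' (F \o (F' \o F)))).
  rewrite (lin_sum lE); apply: eq_bigr => i _.
  by rewrite mulr1 (se_swap _ _ hF).
have bc := bim_comp b1 (bim_comp b2 b1).
rewrite -trc_trc' // (E_scalar (trc_scalar bc)) (trc_tracial b1 (bim_comp b2 b1)).
rewrite /c -(ipE bF bF') (trc_tracial b1 b2).
by apply: eq_bigr => i _ /=; rewrite (se_idem _ hF).
Qed.

Let K_D x : D x -> K x = c%:C *: x.
Proof. by move=> Dx; rewrite -{1}(mulr1 x) K_left // K1 -scalerAr mulr1. Qed.

Let K_D' x : D' x -> K x = c%:C *: x.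
Proof. by move=> Dx; rewrite -{1}(mul1r x) K_right // K1 -scalerAl mul1r. Qed.

Let K_K x : K (K x) = c%:C *: K x.
Proof.
have lK := bim_lin bimK.
have e : K x = \sum_i F (lam i) * F' (F (star (lam i)) * x) by [].
rewrite e (lin_sum lK) scaler_sumr; apply: eq_bigr => i _.
rewrite K_left; last exact: be_mem (se_exp hF) _.
by rewrite K_D' ?scalerAr //; exact: be_mem (se_exp hF') _.
Qed.

Let rtrK : rtr K = p * q.
Proof.
have [hf _ _] := hF; have [b1 _] := bF'.
apply: realS_inj; rewrite -rtrE //.
transitivity (\sum_i F (lam i) * (q%:S * star (F (lam i)))).
  rewrite /trc /K; under eq_bigr do rewrite mulr_suml.
  rewrite exchange_big /=; apply: eq_bigr => i _.
  rewrite -(be_star hf) /q -rtrE // -trc_central // mulr_sumr.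
  by apply: eq_bigr => k _; rewrite mulrA.
have -> : (p * q)%:S = q%:C *: p%:S :> A by nc.
rewrite /p (rtr_idem (fun x => se_idem x hF)) -ipE // trc_compE // scaler_sumr.
by apply: eq_bigr => i _; rewrite mulrA -scalerAr mulr1 -scalerAl.
Qed.

(* The projections onto [D] and [D'] lie below [K / c], whose trace is [p q / c];
   their join has trace [p + q - 1] because [D] and [D'] meet in [B]. *)
Lemma angle_le : c * (p + q - 1) <= p * q.
Proof.
have pF : p = ip F F := rtr_idem (fun x => se_idem x hF).
have qF : q = ip F' F' := rtr_idem (fun x => se_idem x hF').
have p0 : 0 <= p by rewrite pF; exact: ip_ge0.
have q0 : 0 <= q by rewrite qF; exact: ip_ge0.
have [Z [bZ vZ HZ]] := corner_inverse.
have ZZ x : Z (v' x) = Z x.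
  have h y : v' (Z y) = 1%:C *: Z y by rewrite vZ scale1r.
  by have := bsa_transpose bv' bZ h x; rewrite scale1r.
have lZ := bim_lin (bsa_bim bZ).
pose f x := x - F x.
have bf : bsa f := bsaB bsa_id bF.
have lf := bim_lin (bsa_bim bf).
have ff x : f (f x) = f x by rewrite /f (linB lF) (se_idem _ hF) subrr subr0.
have Ff x : F (f x) = 0 by rewrite /f (linB lF) (se_idem _ hF) subrr.
have fF x : f (F x) = 0 by rewrite /f (se_idem _ hF) subrr.
have vfZ x : v' (f (Z x)) = v' x.
  by rewrite -(HZ x) /H vZ /f (linB lv') vZ.
have ZfZ x : Z (f (Z x)) = Z x by rewrite -ZZ vfZ ZZ.
(* The projection onto the image of [D'] under [f = 1 - F]. By [vfZ] it is idempotent and has the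
   trace of [v']; [F + g] is the join of [F] and [F']. *)
pose g x := f (Z (f x)).
have bg : bsa g := bsa_conj bf bZ.
have gg x : g (g x) = g x by rewrite /g ff ZfZ.
have tg : rtr g = q - 1.
  have b1 := bsa_bim bf; have b2 := bsa_bim bZ; have b3 := bsa_bim bv'.
  have -> : q - 1 = rtr v' by rewrite /v' rtrB // ?rtr_E //; exact: bsa_E.
  apply: realS_inj; rewrite -!rtrE //.
  rewrite (trc_tracial b1 (bim_comp b2 b1)).
  transitivity (trc (v' \o (f \o Z))); last by apply: eq_bigr => i _ /=; rewrite vfZ.
  rewrite (trc_tracial b3 (bim_comp b1 b2)).
  transitivity (trc (Z \o f)); first by apply: eq_bigr => i _ /=; rewrite ff.
  by rewrite (trc_tracial b2 b1); apply: eq_bigr => i _ /=; rewrite ZZ.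
have Kg x : K (g x) = c%:C *: g x.
  rewrite /g; set w := Z _.
  have Dw : D' w.
    have <- : F' (w - E w) = w by rewrite (linB lF') (se_FE _ hF') -/(v' w) /w vZ.
    exact: be_mem (se_exp hF') _.
  rewrite /f (linB (bim_lin bimK)) K_D' // K_D ?scalerBr //.
  exact: be_mem (se_exp hF) _.
pose s x := F x + g x.
have bs : bsa s := bsaD bF bg.
have Ks x : K (s x) = c%:C *: s x.
  rewrite /s (linD (bim_lin bimK)) Kg K_D ?scalerDr //.
  exact: be_mem (se_exp hF) _.
have sK := bsa_transpose bK bs Ks.
have ss x : s (s x) = s x.
  have Fg y : F (g y) = 0 by rewrite /g Ff.
  have gF y : g (F y) = 0 by rewrite /g fF (lin0 lZ) (lin0 lf).
  have lg := bim_lin (bsa_bim bg).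
  by rewrite /s (linD lF) (linD lg) (se_idem _ hF) Fg gF gg addr0 add0r.
(* From [L \o L = c L] follows [c * rtr L = ip L L >= 0], and [c > 0] can be cancelled. For [c <= 0]
   the claim is immediate, as [p + q - 1] and [p q] are nonnegative. *)
pose L x := K x - c%:C *: s x.
have bL : bsa L := bsaB bK (bsaZ c bs).
have LL x : L (L x) = c%:C *: L x.
  have lK := bim_lin bimK; have ls := bim_lin (bsa_bim bs).
  rewrite /L (linB lK) K_K (linZ lK) Ks (linB ls) sK (linZ ls) ss; nc.
have tL : rtr L = p * q - c * (p + q - 1).
  rewrite /L (rtrB bK (bsaZ c bs)) (rtrZ c bs) rtrK /s (rtrD bF bg) tg.
  by rewrite -/p addrA.
have [c0|c0] := leP c 0.
  have p1 : 1 <= p.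
    apply: (rtr_proj_ge1 (y := 1) bF) => [x|]; first exact: se_idem hF.
    have -> : F 1 = 1 by apply: (be_id (se_exp hF)); apply: (se_sub hF); exact: (ucs1 sB).
    exact: one_neq0.
  move: c0 p0 q0 p1; move: p q c => *; nra.
rewrite -subr_ge0 -tL -(pmulr_rge0 _ c0) -(rtrZ c bL).
by rewrite (rtr_comp (fun x => esym (LL x))) ip_ge0.
Qed.

End Angle.

(** * Expectations onto intermediate subalgebras *)

Lemma E_nrm_pos h : pos h -> nrm (E h) <= nrm h.
Proof.
move=> ph; have -> : nrm h = nrm ((nrm h)%:S) by rewrite nrmS ger0_norm ?nrm_ge0.
apply: pos_nrm_le; first exact: Epos.
have -> : (nrm h)%:S - E h = E ((nrm h)%:S - h) by rewrite (linB lE) (linZ lE) (Eid (ucs1 sB)).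
by apply/Epos/pos_nrmB/pos_sa.
Qed.

Lemma abs_exists k : star k = k -> exists a, [/\ pos a, a * a = k * k, a * k = k * a &
  forall S, closed_subalg S -> S k -> S a].
Proof.
move=> sk; have [a [pa aa aS]] := pos_sqrt (pos_sqr sk); exists a; split=> //.
  apply/esym; apply: (aS (fun y => k * y = y * k)); first exact: closed_commutant.
  by rewrite mulrA.
by move=> S cS Sk; apply: (aS S cS); have [_ _ _ SM _] := cS; exact: SM.
Qed.

(** * Orthogonal complements over a simple algebra *)

Section Complement.
Hypothesis hBs : simple_cstar nrm B.

(** The closed ideal generated by [w] is all of [B], so 1 is close to a sum [v] of terms [a w b].
    Cauchy-Schwarz dominates [star v * v] by a multiple of [q], the sum of the [star (w b) * (w b)];
    hence [q] is invertible, and its inverse root normalises the sum to 1. *)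
Lemma simple_unit_sum w : B w -> w != 0 -> exists s : seq A,
  (forall x, x \in s -> B x) /\ \sum_(x <- s) star (w * x) * (w * x) = 1.
Proof.
move=> Bw w0.
pose comb (l : seq (A * A)) := \sum_(t <- l) t.1 * w * t.2.
pose inB (l : seq (A * A)) := forall t, t \in l -> B t.1 /\ B t.2.
pose I x := B x /\ forall e : R, 0 < e -> exists2 l, inB l & nrm (x - comb l) < e.
have [|Iz|IB] := hBs (I := I).
- split; last first.
    move=> u l Iu cu; split.
      by have [_ _ _ _ Bc] := ucs_subalg sB; apply: Bc cu => k; case: (Iu k).
    move=> e e0; have [N /(_ N (leqnn N)) hN] := cu _ (divr_gt0 e0 (ltr0n R 2)).
    have [_ /(_ _ (divr_gt0 e0 (ltr0n R 2)))[t It ht]] := Iu N; exists t => //.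
    by have := nrm_tri l (u N) (comb t); rewrite (nrmBC l (u N)); lra.
  split=> [x []//||x y [Bx hx] [By hy]|c x [Bx hx]|s x Bs [Bx hx]].
  - split; first exact: (ucs0 sB).
    by move=> e e0; exists [::] => //; rewrite /comb big_nil subrr nrm0.
  - split; first exact: (ucsD sB).
    move=> e e0; have [l1 I1 h1] := hx _ (divr_gt0 e0 (ltr0n R 2)).
    have [l2 I2 h2] := hy _ (divr_gt0 e0 (ltr0n R 2)); exists (l1 ++ l2).
      by move=> t; rewrite mem_cat => /orP[/I1|/I2].
    rewrite /comb big_cat /= -!/(comb _).
    have -> : x + y - (comb l1 + comb l2) = (x - comb l1) + (y - comb l2) by nc.
    by have := nrmD (x - comb l1) (y - comb l2); lra.
  - have Bc : B c%:A by apply: (ucsZ sB); exact: (ucs1 sB).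
    split; first exact: (ucsZ sB).
    move=> e e0; pose K := nrm c%:A + 1; have K0 : 0 < K by rewrite ltr_wpDl ?nrm_ge0.
    have [l Il hl] := hx _ (divr_gt0 e0 K0).
    exists [seq (c *: t.1, t.2) | t <- l].
      by move=> t /mapP[t' /Il[? ?] ->] /=; split=> //; exact: (ucsZ sB).
    have -> : comb [seq (c *: t.1, t.2) | t <- l] = c *: comb l.
      by rewrite /comb big_map scaler_sumr; apply: eq_bigr => t _ /=; rewrite -!scalerAl.
    have -> : c *: x - c *: comb l = c%:A * (x - comb l) by nc.
    rewrite (le_lt_trans (nrmM _ _)) //; move: hl; rewrite ltr_pdivlMr // /K.
    have := nrm_ge0 (x - comb l); have := nrm_ge0 c%:A => *; nra.
  - pose K := nrm s + 1; have K0 : 0 < K by rewrite ltr_wpDl ?nrm_ge0.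
    split; (split; first exact: (ucsM sB)); move=> e e0; have [l Il hl] := hx _ (divr_gt0 e0 K0).
      exists [seq (s * t.1, t.2) | t <- l].
        by move=> t /mapP[t' /Il[? ?] ->] /=; split=> //; exact: (ucsM sB).
      have -> : comb [seq (s * t.1, t.2) | t <- l] = s * comb l.
        by rewrite /comb big_map mulr_sumr; apply: eq_bigr => t _ /=; rewrite !mulrA.
      rewrite -mulrBr (le_lt_trans (nrmM _ _)) //; move: hl; rewrite ltr_pdivlMr // /K.
      have := nrm_ge0 (x - comb l); have := nrm_ge0 s => *; nra.
    exists [seq (t.1, t.2 * s) | t <- l].
      by move=> t /mapP[t' /Il[? ?] ->] /=; split=> //; exact: (ucsM sB).
    have -> : comb [seq (t.1, t.2 * s) | t <- l] = comb l * s.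
      by rewrite /comb big_map mulr_suml; apply: eq_bigr => t _ /=; rewrite !mulrA.
    rewrite -mulrBl (le_lt_trans (nrmM _ _)) //; move: hl; rewrite ltr_pdivlMr // /K.
    have := nrm_ge0 (x - comb l); have := nrm_ge0 s => *; nra.
- case/eqP: w0; apply: Iz; split=> // e e0; exists [:: (1, 1)].
    by move=> t; rewrite inE => /eqP ->; split; exact: (ucs1 sB).
  by rewrite /comb big_seq1 /= mul1r mulr1 subrr nrm0.
have [_ h1] := IB 1 (ucs1 sB).
(* If [1 - v] has norm below 1/4, then [1 - star v * v] has norm at most [1/4 + 5/4 * 1/4 = 9/16],
   hence [star v * v] is at least 7/16. *)
have [l Il hl] := h1 (4^-1) (ltac:(by rewrite invr_gt0)).
pose v := comb l; pose q := \sum_(t <- l) star (w * t.2) * (w * t.2).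
have Bq : B q.
  rewrite /q big_seq; apply: (big_ind B); [exact: (ucs0 sB)|exact: (ucsD sB)|].
  move=> t /Il[_ B2]; apply: (ucsM sB); last exact: (ucsM sB).
  by apply: (ucs_star sB); exact: (ucsM sB).
have pq : pos q by apply: pos_sum => t _; exact: starM_pos.
pose N := (size l)%:R : R; pose L := \sum_(t <- l) nrm (star t.1 * t.1).
have L0 : 0 <= L by apply: sumr_ge0 => t _; exact: nrm_ge0.
have N0 : 0 <= N by [].
have p1 : pos ((N * L)%:C *: q - star v * v).
  pose X := \sum_(t <- l) star (t.1 * w * t.2) * (t.1 * w * t.2).
  have pA : pos (N%:C *: X - star v * v).
    by have := sqr_sum_le [seq t.1 * w * t.2 | t <- l]; rewrite size_map !big_map.
  have pB : pos (L%:C *: q - X).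
    rewrite /q scaler_sumr -sumrB big_seq; apply: pos_sum => t tl.
    have -> : L%:C *: (star (w * t.2) * (w * t.2)) - star (t.1 * w * t.2) * (t.1 * w * t.2)
      = star (w * t.2) * (L%:S - star t.1 * t.1) * (w * t.2).
      by rewrite !starM; nc.
    apply: pos_conj; apply: pos_leB; first by rewrite starM starK.
    rewrite /L (big_rem t) //= lerDl; apply: sumr_ge0 => j _; exact: nrm_ge0.
  by have := posD pA (posZ N0 pB); congr pos; nc.
have nv : nrm (1 - star v * v) <= 9 / 16.
  have -> : 1 - star v * v = star (1 - v) + star v * (1 - v).
    by rewrite starB star1; nc.
  have := nrmD (star (1 - v)) (star v * (1 - v)); have := nrmM (star v) (1 - v).
  rewrite !nrm_star; have := nrmB 1 (1 - v); rewrite subKr nrm1.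
  have := nrm_ge0 (1 - v); rewrite -/v in hl; have := nrm_ge0 v.
  move: (nrm (1 - v)) (nrm v) (nrm (star v * (1 - v))) (nrm (star (1 - v) + _)) hl.
  by move=> *; nra.
have p2 : pos (star v * v - (7 / 16)%:S).
  have := @pos_leB (1 - star v * v) (9 / 16); rewrite starB star1 starM starK => /(_ (erefl _) nv).
  by congr pos; nc; field.
pose K := N * L + 1; have K0 : 0 < K by rewrite ltr_wpDl ?mulr_ge0.
have [||q' [q1 q2 sq' q'S]] := @pos_inv q (7 / 16 / K).
- by rewrite divr_gt0 //; lra.
- apply: (@posZE K) => //.
  have -> : K%:C *: (q - (7 / 16 / K)%:S) = K%:C *: q - (7 / 16)%:S.
    by nc; field; rewrite fmorph_eq0 gt_eqF.
  by have := posD (posD p1 p2) pq; congr pos; rewrite /K; nc.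
have pq' : pos q'.
  by have := pos_conj q' pq; rewrite sq' -mulrA q1 mulr1.
have [g [[sg _] gg gS]] := pos_sqrt pq'.
have Bg : B g by apply: gS (ucs_subalg sB) _; apply: q'S (ucs_subalg sB) Bq.
have qg : q * g = g * q.
  apply: (gS (fun y => q * y = y * q)); first exact: closed_commutant.
  by rewrite q1 q2.
exists [seq t.2 * g | t <- l]; split.
  by move=> x /mapP[t /Il[_ B2] ->]; exact: (ucsM sB).
rewrite big_map -q1 -gg mulrA qg /q mulr_sumr mulr_suml; apply: eq_bigr => t _.
by rewrite (mulrA w) (starM _ g) sg !mulrA.
Qed.

Variable C : A -> Prop.
Hypothesis hC : unital_cstar_subalgebra nrm star C.
Hypothesis BC : forall x, B x -> C x.

(** The positive finite rank operator [\sum_x x e_B star x]. [G] measures its size, and [adm] says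
    that it lies below 1 as a quadratic form for [E], with all [x] in [C]. *)
Let Top (s : seq A) y := \sum_(x <- s) x * E (star x * y).
Let G (s : seq A) := \sum_(x <- s) E (x * star x).
Let adm (s : seq A) := (forall x, x \in s -> C x) /\
  forall y, pos (E (star y * y) - E (star y * Top s y)).

Let Top_lin s : lin (Top s).
Proof.
move=> c x y; rewrite /Top scaler_sumr -big_split; apply: eq_bigr => z _ /=.
by rewrite mulrDr -scalerAr lE mulrDr -scalerAr.
Qed.

Let Top_C s y : (forall x, x \in s -> C x) -> C (Top s y).
Proof.
move=> hs; rewrite /Top big_seq; apply: (big_ind C); [exact: (ucs0 hC)|exact: (ucsD hC)|].
by move=> x xs; apply: (ucsM hC); [exact: hs|exact/BC].
Qed.

Let Top_sa s x y : E (star x * Top s y) = E (star (Top s x) * y).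
Proof.
rewrite /Top mulr_sumr star_sum mulr_suml !(lin_sum lE); apply: eq_bigr => z _.
rewrite mulrA (Er _ (EB _)) starM -mulrA -Estar (El _ (EB _)).
by rewrite starM starK.
Qed.

Let Top_pos s y : pos (E (star y * Top s y)).
Proof.
rewrite /Top mulr_sumr (lin_sum lE); apply: pos_sum => x _.
rewrite mulrA (Er _ (EB _)); have := starM_pos (E (star x * y)).
by rewrite -Estar starM starK.
Qed.

(** For [0 <= T <= 1] one has [T - T^2 = (1 - T) T (1 - T) + T (1 - T) T]. *)
Let Top_sq s y : adm s -> pos (E (star y * Top s y) - E (star (Top s y) * Top s y)).
Proof.
move=> [_ hs]; have p1 := Top_pos s (y - Top s y); have p2 := hs (Top s y).
have := posD p1 p2; congr pos.
rewrite (linB (@Top_lin s)) starB.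
have -> : (star y - star (Top s y)) * (Top s y - Top s (Top s y)) =
  star y * Top s y - star y * Top s (Top s y) - star (Top s y) * Top s y +
  star (Top s y) * Top s (Top s y) by nc.
rewrite (linD lE) !(linB lE) (Top_sa s y (Top s y)); nc.
Qed.

Let rank1_le d w : nrm d <= 1 -> pos (E (star w * w) - E (star w * d) * E (star d * w)).
Proof.
move=> d1; have p1 := E_schwarz (star d * w).
rewrite -Estar starM starK in p1.
have p2 : pos (star w * (1%:S - d * star d) * w).
  apply: pos_conj; apply: pos_leB; first by rewrite starM starK.
  have := nrmM d (star d); rewrite nrm_star; have := nrm_ge0 d; nra.
have := posD (Epos p2) p1; congr pos.
have -> : star w * (1%:S - d * star d) * w = star w * w - star w * d * (star d * w) by nc.
rewrite (linB lE); nc.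
Qed.

(** With [T = Top s], [d e_B star d <= 1] bounds the new operator by
    [T + (1 - T)^2 = 1 - (T - T^2) <= 1]. *)
Let adm_cons s d : adm s -> C d -> nrm d <= 1 -> adm ((d - Top s d) :: s).
Proof.
move=> hs Cd d1; have [sC hs2] := hs; split.
  move=> x; rewrite inE => /predU1P[->|/sC //]; apply: (ucsB hC) => //; exact: Top_C.
move=> y; set f := d - Top s d.
have -> : Top (f :: s) y = f * E (star f * y) + Top s y by rewrite /Top big_cons.
pose w := y - Top s y.
have e1 : E (star y * f) = E (star w * d).
  by rewrite /f /w mulrBr (linB lE) Top_sa starB mulrBl (linB lE).
have e2 : E (star f * y) = E (star d * w).
  by rewrite /f /w starB mulrBl (linB lE) -Top_sa mulrBr (linB lE).
rewrite mulrDr (linD lE) mulrA (Er _ (EB _)) e1 e2.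
have := posD (rank1_le w d1) (Top_sq y hs); congr pos.
have -> : E (star w * w) = E (star y * y) - E (star y * Top s y) -
  E (star (Top s y) * y) + E (star (Top s y) * Top s y).
  rewrite -(linB lE) -(linB lE) -(linD lE) /w starB; congr E; nc.
rewrite -Top_sa; nc.
Qed.

(** Through the quasi-basis the sum of [x * star x] becomes the sum of
    [Top s (lam i) * star (lam i)], and [pimsner_popa] turns [Top s <= 1] into a norm bound on
    [Top s (lam i)]. The summand 1 in the constant comes from [a <= 1 + a^2]. *)
Let adm_bound : exists M : R, forall s, adm s -> nrm (G s) <= M.
Proof.
have [c c0 pp] := pimsner_popa.
exists (\sum_i (1 + c * nrm (E (star (lam i) * lam i))) * nrm (star (lam i))) => s hs.
have [_ hs2] := hs.
have -> : G s = E (\sum_(x <- s) x * star x) by rewrite (lin_sum lE).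
apply: le_trans (E_nrm_pos _) _; first by apply: pos_sum => x _; exact: mul_star_pos.
have -> : \sum_(x <- s) x * star x = \sum_i Top s (lam i) * star (lam i).
  rewrite /Top; under [RHS]eq_bigr do rewrite mulr_suml.
  rewrite exchange_big /=; apply: eq_bigr => x _.
  by rewrite [in LHS](qbl (star x)) mulr_sumr; apply: eq_bigr => i _; rewrite mulrA.
apply: le_trans (nrm_sum _ _ _) _; apply: ler_sum => i _.
apply: le_trans (nrmM _ _) _; rewrite ler_wpM2r ?nrm_ge0 //.
set y := lam i; set z := Top s y.
have a1 : nrm (star z * z) <= c * nrm (E (star z * z)).
  have := pos_nrm_le (starM_pos z) (pp z); rewrite nrmZ ger0_norm //; exact: ltW.
have a2 : nrm (E (star z * z)) <= nrm (E (star y * y)).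
  apply: pos_nrm_le; first exact/Epos/starM_pos.
  have := posD (Top_sq y hs) (hs2 y); congr pos; rewrite -/z; nc.
rewrite nrm_starM in a1; have := le_trans a1 (ler_wpM2l (ltW c0) a2).
have := nrm_ge0 z; move: (nrm z) (c * _) => *; nra.
Qed.

(* The bound [G <= sup |G|] is attained up to [e]: where [G s] is large, a
   compression by elements of the simple algebra [B] spreads its value over [1]. *)
Let adm_large e : 0 < e -> e < 1 -> exists (t : R) s, [/\ adm s, pos (G s - (t - e)%:S) &
  forall s', adm s' -> nrm (G s') <= t].
Proof.
move=> e0 e1; have [M hM] := adm_bound.
pose X := [set nrm (G s) | s in [set s | adm s]]%classic.
have adm1 : adm [:: 1].
  split; first by move=> x; rewrite inE => /eqP ->; exact: (ucs1 hC).
  move=> y; rewrite /Top big_seq1 star1 !mul1r (Er _ (EB _)) Estar; exact: E_schwarz.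
have X1 : X 1.
  by exists [:: 1] => //; rewrite /G big_seq1 star1 mulr1 (Eid (ucs1 sB)) nrm1.
have hX : has_sup X by split; [exists 1|exists M => _ [s hs <-]; exact: hM].
pose t := sup X.
have tX s : adm s -> nrm (G s) <= t.
  by move=> hs; apply: (sup_upper_bound hX); exists s.
have t1 : 1 <= t by apply: (sup_upper_bound hX).
have [_ [s hs <-] st] := sup_adherent e0 hX; rewrite -/t in st.
have pG : pos (G s) by apply: pos_sum => x _; apply/Epos/mul_star_pos.
pose k := G s - (t - e)%:S.
have sk : star k = k by rewrite starB starS (pos_sa pG).
have Bk : B k.
  apply: (ucsB sB); last by apply: (ucsZ sB); exact: (ucs1 sB).
  by rewrite /G; apply: (big_ind B) => [||x _]; [exact: (ucs0 sB)|exact: (ucsD sB)|exact: EB].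
have nk : ~ pos (- k).
  move=> pk; have := pos_nrm_le pG (_ : pos ((t - e)%:S - G s)).
  rewrite nrmS ger0_norm; last by lra.
  have -> : (t - e)%:S - G s = - k by rewrite /k; nc.
  by move=> /(_ pk); lra.
(* [a] is the absolute value of [k], so [w = a + k] is twice the positive part and [k w = a w]:
   compressed by [w], [k] becomes positive. *)
have [a [pa aa ak aS]] := abs_exists sk.
have Ba : B a by apply: aS (ucs_subalg sB) Bk.
pose w := a + k.
have w0 : w != 0.
  apply/eqP => w0; apply: nk; have -> : - k = a - w by rewrite /w; nc.
  by rewrite w0 subr0.
have sw : star w = w by rewrite starD sk (pos_sa pa).
have Bw : B w by exact: (ucsD sB).
have kw : k * w = a * w by rewrite /w (mulrDr k a k) (mulrDr a a k) aa ak addrC.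
have [xs [Bxs e1s]] := simple_unit_sum Bw w0.
pose zs := [seq w * x | x <- xs].
have Bzs z : z \in zs -> B z by move=> /mapP[x /Bxs Bx ->]; exact: (ucsM sB).
have zs1 : \sum_(z <- zs) star z * z = 1 by rewrite big_map.
pose s1 := [seq star z * x | z <- zs, x <- s].
have [sC hs2] := hs.
exists t, s1; split=> //.
- split.
    move=> _ /allpairsP[[z x] [/= zz xs' ->]]; apply: (ucsM hC); last exact: sC.
    exact/BC/(ucs_star sB)/Bzs.
  move=> y; have -> : Top s1 y = \sum_(z <- zs) star z * Top s (z * y).
    rewrite /Top big_allpairs_dep; apply: eq_bigr => z _; rewrite mulr_sumr.
    by apply: eq_bigr => x _; rewrite starM starK !mulrA.
  have -> : E (star y * y) = \sum_(z <- zs) E (star (z * y) * (z * y)).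
    rewrite -(lin_sum lE); congr E; rewrite -{1}(mulr1 (star y)) -zs1.
    rewrite mulr_sumr mulr_suml; apply: eq_bigr => z _.
    by rewrite starM !mulrA.
  rewrite mulr_sumr (lin_sum lE) -sumrB; apply: pos_sum => z _.
  have := hs2 (z * y); congr pos; congr (_ - E _).
  by rewrite starM !mulrA.
- have -> : G s1 - (t - e)%:S = \sum_(z <- zs) star z * k * z.
    have -> : G s1 = \sum_(z <- zs) star z * G s * z.
      rewrite /G big_allpairs_dep [LHS]big_seq [RHS]big_seq; apply: eq_bigr => z /Bzs Bz.
      rewrite mulr_sumr mulr_suml; apply: eq_bigr => x _.
      rewrite -(El _ (ucs_star sB Bz)) -(Er _ Bz); congr E.
      by rewrite starM starK !mulrA.
    have -> : (t - e)%:S = \sum_(z <- zs) star z * (t - e)%:S * z.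
      by rewrite -[in LHS]zs1 scaler_sumr; apply: eq_bigr => z _; nc.
    by rewrite -sumrB; apply: eq_bigr => z _; rewrite /k; nc.
  rewrite big_map; apply: pos_sum => x _.
  have -> : star (w * x) * k * (w * x) = star (w * x) * a * (w * x).
    by rewrite -!mulrA (mulrA k) kw !mulrA.
  exact: pos_conj.
Qed.

(** Adjoining [f = d - Top s d] raises [G] by [E (f * star f)]. Since [G s] is at least [t - e] as
    an operator and the new value at most [t], the increment is at most [e], and [pimsner_popa]
    bounds [nrm f ^ 2] by [c e <= 1/4]. *)
Let near_id : exists s, (forall x, x \in s -> C x) /\
  forall d, C d -> nrm (d - Top s d) <= 2^-1 * nrm d.
Proof.
have [c c0 pp] := pimsner_popa.
pose e := (4 * c + 1)^-1.
have d0 : 0 < 4 * c + 1 by lra.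
have e0 : 0 < e by rewrite invr_gt0.
have e1 : e < 1 by rewrite invf_lt1 //; lra.
have ce : c * e <= 4^-1.
  have : e * (4 * c + 1) = 1 by rewrite mulVf ?gt_eqF.
  move: e0 {e1}; move: e => *; nra.
have [t [s [hs ps st]]] := adm_large e0 e1; have [sC _] := hs; exists s; split=> //.
have half d : C d -> nrm d <= 1 -> nrm (d - Top s d) <= 2^-1.
  move=> Cd d1; set f := d - Top s d.
  have h2 := adm_cons hs Cd d1; have := st _ h2.
  have -> : G ((d - Top s d) :: s) = E (f * star f) + G s by rewrite /G big_cons.
  set g := E (f * star f) + G s => gt.
  have pf : pos (E (f * star f)) by apply/Epos/mul_star_pos.
  have pG : pos (G s) by apply: pos_sum => x _; apply/Epos/mul_star_pos.
  have pg : pos (t%:S - g).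
    by apply: pos_leB => //; apply: pos_sa; exact: posD.
  have nf : nrm (E (f * star f)) <= e.
    have ne : nrm e%:S = e by rewrite nrmS ger0_norm // ltW.
    rewrite -[X in _ <= X]ne; apply: pos_nrm_le => //.
    have := posD pg ps; congr pos; rewrite /g; nc.
  have := pp (star f); rewrite starK => /(pos_nrm_le (mul_star_pos f)).
  rewrite nrmZ (ger0_norm (ltW c0)) -{1}(starK f) nrm_starM nrm_star.
  have := nrm_ge0 f; have := ler_wpM2l (ltW c0) nf.
  move: (nrm f) (c * nrm _) (c * e) ce => n1 n2 n3 *.
  have : n1 ^+ 2 <= 4^-1 by lra.
  nra.
move=> d Cd; have [n0|n0] := eqVneq (nrm d) 0.
  by rewrite (nrm_eq0 n0) (lin0 (@Top_lin s)) subrr nrm0 mulr0.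
have np : 0 < nrm d by rewrite lt0r n0 nrm_ge0.
pose d' := (nrm d)^-1%:C *: d.
have : nrm (d' - Top s d') <= 2^-1.
  apply: half; first exact: (ucsZ hC).
  by rewrite nrmZ ger0_norm ?invr_ge0 ?nrm_ge0 // mulVf.
rewrite /d' (linZ (@Top_lin s)) -scalerBr nrmZ ger0_norm ?invr_ge0 ?nrm_ge0 //.
by rewrite ler_pdivrMl // mulrC.
Qed.

(** [Top s] is within 1/2 of the identity on [C], hence onto [C]. Solve [Top s c = Top s y]; every
    [d] in [C] is some [Top s d'], and self-adjointness moves [Top s] over to [y - c]. *)
Lemma orth_proj y : exists2 c, C c & forall d, C d -> E (star d * (y - c)) = 0.
Proof.
have [s [sC hs]] := near_id.
have solve z : C z -> exists2 c, C c & Top s c = z.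
  move=> Cz; have [||||||c Cc fc] := @fixpoint C (fun x => x - Top s x + z) 2^-1 0.
  - by have [_ _ _ _ h] := ucs_subalg hC.
  - exact: (ucs0 hC).
  - move=> x Cx; apply: (ucsD hC) => //; apply: (ucsB hC) => //; exact: Top_C.
  - by rewrite invr_ge0.
  - by rewrite invf_lt1 // ltr1n.
  - move=> x x' Cx Cx'; have := hs _ (ucsB hC Cx Cx').
    rewrite (linB (@Top_lin s)).
    by have -> : x - x' - (Top s x - Top s x') = x - Top s x + z - (x' - Top s x' + z) by nc.
  exists c => //; have -> : Top s c = z - (c - Top s c + z - c) by nc.
  by rewrite fc subrr subr0.
have [c Cc ec] := solve _ (Top_C y sC); exists c => // d Cd.
have [d' Cd' <-] := solve _ Cd.
by rewrite -Top_sa (linB (@Top_lin s)) ec subrr mulr0 (lin0 lE).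
Qed.

Let orth_uniq y c c' : C c -> C c' -> (forall d, C d -> E (star d * (y - c)) = 0) ->
  (forall d, C d -> E (star d * (y - c')) = 0) -> c = c'.
Proof.
move=> Cc Cc' h h'; apply/eqP; rewrite -subr_eq0; apply/eqP; apply: E_faithful.
have Cd := ucsB hC Cc Cc'.
have -> : star (c - c') * (c - c') = star (c - c') * (y - c') - star (c - c') * (y - c) by nc.
by rewrite (linB lE) h // h' // subrr.
Qed.

(** The orthogonal projection [F] is left [C]-linear and a self-adjoint [B]-bimodule map, with
    transpose [z -> star (F (star z))]. Triviality of the modular automorphism ([twE']) then shows
    that [F] commutes with [star], which gives right [C]-linearity. *)
Lemma sub_exp_exists : exists F, sub_exp C F.
Proof.
have ch y : exists c, C c /\ forall d, C d -> E (star d * (y - c)) = 0.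
  by have [c Cc hc] := orth_proj y; exists c.
pose F y := projT1 (cid (ch y)).
have FC y : C (F y) by rewrite /F; case: cid => c [].
have Fo y d : C d -> E (star d * (y - F y)) = 0 by rewrite /F; case: cid => c [_ h] /=; exact: h.
have Fu y c : C c -> (forall d, C d -> E (star d * (y - c)) = 0) -> F y = c.
  by move=> Cc hc; apply: (orth_uniq (FC y) Cc _ hc) => d; exact: Fo.
have lF : lin F.
  move=> c x y; apply: Fu; first by apply: (ucsD hC) => //; exact: (ucsZ hC).
  move=> d Cd; have -> : star d * (c *: x + y - (c *: F x + F y)) =
    c *: (star d * (x - F x)) + star d * (y - F y) by nc.
  by rewrite lE !Fo // scaler0 addr0.
have Fid b : C b -> F b = b.
  by move=> Cb; apply: Fu => // d _; rewrite subrr mulr0 (lin0 lE).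
have Fl b x : C b -> F (b * x) = b * F x.
  move=> Cb; apply: Fu; first exact: (ucsM hC).
  move=> d Cd; have := Fo x _ (ucsM hC (ucs_star hC Cb) Cd).
  by rewrite starM starK -mulrA mulrBr.
have FrB b x : B b -> F (x * b) = F x * b.
  move=> Bb; apply: Fu; first by apply: (ucsM hC) => //; exact: BC.
  by move=> d Cd; rewrite -mulrBl mulrA (Er _ Bb) Fo // mul0r.
have bF : bim F by split=> // b x Bb; apply: Fl; exact: BC.
have FoR x y : C y -> E (star x * y) = E (star (F x) * y).
  move=> Cy; apply/eqP; rewrite -subr_eq0 -(linB lE) -mulrBl -starB.
  have := congr1 star (Fo x _ Cy); rewrite -Estar starM starK star0 => ->.
  by rewrite eqxx.
have FoL x y : C x -> E (star x * y) = E (star x * F y).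
  by move=> Cx; apply/eqP; rewrite -subr_eq0 -(linB lE) -mulrBr Fo.
have sF : bsa F by split=> // x y; rewrite FoR // -FoL.
have Fstar y : F (star y) = star (F y).
  apply: Fu; first exact: (ucs_star hC).
  move=> d Cd; rewrite -starB -starM Estar mulrBl (linB lE) (twE' _ _ bF) bsa_tw //.
  by rewrite (Fid _ (ucs_star hC Cd)) starK subrr star0.
have Fr b x : C b -> F (x * b) = F x * b.
  move=> Cb; rewrite -[x * b]starK Fstar starM Fl; last exact: (ucs_star hC).
  by rewrite starM starK Fstar starK.
have FE x : E (F x) = E x.
  have := FoL 1 x (ucs1 hC); by rewrite star1 !mul1r.
exists F; split=> //; split=> // x px.
have sa : star (F x) = F x by rewrite -Fstar (pos_sa px).
have [a [pa aa ab aS]] := abs_exists sa.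
have Ca : C a by apply: aS (ucs_subalg hC) (FC x).
(* Twice the negative part of [F x]. It lies in [C], so [E (w * F x * w) = E (w * x * w)] is
   positive, while [F x * w = - (a * w)]; faithfulness gives [a * w = 0], hence [w = 0]. *)
pose w := a - F x.
have sw : star w = w by rewrite starB sa (pos_sa pa).
have Cw : C w by exact: (ucsB hC).
have aw : F x * w = - (a * w).
  by rewrite /w !mulrBr aa ab opprB.
have p1 : pos (E (w * F x * w)).
  have -> : E (w * F x * w) = E (star w * x * w).
    by rewrite -(Fl _ _ Cw) -(Fr _ _ Cw) FE sw.
  by apply/Epos/pos_conj.
have [h [[sh _] hh _]] := pos_sqrt pa.
have e0 : E (star (h * w) * (h * w)) = 0.
  have e : star (h * w) * (h * w) = w * a * w by rewrite starM sw sh -hh !mulrA.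
  apply: pos_antisym; first by apply/Epos/starM_pos.
  rewrite -(linN lE) e; move: p1; rewrite -mulrA aw mulrN mulrA //.
have hw := E_faithful e0.
have aw0 : a * w = 0 by rewrite -hh -mulrA hw mulr0.
suff w0 : w = 0 by move/eqP: w0; rewrite subr_eq0 => /eqP <-.
apply: starM_eq0; rewrite sw {1}/w mulrBl aw aw0 oppr0 subrr //.
Qed.

End Complement.

(** * Passage to an intermediate base algebra *)

Lemma se_tower C D F G x : sub_exp C F -> sub_exp D G -> (forall y, C y -> D y) ->
  F (G x) = F x.
Proof.
move=> hF hG CD; have [eF sF FE] := hF; have [eG sG GE] := hG.
have lF := be_lin eF.
apply/eqP; rewrite -subr_eq0 -(linB lF); apply/eqP; set y := G x - x.
have Fy : C (F y) := be_mem eF y.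
apply: E_faithful.
have [_ saF] := se_bsa hF; have [_ saG] := se_bsa hG.
rewrite -saF (se_idem _ hF).
have -> : E (star y * F y) = E (star y * G (F y)) by rewrite (be_id eG) //; exact: CD.
rewrite saG /y (linB (be_lin eG)) (se_idem _ hG) subrr star0 mul0r (lin0 lE) //.
Qed.

Lemma rtr_se_ge1 D F : sub_exp D F -> 1 <= rtr F.
Proof.
move=> hF; apply: (rtr_proj_ge1 (y := 1) (se_bsa hF)) => [x|]; first exact: se_idem hF.
have -> : F 1 = 1 by apply: (be_id (se_exp hF)); apply: (se_sub hF); exact: (ucs1 sB).
exact: one_neq0.
Qed.

(** The same [lam] serves over the larger algebra: as the trace of [F] is a scalar, [trc_central]
    says that [\sum_i F (x * lam i) * star (lam i)] is [rtr F] times [x], a quasi-basis relation up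
    to that factor. *)
Definition sub_basis (F : A -> A) (i : 'I_n) := (Num.sqrt (rtr F))^-1%:C *: lam i.

Lemma sub_basis_trc (F S T : A -> A) : 0 < rtr F -> lin S -> lin T ->
  \sum_i S (sub_basis F i) * T (star (sub_basis F i)) =
  (rtr F)^-1%:C *: \sum_i S (lam i) * T (star (lam i)).
Proof.
move=> p0 lS lT; rewrite scaler_sumr; apply: eq_bigr => i _.
rewrite /sub_basis starZ (linZ lS) (linZ lT) -scalerAl -scalerAr scalerA -rmorphM.
by rewrite -invfM -expr2 sqr_sqrtr // ltW.
Qed.

Lemma sub_datum D F : unital_cstar_subalgebra nrm star D -> sub_exp D F ->
  index_datum D F (sub_basis F) (r / rtr F).
Proof.
move=> uD hF; have [eF sF FE] := hF; have hb := se_bsa hF; have [bF _] := hb.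
have p0 : 0 < rtr F := lt_le_trans ltr01 (rtr_se_ge1 hF).
have lid : lin id by move=> *.
have lF := be_lin eF.
split=> //.
- by move=> x hx; apply: (id_irr hD) => b Bb; apply: hx; exact: sF.
- move=> x; have e : (rtr F)^-1%:C *: (rtr F)%:S = 1 :> A.
    by rewrite scalerA -rmorphM mulVf ?gt_eqF // scale1r.
  have lFx : lin (fun z => F (x * z)) by move=> c y z; rewrite mulrDr -scalerAr lF.
  have lxF : lin (fun z => F (z * x)) by move=> c y z; rewrite mulrDl -scalerAl lF.
  split.
    rewrite (sub_basis_trc p0 lFx lid) trc_central // (rtrE hb) scalerAl e mul1r //.
  by rewrite (sub_basis_trc p0 lid lxF) trc'_central // -trc_trc' // (rtrE hb) scalerAr e mulr1.
- rewrite (sub_basis_trc p0 lid lid) (id_ind hD) scalerA -rmorphM mulrC //.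
Qed.

Lemma gram_coords (k : nat) (u : nat -> A -> A) : (forall i, (i < k)%N -> bsa (u i)) ->
  exists m (x : nat -> nat -> R), m%:R <= r /\
    forall i j, (i < k)%N -> (j < k)%N -> ip (u i) (u j) = \sum_(a < m) x i a * x j a.
Proof.
move=> hu; have [m [T [x [mr hT oT uE]]]] := gram_schmidt hu; exists m, x; split=> //.
have uT i (a : 'I_m) : (i < k)%N -> ip (u i) (T a) = x i a.
  move=> ik; have -> : u i = fun y => \sum_(b < m) (x i b)%:C *: T b y.
    by apply/funext => y; exact: uE.
  rewrite (ip_suml (x i) hT (hT a (ltn_ord a))) (bigD1 a) //= oT // eqxx mulr1.
  rewrite big1 ?addr0 // => b ba; rewrite oT //.
  by move: ba; rewrite -val_eqE /= => /negbTE ->; rewrite mulr0.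
move=> i j ik jk; rewrite {1}(_ : u i = fun y => \sum_(b < m) (x i b)%:C *: T b y); last first.
  by apply/funext => y; exact: uE.
rewrite (ip_suml (x i) hT (hu j jk)); apply: eq_bigr => a _.
by rewrite ip_sym ?uT //; [exact: hT|exact: hu].
Qed.

Lemma ip_seB D D' F F' : sub_exp D F -> sub_exp D' F' ->
  ip (fun x => F x - E x) (fun x => F' x - E x) = ip F F' - 1.
Proof.
move=> hF hF'; have b1 := se_bsa hF; have b2 := se_bsa hF'; have b3 := bsa_E.
rewrite (ipBl b1 b3 (bsaB b2 b3)) (ip_sym b1 (bsaB b2 b3)) (ip_sym b3 (bsaB b2 b3)).
rewrite !(ipBl b2 b3) // (ip_sym b2 b1) (ip_sym b2 b3).
have -> : ip E F = 1 by rewrite -rtr_E; apply/esym/rtr_comp => x; rewrite (se_E hF).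
have -> : ip E F' = 1 by rewrite -rtr_E; apply/esym/rtr_comp => x; rewrite (se_E hF').
have -> : ip E E = 1 by rewrite -rtr_E; apply/esym/rtr_comp => x; rewrite (Eid (EB _)).
ring.
Qed.

(** With [P = p - 1], [Q = q - 1], [t = c - 1], [angle_le] becomes [t (1 + P + Q) <= P Q]. For
    [s = sqrt (P Q)] and [t > 0] this gives [t (1 + 2 s) <= s^2], so [2 t <= s]: a cosine of at most
    1/2. *)
Lemma angle_cos D D' F F' : sub_exp D F -> sub_exp D' F' ->
  (forall x, D x -> D' x -> B x) ->
  2 * ip (fun x => F x - E x) (fun x => F' x - E x) <=
    Num.sqrt (rtr F - 1) * Num.sqrt (rtr F' - 1).
Proof.
move=> hF hF' hI; rewrite (ip_seB hF hF'); have := angle_le hF hF' hI.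
have := rtr_se_ge1 hF; have := rtr_se_ge1 hF'.
rewrite -subr_ge0; set Q := rtr F' - 1 => Q0; rewrite -subr_ge0; set P := rtr F - 1 => P0.
have -> : rtr F = 1 + P by rewrite /P addrC subrK.
have -> : rtr F' = 1 + Q by rewrite /Q addrC subrK.
have := sqr_sqrtr P0; have := sqr_sqrtr Q0; have := sqrtr_ge0 P; have := sqrtr_ge0 Q.
move: (Num.sqrt P) (Num.sqrt Q) => a b b0 a0 <- <-; move: (ip F F') => c h.
rewrite leNgt; apply/negP => lt; have ab0 : 0 <= a * b by rewrite mulr_ge0.
have t0 : 0 < c - 1 by lra.
have h1 : (c - 1) * (1 + a ^+ 2 + b ^+ 2) <= (a * b) ^+ 2 by rewrite exprMn; lra.
have h2 : (c - 1) * (1 + 2 * (a * b)) <= (a * b) ^+ 2.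
  apply: le_trans h1; rewrite ler_pM2l // -subr_ge0.
  have -> : 1 + a ^+ 2 + b ^+ 2 - (1 + 2 * (a * b)) = (a - b) ^+ 2 by ring.
  exact: sqr_ge0.
move: (a * b) ab0 lt h2 => s *; nra.
Qed.

End Datum.

Lemma scS (a : R) : complex.Re (sc a%:S) = a.
Proof. by rewrite scA. Qed.

Lemma sub_rtr B E n (lam : 'I_n -> A) r D F T : index_datum B E lam r -> sub_exp B E D F ->
  bsa B E T -> rtr (sub_basis lam F) T = rtr lam T / rtr lam F.
Proof.
move=> hD hF hT; have p0 : 0 < rtr lam F := lt_le_trans ltr01 (rtr_se_ge1 hD hF).
have lid : lin id by move=> *.
have lT := bim_lin (bsa_bim hT).
rewrite {1}/rtr /trc (sub_basis_trc p0 lT lid) -/(trc lam T) (rtrE hD hT).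
by rewrite scalerA -rmorphM scS mulrC.
Qed.

(** * Counting *)

Section Count.
Variables (B : A -> Prop) (E : A -> A) (n : nat) (lam : 'I_n -> A) (r : R).
Hypothesis hD : index_datum B E lam r.
Hypothesis hBs : simple_cstar nrm B.

Let inter (C : set A) := intermediate nrm star B C.

Let inter_unital C : inter C -> unital_cstar_subalgebra nrm star C.
Proof. by move=> [hC BC]; split=> //; apply: BC; exact: (ucs1 (id_sub hD)). Qed.

Let exp_exists (C : set A) : exists F, inter C -> sub_exp B E C F.
Proof.
(* [E] is a default value outside the intermediate algebras. *)
have [hC|nC] := pselect (inter C); last by exists E.
by have [F hF] := sub_exp_exists hD hBs (inter_unital hC) (proj2 hC); exists F.
Qed.

Let EF (C : set A) : A -> A := projT1 (cid (exp_exists C)).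

Let EFP C : inter C -> sub_exp B E C (EF C).
Proof. by rewrite /EF; case: cid. Qed.

(** The index of [A] over [C], by [sub_datum]. *)
Let idx C := r / rtr lam (EF C).

Let datum C : inter C -> index_datum C (EF C) (sub_basis lam (EF C)) (idx C).
Proof. by move=> hC; apply: (sub_datum hD (inter_unital hC)); exact: EFP. Qed.

Let tower C D : inter C -> inter D -> (C `<=` D)%classic -> sub_exp C (EF C) D (EF D).
Proof.
move=> hC hDD CD; split; [exact: (se_exp (EFP hDD))|exact: CD|move=> x].
exact: (se_tower hD x (EFP hC) (EFP hDD) CD).
Qed.

Let rtr_gt0 C : inter C -> 0 < rtr lam (EF C).
Proof. by move=> hC; apply: lt_le_trans (rtr_se_ge1 hD (EFP hC)); exact: ltr01. Qed.

Let rtr_tower C D : inter C -> inter D ->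
  rtr (sub_basis lam (EF C)) (EF D) = rtr lam (EF D) / rtr lam (EF C).
Proof.
by move=> hC hDD; apply: (sub_rtr hD (EFP hC)); exact: (se_bsa (EFP hDD)).
Qed.

Let idx_ge1 C : inter C -> 1 <= idx C.
Proof.
move=> hC; have d := datum hC; have b1 := bsa_id C (EF C); have b2 := bsa_E d.
rewrite -(rtr_id d) -(rtr_E d) -subr_ge0 -(rtrB d b1 b2) rtr_idem.
  by apply: (ip_ge0 d); exact: (bsaB d b1 b2).
move=> x; have lE := be_lin (id_exp d).
by rewrite (linB lE) (be_id (id_exp d) (be_mem (id_exp d) x)) subrr subr0.
Qed.

(** [EF D - EF C] is a nonzero projection among the [C]-bimodule maps, so its trace is at least 1,
    and [EF C] itself has trace 1. *)
Let rtr_tower_ge2 C D : inter C -> inter D -> (C `<=` D)%classic -> D <> C ->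
  2 <= rtr (sub_basis lam (EF C)) (EF D).
Proof.
move=> hC hDD CD DC; have d := datum hC; have t := tower hC hDD CD.
have [y Dy nCy] : exists2 y, D y & ~ C y.
  apply: contrapT => h; apply: DC; apply/seteqP; split=> // y Dy.
  by apply: contrapT => nC; apply: h; exists y.
have b1 := se_bsa t; have b2 := bsa_E d; have b3 := bsaB d b1 b2.
have lE := be_lin (id_exp d); have lF := be_lin (se_exp t).
have : 1 <= rtr (sub_basis lam (EF C)) (fun x => EF D x - EF C x).
  apply: (rtr_proj_ge1 d (y := y) b3).
    move=> x; rewrite (linB lE) (linB lF) (se_idem _ t) (se_FE d _ t) (se_E t).
    by rewrite (be_id (id_exp d) (be_mem (id_exp d) x)) subrr subr0.
  rewrite (be_id (se_exp t) Dy) subr_eq0; apply/eqP => e; apply: nCy; rewrite e.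
  exact: be_mem (id_exp d) y.
by rewrite (rtrB d b1 b2) (rtr_E d); lra.
Qed.

Let idx_half C D : inter C -> inter D -> (C `<=` D)%classic -> D <> C ->
  2 * idx D <= idx C.
Proof.
move=> hC hDD CD DC; have := rtr_tower_ge2 hC hDD CD DC; rewrite rtr_tower //.
have c0 := rtr_gt0 hC; have d0 := rtr_gt0 hDD.
rewrite ler_pdivlMr // /idx => h.
have r0 : 0 <= r.
  by have := idx_ge1 hC; rewrite /idx ler_pdivlMr // mul1r => /(le_trans (ltW c0)).
rewrite mulrA ler_pdivrMr // mulrAC ler_pdivlMr //.
by move: (rtr lam (EF C)) (rtr lam (EF D)) h => *; nra.
Qed.

Let minimal_over (C M : set A) := [/\ inter M, (C `<=` M)%classic, M <> C &
  forall D, inter D -> (C `<=` D)%classic -> (D `<=` M)%classic -> D = C \/ D = M].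

(** [k] bounds the descent: each proper step from [D] down towards [C] at least doubles [idx], which
    never exceeds [idx C]. *)
Let minimal_exists (k : nat) C D : inter C -> inter D -> (C `<=` D)%classic -> D <> C ->
  idx C <= 2 ^+ k * idx D -> exists2 M, minimal_over C M & (M `<=` D)%classic.
Proof.
move=> hC; elim: k D => [|k IH] D hDD CD DC le.
  have := idx_half hC hDD CD DC; have := idx_ge1 hDD; rewrite expr0 in le; lra.
have [mD|nD] := pselect (minimal_over C D); first by exists D.
have [D' [hD' CD' DD' nC nD']] : exists D', [/\ inter D', (C `<=` D')%classic,
    (D' `<=` D)%classic, D' <> C & D' <> D].
  apply: contrapT => h; apply: nD; split=> // D' hD' CD' DD'.
  have [->|nC] := pselect (D' = C); first by left.
  have [->|nD'] := pselect (D' = D); first by right.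
  by case: h; exists D'.
have [|M mM MD'] := IH D' hD' CD' nC; last by exists M => //; exact: subset_trans DD'.
have := idx_half hD' hDD DD' (fun e => nD' (esym e)); rewrite exprSr in le.
have : 0 <= 2 ^+ k :> R by exact: exprn_ge0.
move: (2 ^+ k) (idx C) (idx D) (idx D') le => *; nra.
Qed.

Let inter_meet D D' : inter D -> inter D' -> inter (D `&` D')%classic.
Proof.
move=> [[[z a s m t] c] sub] [[[z' a' s' m' t'] c'] sub']; split; last first.
  by move=> x Bx; split; [exact: sub|exact: sub'].
split; last by move=> u l h cu; split; [apply: c cu|apply: c' cu] => k; case: (h k).
by split=> [|x y [? ?] [? ?]|k x [? ?]|x y [? ?] [? ?]|x [? ?]]; split; auto.
Qed.

Let minimal_meet C M M' : inter C -> minimal_over C M -> minimal_over C M' -> M <> M' ->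
  forall x, M x -> M' x -> C x.
Proof.
move=> hC [hM CM MC minM] [hM' CM' MC' minM'] MM' x Mx Mx'.
have hI := inter_meet hM hM'.
have CI : (C `<=` M `&` M')%classic by move=> y Cy; split; [exact: CM|exact: CM'].
have [e|e] := minM _ hI CI (@subIsetl _ M M'); first by rewrite -e.
have [e'|e'] := minM' _ hI CI (@subIsetr _ M M'); first by rewrite -e'.
by case: MM'; rewrite -e e'.
Qed.

(** The packed points are the normalised [EF M - EF C] together with 0, which accounts for the
    successor. They live in the Euclidean space of the datum over [C], hence the dimension bound
    [idx C]. *)
Let minimal_count C (s : seq (set A)) : inter C -> uniq s ->
  (forall M, M \in s -> minimal_over C M) ->
  exists2 m : nat, m%:R <= idx C & ((size s).+1 <= 3 ^ m)%N.
Proof.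
move=> hC us sM; have d := datum hC; pose mu := sub_basis lam (EF C).
pose M i : set A := nth set0 s i.
have Mi i : (i < size s)%N -> minimal_over C (M i) by move=> si; apply/sM/mem_nth.
have hM i : (i < size s)%N -> inter (M i) by move=> /Mi[].
have tM i : (i < size s)%N -> sub_exp C (EF C) (M i) (EF (M i)).
  by move=> /Mi[hMi CM _ _]; exact: tower.
pose q i := rtr mu (EF (M i)) - 1.
have q1 i : (i < size s)%N -> 1 <= q i.
  by move=> /Mi[hMi CM MC _]; have := rtr_tower_ge2 hC hMi CM MC; rewrite /q; lra.
pose v i x := EF (M i) x - EF C x.
have bv i : (i < size s)%N -> bsa C (EF C) (v i).
  by move=> si; apply: (bsaB d); [exact: se_bsa (tM i si)|exact: bsa_E d].
pose c i := (Num.sqrt (q i))^-1.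
pose u i := if i is i'.+1 then (fun x => (c i')%:C *: v i' x) else (fun=> 0 : A).
have bu i : (i < (size s).+1)%N -> bsa C (EF C) (u i).
  by case: i => [|i] si; [exact: bsa0 d|apply: (bsaZ d); exact: bv].
have [m [x [mr xE]]] := gram_coords d bu; exists m => //.
have sq i' : (i' < size s)%N -> 0 < Num.sqrt (q i').
  by move=> si; rewrite sqrtr_gt0; have := q1 _ si; lra.
have uu i' : (i' < size s)%N -> ip mu (u i'.+1) (u i'.+1) = 1.
  move=> si; have b := bv _ si; have bz := bsaZ d (c i') b.
  rewrite /u (ipZl d _ b bz) (ip_sym d b bz) (ipZl d _ b b).
  rewrite (ip_seB d (tM _ si) (tM _ si)) -(rtr_idem mu (fun x => se_idem x (tM _ si))).
  have := sqr_sqrtr (le_trans ler01 (q1 _ si)); rewrite -/(q i') /c; move: (sq _ si).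
  move: (Num.sqrt _) => t t0 <-; rewrite expr2 mulKf ?mulVf ?gt_eqF //.
have uv i' j' : (i' < size s)%N -> (j' < size s)%N -> i' != j' ->
    2 * ip mu (u i'.+1) (u j'.+1) <= 1.
  move=> si sj nij; have bi := bv _ si; have bj := bv _ sj; have bz := bsaZ d (c j') bj.
  rewrite /u (ipZl d _ bi bz) (ip_sym d bi bz) (ipZl d _ bj bi) (ip_sym d bj bi).
  have MM : M i' <> M j'.
    by move=> /eqP; rewrite nth_uniq // (negbTE nij).
  have := angle_cos d (tM _ si) (tM _ sj) (minimal_meet hC (Mi _ si) (Mi _ sj) MM).
  rewrite -/(q i') -/(q j') -/mu -/(v i') -/(v j') /c; move: (sq _ si) (sq _ sj).
  move: (Num.sqrt (q i')) (Num.sqrt (q j')) (ip _ _ _) => a b t a0 b0 h.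
  have -> : 2 * (a^-1 * (b^-1 * t)) = 2 * t / (a * b).
    by field; rewrite !gt_eqF.
  by rewrite ler_pdivrMr ?mulr_gt0 // mul1r.
have u0 k : (k < (size s).+1)%N -> ip mu (u 0%N) (u k) = 0.
  by move=> sk; exact: (ip0l d (bu _ sk)).
(* Unit vectors with inner product at most 1/2 have squared distance at least [1 + 1 - 1]; the upper
   bound 4 comes from the square norm of their sum being nonnegative. *)
have far i j : (i < (size s).+1)%N -> (j < (size s).+1)%N -> i != j ->
    1 <= ip mu (u i) (u i) - 2 * ip mu (u i) (u j) + ip mu (u j) (u j) <= 4.
  move=> si sj ij; have bi := bu _ si; have bj := bu _ sj.
  have up : 0 <= ip mu (u i) (u i) + 2 * ip mu (u i) (u j) + ip mu (u j) (u j).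
    have := ip_ge0 d (bsaD d bi bj); rewrite -/mu (ipDl d bi bj (bsaD d bi bj)).
    rewrite (ip_sym d bi (bsaD d bi bj)) (ip_sym d bj (bsaD d bi bj)).
    rewrite !(ipDl d bi bj) // (ip_sym d bj bi) -/mu; lra.
  case: i j ij si sj bi bj up => [|i] [|j] // ij si sj bi bj up.
  - by rewrite !u0 // uu //; lra.
  - by rewrite (ip_sym d bi bj) -/mu !u0 // uu //; lra.
  - by rewrite !uu // in up *; have := uv _ _ si sj ij; lra.
apply: (@packing R m (size s).+1 (fun i a => x i a)) => i j ij.
have -> : \sum_(a < m) (x i a - x j a) ^+ 2 =
    ip mu (u i) (u i) - 2 * ip mu (u i) (u j) + ip mu (u j) (u j).
  by rewrite !xE // mulr_sumr -sumrN -!big_split; apply: eq_bigr => a _ /=; ring.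
exact: far.
Qed.

(** Every [D] other than [C] is charged to one minimal algebra [mn D] below it, whose index is at
    most half of [idx C]; [k] is the induction measure. *)
Let count_bound (k : nat) C (s : seq (set A)) : inter C -> idx C < 2 ^+ k -> uniq s ->
  (forall D, D \in s -> inter D /\ (C `<=` D)%classic) -> (size s)%:R <= 9 `^ idx C.
Proof.
elim: k C s => [|k IH] C s hC ik us sD.
  by have := idx_ge1 hC; rewrite expr0 in ik; lra.
pose s' := [seq D <- s | D != C].
have exM D : exists M, D \in s' -> minimal_over C M /\ (M `<=` D)%classic.
  have [Ds|nDs] := boolP (D \in s'); last by exists C.
  move: Ds; rewrite mem_filter => /andP[/eqP DC /sD[hDD CD]].
  have [M mM MD] : exists2 M, minimal_over C M & (M `<=` D)%classic.
    have [j hj] : exists j, idx C <= 2 ^+ j.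
      by exists k.+1; exact: ltW.
    apply: (minimal_exists hC hDD CD DC (k := j)); apply: le_trans hj _.
    by rewrite ler_peMr ?exprn_ge0 // idx_ge1.
  by exists M.
pose mn D := projT1 (cid (exM D)).
have mnP D : D \in s' -> minimal_over C (mn D) /\ (mn D `<=` D)%classic.
  by rewrite /mn; case: cid.
pose ms := undup [seq mn D | D <- s'].
have [m mi ms3] : exists2 m : nat, m%:R <= idx C & ((size ms).+1 <= 3 ^ m)%N.
  apply: minimal_count => //; first exact: undup_uniq.
  by move=> M; rewrite mem_undup => /mapP[D /mnP[mM _] ->].
pose X := 3 `^ idx C : R.
have X9 : 9 `^ idx C = X * X.
  have -> : 9 = 3 * 3 :> R by rewrite -natrM.
  by rewrite powRM.
have XM M : M \in ms -> 9 `^ idx M <= X.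
  rewrite mem_undup => /mapP[D /mnP[[hM CM MC _] _] ->].
  have h2 := idx_half hC hM CM MC.
  have -> : X = 9 `^ (idx C / 2).
    have -> : 9 = 3 `^ 2 :> R by rewrite powR_mulrn // -natrX.
    by rewrite -powRrM mulrCA divff ?mulr1 ?pnatr_eq0.
  by apply: ler_powR; [rewrite ler1n|lra].
have kX : (size ms)%:R + 1 <= X.
  rewrite natr1 (le_trans (_ : _ <= (3 ^ m)%:R)) ?ler_nat //.
  rewrite natrX -powR_mulrn //; apply: ler_powR => //; by rewrite ler1n.
have X1 : 1 <= X by have : 0 <= (size ms)%:R :> R by []; lra.
have szs : (size s <= (size s').+1)%N.
  rewrite size_filter -(count_predC (pred1 C) s) count_uniq_mem //.
  by case: (C \in s); rewrite /= ?add0n ?add1n.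
have szs' : (size s')%:R <= (size ms)%:R * X.
  have -> : size s' = (\sum_(M <- ms) count (fun D => mn D == M) s')%N.
    rewrite -sum1_size (eq_big_seq (fun D => \sum_(M <- ms | mn D == M) 1)%N) => [|D Ds].
      rewrite (exchange_big_dep xpredT) //=; apply: eq_bigr => M _.
      by rewrite sum1_count.
    rewrite sum1_count -(eq_count (a1 := pred1 (mn D))) => [|M]; last exact: eq_sym.
    by rewrite count_uniq_mem ?undup_uniq // mem_undup map_f.
  rewrite natr_sum.
  apply: (@le_trans _ _ (\sum_(M <- ms) X)); last first.
    by rewrite big_const_seq count_predT iter_addr_0 mulr_natl.
  rewrite big_seq [X in _ <= X]big_seq; apply: ler_sum => M Mms.
  apply: le_trans (XM M Mms); rewrite -size_filter.
  have : M \in [seq mn D | D <- s'] by rewrite -mem_undup.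
  case/mapP => D0 /mnP[[hM CM MC _] _] eM; rewrite -eM in hM CM MC.
  apply: IH => //.
  - have := idx_half hC hM CM MC; rewrite exprS in ik; lra.
  - by rewrite !filter_uniq.
  - move=> D; rewrite mem_filter => /andP[/eqP <- Ds'].
    have [_ MD] := mnP _ Ds'; split=> //.
    by move: Ds'; rewrite mem_filter => /andP[_ /sD[]].
have : (size s)%:R <= (size s')%:R + 1 :> R by rewrite natr1 ler_nat.
by rewrite X9; move: ((size s)%:R) ((size s')%:R) ((size ms)%:R) kX szs' => *; nra.
Qed.

Lemma intermediate_count (s : seq (set A)) : uniq s ->
  (forall D, D \in s -> intermediate nrm star B D) -> (size s)%:R <= 9 `^ r.
Proof.
move=> us sD; have hB : inter B by split=> //; have [] := id_sub hD.
have e : EF B = E.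
  apply/funext => x; have h := EFP hB.
  by rewrite -(se_E h) (be_id (id_exp hD)) //; exact: be_mem (se_exp h) x.
have ir : idx B = r by rewrite /idx e (rtr_E hD) divr1.
rewrite -ir; have [k hk] : exists k, idx B < 2 ^+ k.
  exists (Num.bound `|idx B|); apply: (le_lt_trans (ler_norm _)).
  apply: (lt_le_trans (archi_boundP (normr_ge0 _))).
  by rewrite -natrX ler_nat ltnW // ltn_expl.
by apply: (count_bound hB hk us) => D /sD hDD; split=> //; case: hDD.
Qed.

End Count.

End CStarAlgebra.

(** Were no finite list exhaustive, lists could be extended one element at a time beyond [N]. This
    turns a bound on finite families of intermediate algebras into their finiteness. *)
Lemma bounded_enum (T : eqType) (P : T -> Prop) (N : nat) :
  (forall s : seq T, uniq s -> (forall x, x \in s -> P x) -> (size s <= N)%N) ->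
  exists s : seq T, [/\ uniq s, (forall x, x \in s -> P x) & forall x, P x -> x \in s].
Proof.
move=> hN; apply: contrapT => no.
have grow k : exists s : seq T, [/\ uniq s, (forall x, x \in s -> P x) & size s = k].
  elim: k => [|k [s [us sP sk]]]; first by exists [::].
  have [x [Px xs]] : exists x, P x /\ x \notin s.
    apply: contrapT => h; apply: no; exists s; split=> // x Px.
    by apply/negPn/negP => xs; apply: h; exists x.
  exists (x :: s); split; [by rewrite /= xs| |by rewrite /= sk].
  by move=> y; rewrite inE => /predU1P[->|/sP].
have [s [us sP sN]] := grow N.+1.
by have := hN s us sP; rewrite sN ltnn.
Qed.

Theorem theorem3p5 (R : realType) (A : algType R[i])
  (nrm : A -> R) (star : A -> A)
  (hA : is_unital_cstar_algebra nrm star)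
  (hAs : simple_cstar nrm (fun _ : A => True))
  (B : A -> Prop)
  (hB : unital_cstar_subalgebra nrm star B)
  (hBs : simple_cstar nrm B)
  (hirr : irreducible_inclusion B)
  (r : R) (hr : minimal_index nrm star B r) :
  exists (n : nat) (Cs : 'I_n -> (A -> Prop)),
    (forall C, intermediate nrm star B C -> exists i, C = Cs i) /\
    (n%:R <= powR 9 r).
Proof.
have [[E [hE [n [lam [qb ind]]]]] _] := hr.
have hD : index_datum nrm star B E lam r.
  split=> //; split.
  - exact: E_lin hE.
  - exact: E_B hE.
  - exact: E_id hE.
  - by move=> x; rewrite (E_star hA hB hE).
  - by move=> b x Bb; rewrite (E_left hA hB hBs hirr hE).
  - by move=> b x Bb; rewrite (E_right hA hB hBs hirr hE).
  - by move=> x px; apply: (E_pos hA hB hE).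
have bound s := intermediate_count hA hD hBs (s := s).
have [|s [us sP sC]] := @bounded_enum _ (intermediate nrm star B) (Num.truncn (9 `^ r)).
  by move=> s us sP; rewrite truncn_ge_nat ?powR_ge0 //; exact: bound.
exists (size s), (fun i => nth set0 s i); split; last exact: bound.
move=> C /sC Cs; have := Cs; rewrite -index_mem => iC.
by exists (Ordinal iC); rewrite /= nth_index.
Qed.
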